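(* Let $n\ge 1$, let $h:[0,\infty)\to[0,\infty)$ be a continuous function with $\int_0^\infty r^{2m+2n-1}e^{-2h(r)}\,dr<\infty$ for every $m\in\mathbb{N}_0$, let $\mathbf{m}=(b_1,\dots,b_k)$ be a partition of $n=b_1+\dots+b_k$, and let $\mathbf{U_m}:=\mathrm{U}(b_1)\times\dots\times\mathrm{U}(b_k)$. Then the $C^*$-algebra $\mathcal{T}(\mathcal{A}_h(\mathbb{C}^n))^{\mathbf{U_m}}$ generated by all Toeplitz operators $T_\varphi$ on $\mathcal{A}_h(\mathbb{C}^n)$ with symbols $\varphi\in L^\infty(\mathbb{C}^n)$ invariant under $\mathbf{U_m}$ is commutative.
   Context: $\mathbb{N}_0=\{0,1,2,\dots\}$. Put $h(z):=h(|z|)$ for $z\in\mathbb{C}^n$. $L^2_h(\mathbb{C}^n)$ is the Hilbert space of (classes of) Lebesgue measurable functions $f$ on $\mathbb{C}^n$ with $\|f\|_h^2=\int_{\mathbb{C}^n}|f(z)|^2e^{-2h(z)}\,dz<\infty$, where $dz$ is Lebesgue measure. The radially weighted Fock space $\mathcal{A}_h(\mathbb{C}^n)$ is the closed subspace of entire functions in $L^2_h(\mathbb{C}^n)$, and $P:L^2_h(\mathbb{C}^n)\to\mathcal{A}_h(\mathbb{C}^n)$ is the orthogonal projection. For $\varphi\in L^\infty(\mathbb{C}^n)$ the Toeplitz operator on $\mathcal{A}_h(\mathbb{C}^n)$ is $T_\varphi f=P(\varphi f)$. The partition consists of positive integers; the group $\mathbf{U_m}$ is embedded block-diagonally in $\mathrm{U}(n)$,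 acting on $\mathbb{C}^n=\mathbb{C}^{b_1}\times\dots\times\mathbb{C}^{b_k}$. A symbol $\varphi\in L^\infty(\mathbb{C}^n)$ is invariant under a subgroup $G\subseteq\mathrm{U}(n)$ if $\varphi(g^{-1}z)=\varphi(z)$ (as elements of $L^\infty(\mathbb{C}^n)$) for all $g\in G$. *)

(* Defs.v *)
From HB Require Import structures.
From mathcomp Require Import all_boot all_order all_algebra.
From mathcomp Require Import complex.
From mathcomp Require Import all_classical all_reals all_analysis.
From mathcomp Require Import measurable_realfun.
From mathcomp Require Import lra.

Set Implicit Arguments.
Unset Strict Implicit.
Unset Printing Implicit Defensive.

Import Order.TTheory GRing.Theory Num.Theory.
Import numFieldNormedType.Exports.
Import ComplexField.Normc.

Local Open Scope classical_set_scope.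
Local Open Scope ring_scope.
Local Open Scope complex_scope.

(* [m1 \x m2] is sigma-finite, but the canonical instance recorded for it is
   that of subprobabilities, hence this lemma. *)
Lemma sigma_finite_product d1 d2 (T1 : measurableType d1)
    (T2 : measurableType d2) (R : realType)
    (m1 : {sigma_finite_measure set T1 -> \bar R})
    (m2 : {sigma_finite_measure set T2 -> \bar R}) :
  sigma_finite setT (m1 \x m2)%E.
Proof.
have /sigma_finiteP[F [TF ndF Foo]] := sigma_finiteT m1.
have /sigma_finiteP[G [TG ndG Goo]] := sigma_finiteT m2.
exists (fun n => F n `*` G n).
  rewrite -setXTT TF TG predeqE => -[x y]; split.
    move=> [/= [n _ Fnx] [k _ Gky]]; exists (maxn n k) => //; split.
    - by move: x Fnx; exact/subsetPset/ndF/leq_maxl.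
    - by move: y Gky; exact/subsetPset/ndG/leq_maxr.
  by move=> [n _ []/= ? ?]; split; exists n.
move=> k; have [? ?] := Foo k; have [? ?] := Goo k.
split; first exact: measurableX.
by rewrite product_measure1E// lte_mul_pinfty// ge0_fin_numE.
Qed.

Section tuple_measure.
Context d (T : measurableType d) (R : realType).
Variable mu : {sigma_finite_measure set T -> \bar R}.

Definition tcons n (p : T * n.-tuple T) : n.+1.-tuple T := [tuple of p.1 :: p.2].

Lemma measurable_tcons n : measurable_fun setT (@tcons n).
Proof. exact: measurable_cons. Qed.

Section step.
Variables (n : nat) (nu : {sigma_finite_measure set (n.-tuple T) -> \bar R}).

Definition tuple_measureS : set (n.+1.-tuple T) -> \bar R :=
  pushforward (mu \x nu)%E (@tcons n).

Let tuple_measureS0 : tuple_measureS set0 = 0%E.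
Proof. by rewrite /tuple_measureS /pushforward preimage_set0 measure0. Qed.

Let tuple_measureS_ge0 A : (0 <= tuple_measureS A)%E.
Proof. by rewrite /tuple_measureS /pushforward; exact: measure_ge0. Qed.

Let tuple_measureS_sigma_additive : semi_sigma_additive tuple_measureS.
Proof.
move=> F mF tF mUF; rewrite /tuple_measureS /pushforward preimage_bigcup.
apply: measure_semi_sigma_additive.
- by move=> i; rewrite -[X in measurable X]setTI; exact: measurable_tcons.
- apply/trivIsetP => /= i j _ _ ij; rewrite -preimage_setI.
  by move/trivIsetP : tF => /(_ _ _ _ _ ij) ->//; rewrite preimage_set0.
- by rewrite -preimage_bigcup -[X in measurable X]setTI; exact: measurable_tcons.
Qed.

HB.instance Definition _ := isMeasure.Build _ _ _ tuple_measureS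
  tuple_measureS0 tuple_measureS_ge0 tuple_measureS_sigma_additive.

Let tuple_measureS_sigma_finite : sigma_finite setT tuple_measureS.
Proof.
have [F TF Foo] := sigma_finite_product mu nu.
pose unc (t : n.+1.-tuple T) : T * n.-tuple T := (thead t, [tuple of behead t]).
have uncK : cancel (@tcons n) unc.
  by case=> x t; rewrite /unc /tcons theadE; congr pair; exact: val_inj.
have tconsK : cancel unc (@tcons n).
  by move=> t; rewrite /tcons /= [RHS]tuple_eta.
have munc : measurable_fun setT unc.
  apply/measurable_fun_pairP; split => /=.
    exact: (@measurable_tnth _ T _ ord0).
  exact: measurable_behead.
exists (fun i => unc @^-1` F i).
  by rewrite -preimage_bigcup -TF preimage_setT.
move=> i; have [mFi Fioo] := Foo i; split.
  by rewrite -[X in measurable X]setTI; exact: munc.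
rewrite /tuple_measureS /pushforward -comp_preimage.
by rewrite (_ : unc \o @tcons n = id) ?preimage_id//; apply/funext => p /=.
Qed.

HB.instance Definition _ := Measure_isSigmaFinite.Build _ _ _ tuple_measureS
  tuple_measureS_sigma_finite.

End step.

Fixpoint tuple_measure n : {sigma_finite_measure set (n.-tuple T) -> \bar R} :=
  if n is m.+1 then tuple_measureS (tuple_measure m) else dirac [tuple].

End tuple_measure.

HB.instance Definition _ (R : realType) := isPointed.Build R[i] 0.

Section lebesgue_Cn.
Variable R : realType.

Definition lebesgue_R2 :
    set (measurableTypeR R * measurableTypeR R)%type -> \bar R :=
  (@lebesgue_measure R \x @lebesgue_measure R)%E.

HB.instance Definition _ := Measure.on lebesgue_R2.
HB.instance Definition _ := Measure_isSigmaFinite.Build _ _ _ lebesgue_R2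
  (sigma_finite_product (@lebesgue_measure R) (@lebesgue_measure R)).

Variable n : nat.

Definition cvec (t : n.-tuple (measurableTypeR R * measurableTypeR R)%type) :
    'cV[R[i]]_n :=
  \col_j ((tnth t j).1 +i* (tnth t j).2).

(* The outer measure induced on C^n by the Borel measure on (R^2)^n; its
   Caratheodory-measurable sets are the Lebesgue measurable sets. *)
Definition lebesgue_outer (A : set 'cV[R[i]]_n) : \bar R :=
  mu_ext (tuple_measure lebesgue_R2 n) (cvec @^-1` A).

Let lebesgue_outer0 : lebesgue_outer set0 = 0%E.
Proof. by rewrite /lebesgue_outer preimage_set0 outer_measure0. Qed.

Let lebesgue_outer_ge0 A : (0 <= lebesgue_outer A)%E.
Proof. exact: outer_measure_ge0. Qed.

Let le_lebesgue_outer :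
  {homo lebesgue_outer : A B / A `<=` B >-> (A <= B)%E}.
Proof. by move=> A B AB; apply: le_outer_measure; exact: preimage_subset. Qed.

Let lebesgue_outer_sigma_subadditive : sigma_subadditive lebesgue_outer.
Proof.
move=> F; rewrite /lebesgue_outer preimage_bigcup.
exact: outer_measure_sigma_subadditive.
Qed.

HB.instance Definition _ := isOuterMeasure.Build R _ lebesgue_outer
  lebesgue_outer0 lebesgue_outer_ge0 le_lebesgue_outer
  lebesgue_outer_sigma_subadditive.

Definition Cn := caratheodory_type lebesgue_outer.

HB.instance Definition _ := Measurable.on Cn.

Definition lebesgue_Cn : set Cn -> \bar R := lebesgue_outer.

Let outer : {outer_measure set 'cV[R[i]]_n -> \bar R} := lebesgue_outer.

HB.instance Definition _ := isMeasure.Build _ Cn R lebesgue_Cn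
  (caratheodory_measure0 outer) (@caratheodory_measure_ge0 _ _ outer)
  (@caratheodory_measure_sigma_additive _ _ outer).

Lemma lebesgue_measurable_Borel (A : set 'cV[R[i]]_n) :
  measurable (cvec @^-1` A) -> measurable (A : set Cn).
Proof.
move=> mA; suff : caratheodory_measurable lebesgue_outer A by [].
move=> X; exact: (@caratheodory_measurable_mu_ext _ _ _
  (tuple_measure lebesgue_R2 n) _ mA (cvec @^-1` X)).
Qed.

End lebesgue_Cn.
Arguments lebesgue_Cn {R n}.

Section weight.
Variables (R : realType) (n : nat) (h : R -> R).

Definition cnorm (z : Cn R n) : R := Num.sqrt (\sum_j normc (z j 0) ^+ 2).

Definition weight (z : Cn R n) : R := expR (- 2 * h (cnorm z)).

Lemma normc_sqr (c : R[i]) : normc c ^+ 2 = complex.Re c ^+ 2 + complex.Im c ^+ 2.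
Proof. by case: c => x y /=; rewrite sqr_sqrtr// addr_ge0// sqr_ge0. Qed.

Lemma measurable_weight :
  {within `[0, +oo[, continuous h} -> measurable_fun setT weight.
Proof.
move=> hc; have mh : measurable_fun (`[0, +oo[ : set R) h.
  exact: subspace_continuous_measurable_fun.
have mcnorm : measurable_fun setT (cnorm \o @cvec R n).
  pose q (t : n.-tuple (measurableTypeR R * measurableTypeR R)%type) : R :=
    \sum_j ((tnth t j).1 ^+ 2 + (tnth t j).2 ^+ 2).
  have -> : cnorm \o @cvec R n = Num.sqrt \o q.
    apply/funext => t; rewrite /cnorm /q /=; congr Num.sqrt.
    by apply: eq_bigr => j _; rewrite mxE normc_sqr.
  have mq : measurable_fun setT q.
    apply: measurable_sum => j; apply: measurable_funD; apply: measurable_funX.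
    - have mt := @measurable_tnth _ (measurableTypeR R * measurableTypeR R)%type n j.
      exact: (measurableT_comp measurable_fst mt).
    - have mt := @measurable_tnth _ (measurableTypeR R * measurableTypeR R)%type n j.
      exact: (measurableT_comp measurable_snd mt).
  apply: (measurableT_comp _ mq).
  by apply: continuous_measurable_fun => x; exact: sqrt_continuous.
suff mw : measurable_fun setT (weight \o @cvec R n).
  move=> _ Y mY; rewrite setTI; apply: lebesgue_measurable_Borel.
  by rewrite -comp_preimage -[X in measurable X]setTI; exact: mw.
have mhc : measurable_fun setT (h \o (cnorm \o @cvec R n)).
  refine (measurable_comp _ _ mh mcnorm); first exact: measurable_itv.
  by move=> _ [t _ <-] /=; rewrite in_itv /= andbT sqrtr_ge0.
have m2 := measurable_funM (@measurable_cst _ _ _ _ setT (- 2 : R)) mhc.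
exact: (measurableT_comp (@measurable_expR R) m2).
Qed.

End weight.

Section fock.
Variables (R : realType) (n : nat) (h : R -> R).
Implicit Types f g : Cn R n -> R[i].

Definition Cmeasurable f :=
  measurable_fun setT (fun z => complex.Re (f z)) /\
  measurable_fun setT (fun z => complex.Im (f z)).

Definition in_L2h f :=
  Cmeasurable f /\
  (\int[lebesgue_Cn]_z (normc (f z) ^+ 2 * weight h z)%:E < +oo)%E.

Definition Cintegral f : R[i] :=
  (\int[lebesgue_Cn]_z complex.Re (f z)) +i* (\int[lebesgue_Cn]_z complex.Im (f z)).

Definition L2h_inner f g : R[i] :=
  Cintegral (fun z => f z * (g z)^* * (weight h z)%:C).

Definition in_Linfty f :=
  Cmeasurable f /\
  exists M : R, {ae lebesgue_Cn, forall z, normc (f z) <= M}.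

Definition entire (f : 'cV[R[i]]_n -> R[i]) :=
  forall z, differentiable (f : _ -> R[i]^o) z.

(* An element of A_h(C^n) is represented by its entire representative, which is
   unique because two continuous functions equal almost everywhere are equal. *)
Definition fock : {pred 'cV[R[i]]_n -> R[i]} :=
  [pred f | `[< in_L2h f /\ entire f >]].

Hypothesis h_cont : {within `[0, +oo[, continuous h}.

Lemma Cmeasurable_lin (a : R[i]) f g :
  Cmeasurable f -> Cmeasurable g -> Cmeasurable (fun z => a * f z + g z).
Proof.
move=> [mRf mIf] [mRg mIg]; case: a => a b.
have ReE z : complex.Re ((a +i* b) * f z + g z) =
    a * complex.Re (f z) - b * complex.Im (f z) + complex.Re (g z).
  by case: (f z) => ? ?; case: (g z).
have ImE z : complex.Im ((a +i* b) * f z + g z) =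
    a * complex.Im (f z) + b * complex.Re (f z) + complex.Im (g z).
  by case: (f z) => ? ?; case: (g z).
have mZ (r : R) (k : Cn R n -> R) : measurable_fun setT k ->
    measurable_fun setT (fun z => r * k z).
  by move=> mk; apply: measurable_funM; [exact: measurable_cst|exact: mk].
split.
- under eq_fun do rewrite ReE.
  apply: measurable_funD; last exact: mRg.
  by apply: measurable_funB; [exact: mZ mRf|exact: mZ mIf].
- under eq_fun do rewrite ImE.
  apply: measurable_funD; last exact: mIg.
  by apply: measurable_funD; [exact: mZ mIf|exact: mZ mRf].
Qed.

Lemma normc_lin_le (a u v : R[i]) :
  normc (a * u + v) ^+ 2 <= 2 * normc a ^+ 2 * normc u ^+ 2 + 2 * normc v ^+ 2.
Proof.
have -> : 2 * normc a ^+ 2 * normc u ^+ 2 = 2 * normc (a * u) ^+ 2.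
  by rewrite normcM exprMn -mulrA.
move: (a * u) => {a u} w; case: w v => [x y] [s t].
rewrite !normc_sqr /=.
have := sqr_ge0 (x - s); have := sqr_ge0 (y - t); rewrite !sqrrB !sqrrD.
by move=> *; lra.
Qed.

Lemma in_L2h_lin (a : R[i]) f g :
  in_L2h f -> in_L2h g -> in_L2h (fun z => a * f z + g z).
Proof.
move=> [mf foo] [mg goo]; split; first exact: Cmeasurable_lin.
have mw := @measurable_weight R n h h_cont.
pose q (k : Cn R n -> R[i]) z : \bar R := (normc (k z) ^+ 2 * weight h z)%:E.
have mq k : Cmeasurable k -> measurable_fun setT (q k).
  move=> [mR mI]; apply/measurable_EFinP; apply: measurable_funM; last exact: mw.
  under eq_fun do rewrite normc_sqr.
  by apply: measurable_funD; [exact: measurable_funX mR|exact: measurable_funX mI].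
have q0 k z : (0 <= q k z)%E by rewrite lee_fin mulr_ge0// ?sqr_ge0// expR_ge0.
pose c := 2 * normc a ^+ 2.
have c0 : (0 <= c%:E)%E by rewrite lee_fin mulr_ge0// sqr_ge0.
have d0 : (0 <= 2%:E :> \bar R)%E by rewrite lee_fin.
have mcf : measurable_fun setT (fun z => c%:E * q f z)%E.
  exact: measurable_funeM (mq _ mf).
have mdg : measurable_fun setT (fun z => 2%:E * q g z)%E.
  exact: measurable_funeM (mq _ mg).
have le_q : (\int[lebesgue_Cn]_z q (fun z => a * f z + g z)%R z <=
    \int[lebesgue_Cn]_z (c%:E * q f z + 2%:E * q g z))%E.
  apply: ge0_le_integral.
  - exact: measurableT.
  - by move=> z _; exact: q0.
  - exact/mq/Cmeasurable_lin.
  - exact: emeasurable_funD mcf mdg.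
  - move=> z _; rewrite /q -!EFinM -EFinD lee_fin.
    rewrite [c * _]mulrA [2 * (_ * _)]mulrA -mulrDl ler_wpM2r ?expR_ge0//.
    exact: normc_lin_le.
apply: (le_lt_trans le_q).
rewrite ge0_integralD; [|exact: measurableT|by move=> z _; exact: mule_ge0
  |exact: mcf|by move=> z _; exact: mule_ge0|exact: mdg].
rewrite (@ge0_integralZl _ _ _ lebesgue_Cn _ measurableT _ (mq _ mf) _
  (fun z _ => q0 f z) c0).
rewrite (@ge0_integralZl _ _ _ lebesgue_Cn _ measurableT _ (mq _ mg) _
  (fun z _ => q0 g z) d0).
by apply: lte_add_pinfty; apply: lte_mul_pinfty.
Qed.

Lemma fock_submod_closed : submod_closed fock.
Proof.
split.
  apply/asboolP; split; last by move=> z; exact: differentiable_cst.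
  split; first by split; exact: measurable_cst.
  under eq_integral do rewrite normc_sqr /= expr0n /= addr0 mul0r.
  by rewrite integral0.
move=> a f g /asboolP[Lf ef] /asboolP[Lg eg]; apply/asboolP; split.
  exact: in_L2h_lin.
move=> z; apply: (@differentiableD _ _ (R[i]^o)); last exact: eg.
exact: (@differentiableZ _ _ (R[i]^o)).
Qed.

End fock.

Section fock_space.
Variables (R : realType) (n : nat) (h : R -> R).

(* The continuity proof is a parameter because the vector space structure relies
   on the measurability of the weight. *)
Record fock_space (hc : {within `[0, +oo[, continuous h}) := FockSpace {
  fock_val :> 'cV[R[i]]_n -> R[i] ;
  fock_valP : fock_val \in fock h }.

Variable h_cont : {within `[0, +oo[, continuous h}.

Local Notation A_h := (fock_space h_cont).

HB.instance Definition _ := [isSub for @fock_val h_cont].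
HB.instance Definition _ := [Choice of A_h by <:].
HB.instance Definition _ := GRing.SubChoice_isSubLmodule.Build R[i]
  ('cV[R[i]]_n -> R[i]) (fock h) A_h (@fock_submod_closed R n h h_cont).

Definition fock_inner (f g : A_h) : R[i] := L2h_inner h f g.

(* The orthogonal projection P of f, for f in L^2_h: the g in A_h such that
   f - g is orthogonal to A_h. *)
Definition fock_proj (f : 'cV[R[i]]_n -> R[i]) : A_h :=
  xget 0 [set g : A_h | forall u : A_h, L2h_inner h (f \- g) u = 0].

Definition toeplitz (phi : 'cV[R[i]]_n -> R[i]) (f : A_h) : A_h :=
  fock_proj (fun z => phi z * f z).

End fock_space.
Arguments fock_space {R} n {h} hc.

Section cstar.
Variables (R : realType) (H : lmodType R[i]) (ip : H -> H -> R[i]).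

(* [ip] stands for the inner product of the Hilbert space H. *)
Definition hnorm (f : H) : R := Num.sqrt (complex.Re (ip f f)).

Definition bounded_operator (T : H -> H) :=
  linear T /\ exists M : R, forall f, hnorm (T f) <= M * hnorm f.

Definition is_adjoint (T S : H -> H) := forall f g, ip (T f) g = ip f (S g).

Record cstar_subalgebra (A : set (H -> H)) : Prop := {
  cstar_bounded : A `<=` bounded_operator ;
  cstar0 : A (cst 0) ;
  cstar_lin : forall (a : R[i]) S T, A S -> A T -> A (a *: S + T) ;
  cstar_comp : forall S T, A S -> A T -> A (S \o T) ;
  cstar_adjoint : forall T S, A T -> bounded_operator S -> is_adjoint T S -> A S ;
  cstar_closed : forall T, bounded_operator T ->
    (forall e : R, 0 < e ->
       exists2 S, A S & forall f, hnorm (S f - T f) <= e * hnorm f) -> A T }.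

Definition cstar_generated (G : set (H -> H)) : set (H -> H) :=
  smallest cstar_subalgebra G.

End cstar.

Section toeplitz_algebra.
Variables (R : realType) (n : nat).

Definition block_unitary k (b : 'I_k -> nat) (b_sum : (\sum_(i < k) b i)%N = n) :
    set 'M[R[i]]_n :=
  [set g | exists2 B : forall i, 'M[R[i]]_(b i),
    forall i, B i \is unitarymx & g = castmx (b_sum, b_sum) (\mxdiag_(i < k) B i)].

Definition invariant_symbol (G : set 'M[R[i]]_n) (phi : 'cV[R[i]]_n -> R[i]) :=
  forall g, G g -> {ae @lebesgue_Cn R n, forall z, phi (invmx g *m z) = phi z}.

Definition toeplitz_algebra (h : R -> R)
    (h_cont : {within `[0, +oo[, continuous h}) (G : set 'M[R[i]]_n) :
    set (fock_space n h_cont -> fock_space n h_cont) :=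
  cstar_generated (@fock_inner R n h h_cont)
    [set toeplitz (h_cont := h_cont) phi | phi in
      [set phi | in_Linfty phi /\ invariant_symbol G phi]].

End toeplitz_algebra.
Arguments toeplitz_algebra {R n h} h_cont G.

(* Main.v *)
(* U_m contains all diagonal unitary matrices, so an invariant symbol phi is
   unchanged when one coordinate of z is rotated.  As Lebesgue measure and the
   weight have the same symmetry, phi z^x is orthogonal to z^y on every ball
   centred at 0 for multi-indices x <> y.  Expanding entire functions in power
   series and letting the radius of the ball go to infinity, every T_phi is
   diagonal in the orthogonal family of the monomials, which spans a dense
   subspace.  The bounded operators that are diagonal in the monomials form a
   commutative C*-algebra.  The power series expansion itself comes from
   Goursat's argument: the integral of F(z) dz / (z - w) over a circle is
   computed by contracting the circle to w; the several variables are then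
   expanded one after the other. *)
Require Import Defs.
From HB Require Import structures.
From mathcomp Require Import all_boot all_order all_algebra.
From mathcomp Require Import complex.
From mathcomp Require Import all_classical all_reals all_analysis.
From mathcomp Require Import measurable_realfun.
From mathcomp Require Import ring lra.

Set Implicit Arguments.
Unset Strict Implicit.
Unset Printing Implicit Defensive.

Import Order.TTheory GRing.Theory Num.Theory.
Import numFieldNormedType.Exports.
Import ComplexField.Normc.

Local Open Scope classical_set_scope.
Local Open Scope ring_scope.
Local Open Scope complex_scope.

(** * Taylor expansion in one complex variable *)

Section segment_integral.
Variable R : realType.
Implicit Types (f g : R -> R) (a b c : R).

(** [entire] asks for differentiability at each point and gives no continuity of partial
    derivatives; hence the bisection proof of Green's theorem, and estimates for functions of
    several variables that depend only on a local supremum. The weight has finite polynomial moments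
    and no further decay is assumed, so the power series of an entire function in L^2 has no evident
    majorant on all of C^n. Balls supply the domination; convergence in norm is extracted afterwards
    from Pythagoras' identity and Fatou's lemma. Since [fock_proj] is a choice among candidates, a
    projection of [phi u] has to be exhibited: it is the function whose Taylor coefficients are
    those of [u] times the eigenvalues of [phi], and it must be shown to be entire and square
    integrable. Lebesgue measure being a Caratheodory extension, its rotation invariance has to be
    proved for outer measures of arbitrary sets. The moment hypothesis concerns one real variable;
    dilations and Fubini's theorem carry it to C^n. *)

Definition segint f a b : R := \int[@lebesgue_measure R]_(x in `[a, b]) f x.

Lemma segint_integrable f a b : continuous f ->
  (@lebesgue_measure R).-integrable `[a, b] (EFin \o f).
Proof.
move=> cf; apply: continuous_compact_integrable; first exact: segment_compact.
exact: continuous_subspaceT.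
Qed.

Lemma segint_cst c a b : a <= b -> segint (cst c) a b = c * (b - a).
Proof.
move=> ab; rewrite /segint Rintegral_cst//= lebesgue_measure_itv /= lte_fin.
by case: ltP => [//|ba]; rewrite (le_anti (introT andP (conj ab ba))) subrr.
Qed.

Lemma segintD f g a b : continuous f -> continuous g ->
  segint (fun x => f x + g x) a b = segint f a b + segint g a b.
Proof. by move=> cf cg; rewrite /segint RintegralD//; exact: segint_integrable. Qed.

Lemma segintB f g a b : continuous f -> continuous g ->
  segint (fun x => f x - g x) a b = segint f a b - segint g a b.
Proof. by move=> cf cg; rewrite /segint RintegralB//; exact: segint_integrable. Qed.

Lemma segintZ c f a b : continuous f ->
  segint (fun x => c * f x) a b = c * segint f a b.
Proof. by move=> cf; rewrite /segint RintegralZl//; exact: segint_integrable. Qed.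

Lemma segint_cat f a b c : continuous f -> a <= b -> b <= c ->
  segint f a c = segint f a b + segint f b c.
Proof.
move=> cf ab bc; apply/eqP; rewrite addrC -subr_eq; apply/eqP.
rewrite /segint Rintegral_itvB ?bnd_simp//; last exact: segint_integrable.
rewrite Rintegral_itv_obnd_cbnd//.
apply: integrableS (segint_integrable b c cf) => //.
by apply: subset_itvr; rewrite bnd_simp.
Qed.

Lemma segint_near f a b c e : continuous f -> a <= b ->
  (forall x, a <= x <= b -> `|f x - c| <= e) ->
  `|segint f a b - c * (b - a)| <= e * (b - a).
Proof.
move=> cf ab fce.
have cc d : continuous (cst d : R -> R) by move=> x; exact: cvg_cst.
rewrite -segint_cst// -segintB//.
have cfc : continuous (fun x => f x - c).
  by move=> x; apply: cvgB; [exact: cf|exact: cvg_cst].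
rewrite ler_norml; apply/andP; split.
  rewrite -mulNr -segint_cst//; apply: le_Rintegral => //.
  - exact/segint_integrable/cc.
  - exact: segint_integrable.
  - by move=> x; rewrite /= in_itv /= => /fce; rewrite ler_norml => /andP[].
rewrite -segint_cst//; apply: le_Rintegral => //.
- exact: segint_integrable.
- exact/segint_integrable/cc.
- by move=> x; rewrite /= in_itv /= => /fce; rewrite ler_norml => /andP[].
Qed.

Lemma segint_le_norm f a b e : continuous f -> a <= b ->
  (forall x, a <= x <= b -> `|f x| <= e) -> `|segint f a b| <= e * (b - a).
Proof.
move=> cf ab fe; rewrite -[segint f a b]subr0 -(mul0r (b - a)).
by apply: segint_near => // x xab; rewrite subr0; exact: fe.
Qed.

Lemma segint_derive f (F : R -> R) a b : a < b -> continuous f ->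
  (forall x, is_derive x (1 : R) F (f x)) -> segint f a b = F b - F a.
Proof.
move=> ab cf dF.
have dFx x : derivable F x (1 : R) by case: (dF x).
have cF : continuous F by move=> x; exact/differentiable_continuous/derivable1_diffP.
rewrite /segint /Rintegral (continuous_FTC2 ab _ (F := F)).
- by [].
- exact: continuous_subspaceT.
- split => [x _//||].
  + exact/cvg_at_right_filter/cF.
  + exact/cvg_at_left_filter/cF.
- by move=> x _; rewrite derive1E; apply: derive_val.
Qed.

End segment_integral.

(** * Green's theorem on rectangles, by bisection *)

Section green.
Variable R : realType.
Implicit Types (x y a b : R).

Section bisection.
Variable I : R -> R -> R -> R -> R.
Hypothesis I_split : forall x y a b, 0 <= a -> 0 <= b ->
  I x y a b = I x y (a / 2) (b / 2) + I (x + a / 2) y (a / 2) (b / 2) +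
    I x (y + b / 2) (a / 2) (b / 2) + I (x + a / 2) (y + b / 2) (a / 2) (b / 2).
Hypothesis I_local : forall x0 y0 (e : R), 0 < e -> exists2 d : R, 0 < d &
  forall x y a b, 0 <= a -> 0 <= b -> a + b < d ->
    x <= x0 <= x + a -> y <= y0 <= y + b -> `|I x y a b| <= e * (a + b) ^+ 2.

(** Pigeonhole: if all four quarters had [I] at most [c / 4] in absolute value, their sum could not
    exceed [c]. The point [p] is the lower left corner of the quarter that is kept. *)
Lemma bisect_step (c : R) x y a b : 0 <= a -> 0 <= b -> c < `|I x y a b| ->
  exists p : R * R, [/\ x <= p.1, p.1 + a / 2 <= x + a, y <= p.2,
    p.2 + b / 2 <= y + b & c / 4 < `|I p.1 p.2 (a / 2) (b / 2)|].
Proof.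
move=> a0 b0; rewrite I_split//.
set I1 := I _ _ _ _; set I2 := I _ _ _ _; set I3 := I _ _ _ _; set I4 := I _ _ _ _.
move=> cI; apply: contrapT => /forallNP H.
have n1 : `|I1| <= c / 4.
  by rewrite leNgt; apply/negP => ?; apply: (H (x, y)); split => //=; lra.
have n2 : `|I2| <= c / 4.
  by rewrite leNgt; apply/negP => ?; apply: (H (x + a / 2, y)); split => //=; lra.
have n3 : `|I3| <= c / 4.
  by rewrite leNgt; apply/negP => ?; apply: (H (x, y + b / 2)); split => //=; lra.
have n4 : `|I4| <= c / 4.
  by rewrite leNgt; apply/negP => ?; apply: (H (x + a / 2, y + b / 2)); split => //=; lra.
have t1 := ler_normD (I1 + I2 + I3) I4.
have t2 := ler_normD (I1 + I2) I3.
have t3 := ler_normD I1 I2.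
lra.
Qed.

(** The nested rectangles shrink to one point. There [I_local] bounds [I] by a small multiple of the
    squared size, of order [4 ^- n], while bisection keeps it above [c / 4 ^ n]. *)
Lemma bisect_eq0 x y a b : 0 <= a -> 0 <= b -> I x y a b = 0.
Proof.
move=> a0 b0; apply: contrapT => /eqP; rewrite -normr_gt0 => I0.
have [c [c0 cI]] : exists c : R, 0 < c /\ c < `|I x y a b|.
  by exists (`|I x y a b| / 2); split; lra.
pose st n (p q : R * R) := [/\ p.1 <= q.1, q.1 + a / 2 ^+ n.+1 <= p.1 + a / 2 ^+ n, p.2 <= q.2,
  q.2 + b / 2 ^+ n.+1 <= p.2 + b / 2 ^+ n &
  c / 4 ^+ n.+1 < `|I q.1 q.2 (a / 2 ^+ n.+1) (b / 2 ^+ n.+1)|].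
pose inv n (p : R * R) := c / 4 ^+ n < `|I p.1 p.2 (a / 2 ^+ n) (b / 2 ^+ n)|.
have stP n p : inv n p -> exists q, st n p q.
  move=> ip; have [| |q []] := bisect_step _ _ ip.
  - by rewrite divr_ge0// exprn_ge0.
  - by rewrite divr_ge0// exprn_ge0.
  by rewrite -!mulrA -!invfM -!exprSr => *; exists q; split.
(* The default [p] is never returned on the sequence [s]: [stP] provides a successor as long as
   [inv] holds. *)
pose nxt n p := xget p [set q | st n p q].
pose s := fix s n := if n is m.+1 then nxt m (s m) else (x, y).
have invs n : inv n (s n).
  elim: n => [|n IH]; first by rewrite /inv !expr0 !divr1.
  by have := stP _ _ IH => /(xgetPex (s n)); case.
have sst n : st n (s n) (s n.+1) by have := stP _ _ (invs n) => /(xgetPex (s n)).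
have half m (u : R) : 0 <= u -> 0 <= u / 2 ^+ m by move=> ?; rewrite divr_ge0// exprn_ge0.
have mono (f : nat -> R) (u : R) : 0 <= u -> (forall n, f n <= f n.+1) ->
    (forall n, f n.+1 + u / 2 ^+ n.+1 <= f n + u / 2 ^+ n) ->
    exists l, forall n, f n <= l <= f n + u / 2 ^+ n.
  move=> u0 fi fd.
  have ndf : nondecreasing_seq f by apply/nondecreasing_seqP.
  have dec : nonincreasing_seq (fun n => f n + u / 2 ^+ n).
    by apply/nonincreasing_seqP.
  have fub n : f n <= f 0%N + u.
    have := dec 0%N n (leq0n n); rewrite expr0 divr1; apply: le_trans.
    by rewrite lerDl half.
  have cvf : cvgn f.
    by apply: nondecreasing_is_cvgn => //; exists (f 0%N + u) => _ [n _ <-].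
  exists (limn f) => n; apply/andP; split; first exact: nondecreasing_cvgn_le.
  apply: limr_le => //; exists n => // m /= nm.
  by apply: le_trans (dec _ _ nm); rewrite lerDl half.
have [x0 x0P] := mono (fst \o s) a a0 (fun n => let: And5 h _ _ _ _ := sst n in h)
  (fun n => let: And5 _ h _ _ _ := sst n in h).
have [y0 y0P] := mono (snd \o s) b b0 (fun n => let: And5 _ _ h _ _ := sst n in h)
  (fun n => let: And5 _ _ _ h _ := sst n in h).
(* Makes [e * (a + b) ^ 2] at most [c]; the [1] keeps the denominator positive when [a = b = 0]. *)
pose e := c / ((a + b) ^+ 2 + 1).
have ab1 : 0 < (a + b) ^+ 2 + 1 by rewrite ltr_wpDl// sqr_ge0.
have e0 : 0 < e by rewrite divr_gt0.
have [d d0 dP] := I_local x0 y0 e0.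
have [n nd] : exists n, (a + b) / 2 ^+ n < d.
  have : (fun n => (a + b) * (2^-1) ^+ n) @ \oo --> (a + b) * 0.
    by apply: cvgMr; apply: cvg_expr; rewrite ger0_norm; lra.
  rewrite mulr0 => /cvgrPdist_lt /(_ _ d0) [n _ /(_ n (leqnn n))].
  rewrite /= sub0r normrN => H; exists n; rewrite -exprVn.
  exact: le_lt_trans (ler_norm _) H.
have := dP (s n).1 (s n).2 (a / 2 ^+ n) (b / 2 ^+ n) (half _ _ a0) (half _ _ b0).
rewrite -mulrDl => /(_ nd (x0P n) (y0P n)); rewrite leNgt => /negP; apply.
apply: le_lt_trans (invs n).
rewrite expr_div_n -exprM mulnC exprM [2 ^+ 2](_ : _ = 4); last by rewrite expr2; lra.
rewrite mulrA ler_wpM2r ?invr_ge0 ?exprn_ge0//.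
rewrite /e mulrAC ler_pdivrMr// ler_wpM2l ?(ltW c0)//; lra.
Qed.

End bisection.

(** The form [p dx + q dy] is closed at one point: both coefficients are differentiable there, and
    the shared number [be] expresses dp/dy = dq/dx. *)
Definition partial_match (p q : R -> R -> R) x0 y0 := exists al be de : R,
  forall e : R, 0 < e -> exists2 d : R, 0 < d & forall x y, `|x - x0| + `|y - y0| < d ->
    `|p x y - p x0 y0 - al * (x - x0) - be * (y - y0)| <= e * (`|x - x0| + `|y - y0|) /\
    `|q x y - q x0 y0 - be * (x - x0) - de * (y - y0)| <= e * (`|x - x0| + `|y - y0|).

(* Goursat's version of Green's theorem: the partial derivatives need not be
   continuous. *)
Lemma green (p q : R -> R -> R) x y a b :
  (forall y, continuous (p^~ y)) -> (forall x, continuous (q x)) ->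
  (forall x0 y0, partial_match p q x0 y0) -> 0 <= a -> 0 <= b ->
  segint (p^~ y) x (x + a) - segint (p^~ (y + b)) x (x + a) +
  (segint (q (x + a)) y (y + b) - segint (q x) y (y + b)) = 0.
Proof.
move=> cp cq pq.
pose I x y a b := segint (p^~ y) x (x + a) - segint (p^~ (y + b)) x (x + a) +
  (segint (q (x + a)) y (y + b) - segint (q x) y (y + b)).
apply: (@bisect_eq0 I) => {x y a b}.
  move=> x y a b a0 b0; rewrite /I.
  have -> : x + a / 2 + a / 2 = x + a by lra.
  have -> : y + b / 2 + b / 2 = y + b by lra.
  rewrite !(@segint_cat _ _ x (x + a / 2) (x + a))//; try lra.
  rewrite !(@segint_cat _ _ y (y + b / 2) (y + b))//; try lra.
(* Each pair of opposite sides combines two errors of [e / 4 * (a + b)]; integrated over lengths [a]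
   and [b] they add up to [e / 2 * (a + b) ^ 2]. *)
move=> x0 y0 e e0; have [al [be [de /(_ (e / 4))]]] := pq x0 y0.
case; first by rewrite divr_gt0.
move=> d d0 dP; exists d => // x y a b a0 b0 abd xa yb.
have D x' y' : x <= x' <= x + a -> y <= y' <= y + b ->
    `|x' - x0| + `|y' - y0| <= a + b.
  move=> ? ?; apply: lerD; rewrite ler_norml; apply/andP; split; lra.
have P x' y' : x <= x' <= x + a -> y <= y' <= y + b ->
    `|p x' y' - p x0 y0 - al * (x' - x0) - be * (y' - y0)| <= e / 4 * (a + b) /\
    `|q x' y' - q x0 y0 - be * (x' - x0) - de * (y' - y0)| <= e / 4 * (a + b).
  move=> hx hy; have h := D _ _ hx hy; have [h1 h2] := dP _ _ (le_lt_trans h abd).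
  by split; [apply: le_trans h1 _|apply: le_trans h2 _]; rewrite ler_wpM2l//; lra.
(* The linear parts leave [- be * a * b] here and [be * a * b] in [H2]. They cancel, which is where
   closedness enters. *)
have H1 : `|segint (fun s => p s y - p s (y + b)) x (x + a) - (- be * b) * (x + a - x)|
    <= (e / 2 * (a + b)) * (x + a - x).
  apply: segint_near; [|lra|].
    by move=> s; apply: cvgB; exact: cp.
  move=> s sx; have [h1 _] := P s y sx ltac:(lra); have [h2 _] := P s (y + b) sx ltac:(lra).
  move: h1 h2; rewrite !ler_norml => /andP[h1 h1'] /andP[h2 h2'].
  apply/andP; split; lra.
have H2 : `|segint (fun t => q (x + a) t - q x t) y (y + b) - (be * a) * (y + b - y)|
    <= (e / 2 * (a + b)) * (y + b - y).
  apply: segint_near; [|lra|].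
    by move=> s; apply: cvgB; exact: cq.
  move=> s sx; have [_ h1] := P x s ltac:(lra) sx; have [_ h2] := P (x + a) s ltac:(lra) sx.
  move: h1 h2; rewrite !ler_norml => /andP[h1 h1'] /andP[h2 h2'].
  apply/andP; split; lra.
rewrite /I -segintB// -segintB//.
move: H1 H2; rewrite !ler_norml => /andP[h1 h1'] /andP[h2 h2'].
have : 0 <= e * (a + b) ^+ 2 by rewrite mulr_ge0 ?sqr_ge0// ltW.
rewrite expr2 => hE; apply/andP; split; nra.
Qed.

End green.

(** * The modulus of a complex number as a real number *)

Section cmod.
Variable R : realType.
Implicit Types (x y z : R[i]) (r : R).

(* [normc] lands in the carrier of an [rcfType]; [lra] needs it in that of [R]. *)
Definition cmod x : R := normc x.
Arguments cmod : simpl never.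

Lemma cmod_ge0 x : 0 <= cmod x.
Proof. by case: x => a b; exact: sqrtr_ge0. Qed.

Lemma cmod0 : cmod 0 = 0.
Proof. exact: normc0. Qed.

Lemma cmod1 : cmod 1 = 1.
Proof. exact: normc1. Qed.

Lemma cmodM x y : cmod (x * y) = cmod x * cmod y.
Proof. exact: normcM. Qed.

Lemma cmodV x : cmod x^-1 = (cmod x)^-1.
Proof. exact: normcV. Qed.

Lemma cmodD_le x y : cmod (x + y) <= cmod x + cmod y.
Proof. exact: le_normcD. Qed.

Lemma cmodN x : cmod (- x) = cmod x.
Proof. exact: normcN. Qed.

Lemma cmodB_le x y : cmod (x - y) <= cmod x + cmod y.
Proof. by rewrite -(cmodN y); exact: cmodD_le. Qed.

Lemma cmodBC x y : cmod (x - y) = cmod (y - x).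
Proof. by rewrite -cmodN opprB. Qed.

Lemma cmod_real r : cmod r%:C = `|r|.
Proof. by rewrite /cmod /= expr0n /= addr0 sqrtr_sqr. Qed.

Lemma cmod_i : cmod 'i = 1.
Proof. by rewrite /cmod /= expr0n /= add0r expr1n sqrtr1. Qed.

Lemma cmod_eq0 x : (cmod x == 0) = (x == 0).
Proof. by apply/eqP/eqP => [/eq0_normc//|->]; rewrite cmod0. Qed.

Lemma cmod_gt0 x : (0 < cmod x) = (x != 0).
Proof. by rewrite lt_def cmod_ge0 andbT cmod_eq0. Qed.

Lemma cmodX x k : cmod (x ^+ k) = cmod x ^+ k.
Proof. by elim: k => [|k IH]; rewrite ?expr0 ?cmod1// !exprS cmodM IH. Qed.

Lemma cmod_prod (I : Type) (s : seq I) (P : pred I) (f : I -> R[i]) :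
  cmod (\prod_(i <- s | P i) f i) = \prod_(i <- s | P i) cmod (f i).
Proof. by elim/big_rec2: _ => [|i a b _ <-]; rewrite ?cmod1 ?cmodM. Qed.

Lemma cmod_sum (I : Type) (s : seq I) (P : pred I) (f : I -> R[i]) :
  cmod (\sum_(i <- s | P i) f i) <= \sum_(i <- s | P i) cmod (f i).
Proof.
elim/big_rec2: _ => [|i a b _ le_ab]; first by rewrite cmod0.
by apply: le_trans (cmodD_le _ _) _; rewrite lerD2l.
Qed.

Lemma cmod_sqr x : cmod x ^+ 2 = complex.Re x ^+ 2 + complex.Im x ^+ 2.
Proof. exact: normc_sqr. Qed.

Lemma cmod_le_ReIm x : cmod x <= `|complex.Re x| + `|complex.Im x|.
Proof.
rewrite -ler_sqr ?nnegrE ?cmod_ge0 ?addr_ge0// cmod_sqr sqrrD !real_normK ?num_real//.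
by rewrite addrAC lerDl mulrn_wge0// mulr_ge0.
Qed.

Lemma Re_le_cmod x : `|complex.Re x| <= cmod x.
Proof.
rewrite -ler_sqr ?nnegrE ?cmod_ge0// cmod_sqr real_normK ?num_real//.
by rewrite lerDl sqr_ge0.
Qed.

Lemma Im_le_cmod x : `|complex.Im x| <= cmod x.
Proof.
rewrite -ler_sqr ?nnegrE ?cmod_ge0// cmod_sqr real_normK ?num_real//.
by rewrite lerDr sqr_ge0.
Qed.

Lemma cmod_eq_le x y : (forall e : R, 0 < e -> cmod (x - y) <= e) -> x = y.
Proof.
move=> H; apply/eqP; rewrite -subr_eq0 -cmod_eq0 eq_le cmod_ge0 andbT.
by apply/ler_addgt0Pr => e e0; rewrite add0r H.
Qed.

End cmod.

(** * Complex-valued integrals over segments *)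

Section segment_integral_complex.
Variable R : realType.
Implicit Types (f g : R -> R[i]) (a b : R).

Definition rccont f := continuous (@complex.Re R \o f) /\ continuous (@complex.Im R \o f).

Definition csegint f a b : R[i] :=
  segint (@complex.Re R \o f) a b +i* segint (@complex.Im R \o f) a b.

Lemma rccontP f : (forall x (e : R), 0 < e -> exists2 d : R, 0 < d &
    forall y, `|y - x| < d -> cmod (f y - f x) <= e) -> rccont f.
Proof.
move=> H; split=> x; apply/cvgrPdist_le => e e0; have [d d0 dP] := H x e e0;
  near=> y; rewrite distrC /= -raddfB.
- apply: le_trans (Re_le_cmod _) _; apply: dP; rewrite distrC.
  by near: y; apply/nbhs_ballP; exists d.
- apply: le_trans (Im_le_cmod _) _; apply: dP; rewrite distrC.
  by near: y; apply/nbhs_ballP; exists d.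
Unshelve. all: by end_near. Qed.

Lemma rccont_cst (c : R[i]) : rccont (cst c).
Proof. by split=> x; exact: cvg_cst. Qed.

Lemma rccontD f g : rccont f -> rccont g -> rccont (fun x => f x + g x).
Proof.
move=> [f1 f2] [g1 g2]; split=> x.
  have -> : @complex.Re R \o (fun x => f x + g x) = (fun x => complex.Re (f x) + complex.Re (g x)).
    by apply/funext => y /=; rewrite raddfD.
  by apply: cvgD; [exact: f1|exact: g1].
have -> : @complex.Im R \o (fun x => f x + g x) = (fun x => complex.Im (f x) + complex.Im (g x)).
  by apply/funext => y /=; rewrite raddfD.
by apply: cvgD; [exact: f2|exact: g2].
Qed.

Lemma rccontM f g : rccont f -> rccont g -> rccont (fun x => f x * g x).
Proof.
move=> [f1 f2] [g1 g2]; split=> x.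
  have -> : @complex.Re R \o (fun x => f x * g x) = (fun x =>
      complex.Re (f x) * complex.Re (g x) - complex.Im (f x) * complex.Im (g x)).
    by apply/funext => y /=; case: (f y) (g y) => ? ? [].
  by apply: cvgB; apply: cvgM; [exact: f1|exact: g1|exact: f2|exact: g2].
have -> : @complex.Im R \o (fun x => f x * g x) = (fun x =>
    complex.Re (f x) * complex.Im (g x) + complex.Im (f x) * complex.Re (g x)).
  by apply/funext => y /=; case: (f y) (g y) => ? ? [].
by apply: cvgD; apply: cvgM; [exact: f1|exact: g2|exact: f2|exact: g1].
Qed.

Lemma rccontX f k : rccont f -> rccont (fun x => f x ^+ k).
Proof.
move=> cf; elim: k => [|k IH]; first exact: rccont_cst.
by under eq_fun do rewrite exprS; exact: rccontM.
Qed.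

Lemma csegintD f g a b : rccont f -> rccont g ->
  csegint (fun x => f x + g x) a b = csegint f a b + csegint g a b.
Proof.
move=> [f1 f2] [g1 g2]; rewrite /csegint.
have -> : @complex.Re R \o (fun x => f x + g x) =
    (fun x => (@complex.Re R \o f) x + (@complex.Re R \o g) x).
  by apply/funext => y /=; rewrite raddfD.
have -> : @complex.Im R \o (fun x => f x + g x) =
    (fun x => (@complex.Im R \o f) x + (@complex.Im R \o g) x).
  by apply/funext => y /=; rewrite raddfD.
by rewrite !segintD.
Qed.

Lemma csegintZ c f a b : rccont f -> csegint (fun x => c * f x) a b = c * csegint f a b.
Proof.
move=> [f1 f2]; case: c => u v; rewrite /csegint.
have cZ w (h : R -> R) : continuous h -> continuous (fun x => w * h x).
  by move=> ch x; apply: cvgMr; exact: ch.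
have -> : @complex.Re R \o (fun x => (u +i* v) * f x) =
    (fun x => u * (@complex.Re R \o f) x - v * (@complex.Im R \o f) x).
  by apply/funext => y /=; case: (f y).
have -> : @complex.Im R \o (fun x => (u +i* v) * f x) =
    (fun x => u * (@complex.Im R \o f) x + v * (@complex.Re R \o f) x).
  by apply/funext => y /=; case: (f y).
rewrite segintB ?segintD ?segintZ//; try exact: cZ.
Qed.

Lemma csegint_sum (I : Type) (s : seq I) (f : I -> R -> R[i]) a b :
  (forall i, rccont (f i)) ->
  rccont (fun x => \sum_(i <- s) f i x) /\
  csegint (fun x => \sum_(i <- s) f i x) a b = \sum_(i <- s) csegint (f i) a b.
Proof.
move=> cf; elim: s => [|i s [IH1 IH2]].
  under eq_fun do rewrite big_nil.
  split; first exact: rccont_cst.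
  rewrite big_nil -[0 in LHS](mulr0 (0 : R[i])).
  have -> : (fun=> 0 * 0) = (fun x : R => 0 * cst 0 x) :> (R -> R[i]) by [].
  by rewrite csegintZ ?mul0r//; exact: rccont_cst.
under eq_fun do rewrite big_cons.
split; first exact: rccontD.
by rewrite csegintD// IH2 big_cons.
Qed.

(** Real and imaginary parts are bounded separately, whence the factor 2. It propagates into the
    constants of all Taylor remainders below. *)
Lemma csegint_le_norm f a b M : rccont f -> a <= b ->
  (forall x, a <= x <= b -> cmod (f x) <= M) ->
  cmod (csegint f a b) <= 2 * M * (b - a).
Proof.
move=> [f1 f2] ab fM; apply: le_trans (cmod_le_ReIm _) _.
rewrite /= -mulrA mulr_natl mulr2n; apply: lerD; apply: segint_le_norm => // x /fM;
  apply: le_trans; [exact: Re_le_cmod|exact: Im_le_cmod].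
Qed.

End segment_integral_complex.

(** * Pointwise derivatives of maps from R^2 to C *)

Section total_derivative.
Variable R : realType.
Implicit Types (p q : R -> R -> R[i]) (s t e : R) (F : R[i] -> R[i]).

Definition cdiff_at F z l := forall e, 0 < e -> exists2 d : R, 0 < d &
  forall u, cmod u <= d -> cmod (F (z + u) - F z - l * u) <= e * cmod u.

(** Fréchet differentiability at one point, with [a] and [b] as partial derivatives. In this form it
    passes through products and through composition with a complex differentiable function, and it
    is what [green] consumes. *)
Definition tderiv p s0 t0 (a b : R[i]) := forall e, 0 < e -> exists2 d : R, 0 < d &
  forall s t, `|s - s0| + `|t - t0| < d ->
  cmod (p s t - p s0 t0 - a * (s - s0)%:C - b * (t - t0)%:C) <=
    e * (`|s - s0| + `|t - t0|).

Lemma tderiv_lip p s0 t0 a b : tderiv p s0 t0 a b -> exists K d : R,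
  [/\ 0 < K, 0 < d & forall s t, `|s - s0| + `|t - t0| < d ->
    cmod (p s t - p s0 t0) <= K * (`|s - s0| + `|t - t0|)].
Proof.
move=> /(_ 1 ltr01)[d d0 dP]; exists (1 + cmod a + cmod b), d; split=> //.
  by have := cmod_ge0 a; have := cmod_ge0 b; lra.
move=> s t /dP {dP}; set rho := `|s - s0| + _.
set L1 := a * _; set L2 := b * _ => H.
have -> : p s t - p s0 t0 = (p s t - p s0 t0 - L1 - L2) + (L1 + L2) by ring.
apply: le_trans (cmodD_le _ _) _.
have := cmodD_le L1 L2; rewrite !cmodM !cmod_real.
have r1 : `|s - s0| <= rho by rewrite lerDl.
have r2 : `|t - t0| <= rho by rewrite lerDr.
have := ler_wpM2l (cmod_ge0 a) r1; have := ler_wpM2l (cmod_ge0 b) r2; lra.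
Qed.

Lemma tderiv_cst (c : R[i]) s0 t0 : tderiv (fun _ _ => c) s0 t0 0 0.
Proof.
move=> e e0; exists 1 => // s t _; rewrite !mul0r !subr0 subrr cmod0.
by rewrite mulr_ge0 ?addr_ge0// ltW.
Qed.

Lemma tderivD p q s0 t0 a b a' b' : tderiv p s0 t0 a b -> tderiv q s0 t0 a' b' ->
  tderiv (fun s t => p s t + q s t) s0 t0 (a + a') (b + b').
Proof.
move=> dp dq e e0; have e2 : 0 < e / 2 by rewrite divr_gt0.
have [d d0 dP] := dp _ e2; have [d' d'0 d'P] := dq _ e2.
exists (Num.min d d'); first by rewrite lt_min d0.
move=> s t; rewrite lt_min => /andP[/dP h1 /d'P h2].
set X := cmod _; have -> : X = cmod ((p s t - p s0 t0 - a * (s - s0)%:C - b * (t - t0)%:C)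
  + (q s t - q s0 t0 - a' * (s - s0)%:C - b' * (t - t0)%:C)).
  by congr cmod; ring.
by apply: le_trans (cmodD_le _ _) _; lra.
Qed.

Lemma tderivM p q s0 t0 a b a' b' : tderiv p s0 t0 a b -> tderiv q s0 t0 a' b' ->
  tderiv (fun s t => p s t * q s t) s0 t0
    (a * q s0 t0 + p s0 t0 * a') (b * q s0 t0 + p s0 t0 * b').
Proof.
move=> dp dq e e0.
have [K [k [K0 k0 kP]]] := tderiv_lip dp; have [K' [k' [K'0 k'0 k'P]]] := tderiv_lip dq.
set p0 := p s0 t0; set q0 := q s0 t0.
pose A := cmod p0 + cmod q0 + 1.
have A0 : 0 < A by have := cmod_ge0 p0; have := cmod_ge0 q0; rewrite /A; lra.
have e1 : 0 < e / (2 * A) by rewrite divr_gt0// mulr_gt0.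
have [d d0 dP] := dp _ e1; have [d' d'0 d'P] := dq _ e1.
(* Under this bound on [rho] the product of the two increments, at most [K * rho * (K' * rho)], is
   at most [e / 2 * rho]. *)
have m0 : 0 < e / (2 * K * K') by rewrite divr_gt0// !mulr_gt0.
exists (Num.min (Num.min d d') (Num.min (Num.min k k') (e / (2 * K * K')))).
  by rewrite !lt_min d0 d'0 k0 k'0 m0.
move=> s t; rewrite !lt_min -!andbA => /and5P[/dP h1 /d'P h2 /kP h3 /k'P h4].
set rho := `|s - s0| + `|t - t0| => hrho.
have rho0 : 0 <= rho by rewrite addr_ge0.
move: h1 h2 h3 h4; rewrite -/p0 -/q0 -/rho.
set P := _ - a * _ - _; set Q := _ - a' * _ - _ => h1 h2 h3 h4.
(* Product rule with remainder: the linear remainders [P] and [Q] are weighted by the values at the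
   point, whose moduli sum to less than [A], and the product of the increments is quadratic in
   [rho]. *)
set X := cmod _; have -> : X = cmod (P * q0 + p0 * Q + (p s t - p0) * (q s t - q0)).
  by congr cmod; rewrite /P /Q /p0 /q0; ring.
apply: le_trans (cmodD_le _ _) _.
apply: le_trans (lerD (cmodD_le _ _) (lexx _)) _; rewrite !cmodM.
have i1 := ler_wpM2r (cmod_ge0 q0) h1.
have i2 := ler_wpM2l (cmod_ge0 p0) h2.
have i3 := ler_pM (cmod_ge0 _) (cmod_ge0 _) h3 h4.
have i4 : K * rho * (K' * rho) <= e / 2 * rho.
  have -> : K * rho * (K' * rho) = (rho * (2 * K * K')) / 2 * rho by field.
  rewrite ler_wpM2r// ler_wpM2r ?invr_ge0// -ler_pdivlMr ?mulr_gt0//; exact: ltW.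
have i5 : e / (2 * A) * rho * (cmod p0 + cmod q0) <= e / 2 * rho.
  have -> : e / 2 * rho = e / (2 * A) * rho * A by field; rewrite gt_eqF.
  rewrite ler_wpM2l//; first by rewrite mulr_ge0// ltW.
  by rewrite /A; lra.
lra.
Qed.

Lemma tderiv_comp F p s0 t0 a b l : tderiv p s0 t0 a b -> cdiff_at F (p s0 t0) l ->
  tderiv (fun s t => F (p s t)) s0 t0 (l * a) (l * b).
Proof.
move=> dp dF e e0.
have [K [k [K0 k0 kP]]] := tderiv_lip dp.
have e1 : 0 < e / (2 * K) by rewrite divr_gt0// mulr_gt0.
have [d d0 dP] := dF _ e1.
have L0 : 0 < cmod l + 1 by have := cmod_ge0 l; lra.
have e2 : 0 < e / (2 * (cmod l + 1)) by rewrite divr_gt0// mulr_gt0.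
have [d' d'0 d'P] := dp _ e2.
have dK0 : 0 < d / K by rewrite divr_gt0.
exists (Num.min (d / K) (Num.min k d')); first by rewrite !lt_min dK0 k0 d'0.
move=> s t; rewrite !lt_min => /and3P[h1 /kP h2 /d'P h3].
set rho := `|s - s0| + `|t - t0| in h1 h2 h3 *.
have rho0 : 0 <= rho by rewrite addr_ge0.
have hd : cmod (p s t - p s0 t0) <= d.
  by apply: le_trans h2 _; rewrite mulrC -ler_pdivlMr// ltW.
have := dP _ hd; rewrite (addrC (p s0 t0)) subrK => h4.
set Q := _ - a * _ - _ in h3; set P := _ - _ - _ in h4.
set X := cmod _; have -> : X = cmod (P + l * Q).
  by congr cmod; rewrite /P /Q; ring.
apply: le_trans (cmodD_le _ _) _; rewrite cmodM.
have i1 : e / (2 * K) * cmod (p s t - p s0 t0) <= e / 2 * rho.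
  have -> : e / 2 * rho = e / (2 * K) * (K * rho) by field; rewrite gt_eqF.
  by rewrite ler_wpM2l// ltW.
have i2 : cmod l * cmod Q <= e / 2 * rho.
  have -> : e / 2 * rho = (cmod l + 1) * (e / (2 * (cmod l + 1)) * rho).
    by field; rewrite gt_eqF.
  by apply: ler_pM => //; rewrite ?cmod_ge0//; have := cmod_ge0 l; lra.
lra.
Qed.

Lemma cdiff_inv z : z != 0 -> cdiff_at (fun u => u^-1) z (- z ^- 2).
Proof.
move=> z0 e e0; have nz : 0 < cmod z by rewrite cmod_gt0.
(* The remainder is [u ^ 2 / (z ^ 2 * (z + u))], and [cmod (z + u)] is at least [cmod z / 2] when
   [cmod u] is at most [cmod z / 2]. *)
have m0 : 0 < e * cmod z ^+ 3 / 2 by rewrite divr_gt0// mulr_gt0// exprn_gt0.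
exists (Num.min (cmod z / 2) (e * cmod z ^+ 3 / 2)); first by rewrite lt_min m0 divr_gt0.
move=> u; rewrite le_min => /andP[u1 u2].
have zu : cmod z / 2 <= cmod (z + u).
  by have := cmodB_le (z + u) u; rewrite addrK; lra.
have zu0 : z + u != 0 by rewrite -cmod_gt0; lra.
have -> : (z + u)^-1 - z^-1 - (- z ^- 2) * u = u * u / (z ^+ 2 * (z + u)).
  by field; rewrite z0 zu0.
rewrite cmodM cmodV !cmodM ler_pdivrMr; last by rewrite !mulr_gt0//; lra.
rewrite mulrAC ler_wpM2r ?cmod_ge0//.
apply: le_trans u2 _.
rewrite -!mulrA ler_wpM2l ?(ltW e0)//.
by rewrite !ler_wpM2l ?cmod_ge0.
Qed.

Lemma is_derive_eps (f : R -> R) x df : is_derive x (1 : R) f df ->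
  forall e, 0 < e -> exists2 d : R, 0 < d &
    forall y, `|y - x| < d -> `|f y - f x - df * (y - x)| <= e * `|y - x|.
Proof.
move=> [dv ev] e e0; move: dv; rewrite /derivable.
move=> /cvg_ex[l lP]; have El : l = df by rewrite -ev /derive; apply/esym/cvg_lim.
subst l; move/cvgrPdist_le : lP => /(_ _ e0).
rewrite /= => /nbhs_ballP[d /= d0 dP].
exists d => // y yd; have [->|yx] := eqVneq y x.
  by rewrite !subrr mulr0 subrr normr0 mulr0.
have yx0 : y - x != 0 by rewrite subr_eq0.
have := dP (y - x); rewrite /ball /= sub0r normrN => /(_ yd yx0).
rewrite /= [_ *: 1]mulr1 subrK.
rewrite -[X in _ -> X <= _]normrN.
have -> : - (f y - f x - df * (y - x)) = (df - (y - x)^-1 * (f y - f x)) * (y - x).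
  by field.
by rewrite normrM => h; rewrite ler_wpM2r.
Qed.

End total_derivative.

(** * Cauchy's formula on a circle about the origin *)

Section cauchy.
Variable R : realType.
Implicit Types (s t e r : R) (F : R[i] -> R[i]).

Lemma tderiv_rccont (p : R -> R -> R[i]) :
  (forall s t, exists a b, tderiv p s t a b) ->
  (forall t, rccont (p^~ t)) /\ (forall s, rccont (p s)).
Proof.
move=> dp; split=> u; apply: rccontP => x e e0.
- have [a [b /tderiv_lip[K [d [K0 d0 dP]]]]] := dp x u.
  exists (Num.min d (e / K)); first by rewrite lt_min d0 divr_gt0.
  move=> y; rewrite lt_min => /andP[yd ye].
  have := dP y u; rewrite subrr normr0 addr0 => /(_ yd) h; apply: le_trans h _.
  by rewrite mulrC -ler_pdivlMr// ltW.
- have [a [b /tderiv_lip[K [d [K0 d0 dP]]]]] := dp u x.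
  exists (Num.min d (e / K)); first by rewrite lt_min d0 divr_gt0.
  move=> y; rewrite lt_min => /andP[yd ye].
  have := dP u y; rewrite subrr normr0 add0r => /(_ yd) h; apply: le_trans h _.
  by rewrite mulrC -ler_pdivlMr// ltW.
Qed.

Lemma green_complex (p q : R -> R -> R[i]) x y a b :
  (forall s t, exists al be de, tderiv p s t al be /\ tderiv q s t be de) ->
  0 <= a -> 0 <= b ->
  csegint (p^~ y) x (x + a) - csegint (p^~ (y + b)) x (x + a) +
  (csegint (q (x + a)) y (y + b) - csegint (q x) y (y + b)) = 0.
Proof.
move=> pq a0 b0.
have [cp _] : (forall t, rccont (p^~ t)) /\ (forall s, rccont (p s)).
  by apply: tderiv_rccont => s t; have [al [be [_ [? _]]]] := pq s t; exists al, be.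
have [_ cq] : (forall t, rccont (q^~ t)) /\ (forall s, rccont (q s)).
  by apply: tderiv_rccont => s t; have [_ [be [de [_ ?]]]] := pq s t; exists be, de.
(* Serves the real and the imaginary part at once: [g] commutes with real factors and is bounded by
   the modulus. *)
have parts (g : {additive R[i] -> R}) : (forall u r, g (u * r%:C) = g u * r) ->
    (forall u, `|g u| <= cmod u) -> (forall t, continuous (g \o p^~ t)) ->
    (forall s, continuous (g \o q s)) ->
    segint (g \o p^~ y) x (x + a) - segint (g \o p^~ (y + b)) x (x + a) +
    (segint (g \o q (x + a)) y (y + b) - segint (g \o q x) y (y + b)) = 0.
  move=> gM gle cgp cgq.
  apply: (@green R (fun s t => g (p s t)) (fun s t => g (q s t)) x y a b) => // s0 t0.
  have [al [be [de [dp dq]]]] := pq s0 t0.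
  exists (g al), (g be), (g de) => e e0.
  have [d d0 dP] := dp e e0; have [d' d'0 d'P] := dq e e0.
  exists (Num.min d d'); first by rewrite lt_min d0.
  move=> s t; rewrite lt_min => /andP[/dP h1 /d'P h2].
  by split; [apply: le_trans h1|apply: le_trans h2]; rewrite -!gM -!raddfB; exact: gle.
apply/eqP; rewrite eq_complex; apply/andP; split; apply/eqP.
- apply: (parts (@complex.Re R)) => [u r|u|t|s].
  + by case: u => ? ? /=; rewrite mulr0 subr0.
  + exact: Re_le_cmod.
  + exact: (cp t).1.
  + exact: (cq s).1.
- apply: (parts (@complex.Im R)) => [u r|u|t|s].
  + by case: u => ? ? /=; rewrite mulr0 add0r.
  + exact: Im_le_cmod.
  + exact: (cp t).2.
  + exact: (cq s).2.
Qed.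

Definition cis t : R[i] := cos t +i* sin t.

Lemma cisD s t : cis (s + t) = cis s * cis t.
Proof. by rewrite /cis cosD sinD; simpc; congr (_ +i* _); ring. Qed.

Lemma cis0 : cis 0 = 1.
Proof. by rewrite /cis cos0 sin0. Qed.

Lemma cis2pi : cis (2 * pi) = 1.
Proof. by rewrite /cis mulr_natl cos2pi sin2pi. Qed.

Lemma cisX t k : cis t ^+ k = cis (k%:R * t).
Proof.
elim: k => [|k IH]; first by rewrite expr0 mul0r cis0.
by rewrite exprS IH -cisD -natr1; congr cis; ring.
Qed.

Lemma cmod_cis t : cmod (cis t) = 1.
Proof. by rewrite /cmod /cis /= cos2Dsin2 sqrtr1. Qed.

Lemma cis_neq0 t : cis t != 0.
Proof. by rewrite -cmod_gt0 cmod_cis. Qed.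

Lemma tderiv_cis s t : tderiv (fun _ t => cis t) s t 0 ('i * cis t).
Proof.
move=> e e0; have e2 : 0 < e / 2 by rewrite divr_gt0.
have [d d0 dP] := is_derive_eps (is_derive_cos t) e2.
have [d' d'0 d'P] := is_derive_eps (is_derive_sin t) e2.
exists (Num.min d d'); first by rewrite lt_min d0.
move=> s' t' h; have {h} : `|t' - t| < Num.min d d'.
  by apply: le_lt_trans h; rewrite lerDr.
rewrite lt_min => /andP[/dP h1 /d'P h2].
rewrite mul0r subr0; apply: le_trans (cmod_le_ReIm _) _.
move: h1 h2; rewrite /cis /= !(mul0r, mul1r, mulr0, subr0, add0r, addr0, sub0r) => h1 h2.
have : 0 <= e * `|s' - s| by rewrite mulr_ge0// ltW.
lra.
Qed.

Lemma tderiv_expR s t : tderiv (fun s _ => (expR s)%:C) s t (expR s)%:C 0.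
Proof.
move=> e e0; have [d d0 dP] := is_derive_eps (is_derive_expR s) e0.
exists d => // s' t' h; have {h} /dP h : `|s' - s| < d.
  by apply: le_lt_trans h; rewrite lerDl.
rewrite mul0r subr0 -rmorphM -!raddfB cmod_real; apply: le_trans h _.
by rewrite ler_wpM2l ?lerDl// ltW.
Qed.

Definition cdiff F := forall z, exists l, cdiff_at F z l.

(** The density in [t] of dz / (z - w) along z = [r * cis t]. *)
Definition ckernel r (w : R[i]) t : R[i] := 'i * (r%:C * cis t) / (r%:C * cis t - w).

Lemma rccont_cis : rccont cis.
Proof.
have H s t : exists a b, tderiv (fun _ t => cis t) s t a b.
  by exists 0, ('i * cis t); exact: tderiv_cis.
exact: ((tderiv_rccont H).2 0).
Qed.

Section fixed_radius.
Variables (r : R) (w : R[i]).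
Hypotheses (r0 : 0 < r) (wr : cmod w < r).

Lemma circle_dist t : r - cmod w <= cmod (r%:C * cis t - w).
Proof.
have := cmodD_le (r%:C * cis t - w) w.
by rewrite subrK cmodM cmod_real cmod_cis (gtr0_norm r0); lra.
Qed.

Lemma circle_neq t : r%:C * cis t - w != 0.
Proof. by rewrite -cmod_gt0; apply: lt_le_trans (circle_dist t); rewrite subr_gt0. Qed.

Lemma tderiv_circle s t : tderiv (fun _ t => r%:C * cis t - w) s t 0 (r%:C * ('i * cis t)).
Proof.
have h := tderivD (tderivM (tderiv_cst r%:C s t) (tderiv_cis s t)) (tderiv_cst (- w) s t).
by move: h; rewrite !mul0r ?mulr0 !add0r addr0.
Qed.

Lemma tderiv_ckernel s t : exists de, tderiv (fun _ t => ckernel r w t) s t 0 de.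
Proof.
have h1 := tderivM (tderiv_cst ('i * r%:C) s t) (tderiv_cis s t).
have h2 := tderiv_comp (tderiv_circle s t) (cdiff_inv (circle_neq t)).
have := tderivM h1 h2; rewrite !(mulr0, mul0r, add0r).
have -> : (fun _ t => ckernel r w t) =
    (fun _ t : R => 'i * r%:C * cis t * (r%:C * cis t - w)^-1).
  by apply/funext => _; apply/funext => u; rewrite /ckernel mulrA.
by move=> h; eexists; exact: h.
Qed.

Lemma rccont_ckernel : rccont (ckernel r w).
Proof.
have H s t : exists a b, tderiv (fun _ t => ckernel r w t) s t a b.
  by have [de ?] := tderiv_ckernel s t; exists 0, de.
exact: ((tderiv_rccont H).2 0).
Qed.

Lemma cmod_ckernel t : cmod w <= r / 2 -> cmod (ckernel r w t) <= 2.
Proof.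
move=> wr2; rewrite /ckernel !cmodM cmodV cmod_real cmod_cis (gtr0_norm r0) mulr1 cmod_i mul1r.
suff H (N : R) : r - cmod w <= N -> r / N <= 2 by exact/H/circle_dist.
by move=> h; rewrite ler_pdivrMr; [lra|move: r0 wr wr2 h; clear; lra].
Qed.

(* [gam] contracts the circle of radius [r] to the point [w] as [s] goes to
   [-oo], and [d gam / (gam - w) = ds + ckernel dt]. *)
Lemma cauchy_kernel F : cdiff F ->
  csegint (fun t => F (r%:C * cis t) * ckernel r w t) 0 (2 * pi) =
  F w * csegint (ckernel r w) 0 (2 * pi).
Proof.
move=> dF; pose gam s t : R[i] := w + (expR s)%:C * (r%:C * cis t - w).
pose p s t := F (gam s t); pose q s t := p s t * ckernel r w t.
have dgam s t : tderiv gam s t ((expR s)%:C * (r%:C * cis t - w))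
    ((expR s)%:C * (r%:C * ('i * cis t))).
  have := tderivD (tderiv_cst w s t) (tderivM (tderiv_expR s t) (tderiv_circle s t)).
  by rewrite !add0r mulr0 addr0 mul0r add0r.
have pi20 : 0 <= 2 * pi :> R by rewrite mulr_ge0// pi_ge0.
have dpq s t : exists al be de, tderiv p s t al be /\ tderiv q s t be de.
  have [l lP] := dF (gam s t).
  have dp := tderiv_comp (dgam s t) lP.
  have [k kP] := tderiv_ckernel s t.
  have dq := tderivM dp kP.
  do 3 eexists; split; first exact: dp.
  move: dq; rewrite mulr0 addr0.
  (* The mixed partials agree: the kernel times d gam / ds equals d gam / dt, so that [p ds + q dt],
     the pullback of F(z) dz / (z - w), is closed. *)
  have -> : l * ((expR s)%:C * (r%:C * cis t - w)) * ckernel r w t =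
      l * ((expR s)%:C * (r%:C * ('i * cis t))).
    by rewrite /ckernel; field; exact: circle_neq.
  by move=> dq; exact: dq.
have [_ cq] : (forall t, rccont (q^~ t)) /\ (forall s, rccont (q s)).
  by apply: tderiv_rccont => s t; have [_ [be [de [_ ?]]]] := dpq s t; exists be, de.
have [_ cp] : (forall t, rccont (p^~ t)) /\ (forall s, rccont (p s)).
  by apply: tderiv_rccont => s t; have [al [be [_ [? _]]]] := dpq s t; exists al, be.
(* Green's theorem on [[s, 0]] times [[0, 2 * pi]]: the sides [t = 0] and [t = 2 * pi] cancel by
   periodicity, so the integral over the contracted circle does not depend on [s]. *)
have Es s : s <= 0 -> csegint (q 0) 0 (2 * pi) = csegint (q s) 0 (2 * pi).
  move=> s0; have := @green_complex p q s 0 (- s) (2 * pi) dpq ltac:(lra) pi20.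
  rewrite subrr add0r.
  have -> : p^~ (2 * pi) = p^~ 0.
    by apply/funext => s' ; rewrite /p /gam cis2pi cis0.
  by rewrite subrr add0r => /eqP; rewrite subr_eq0 => /eqP.
have -> : (fun t => F (r%:C * cis t) * ckernel r w t) = q 0.
  by apply/funext => t; rewrite /q /p /gam expR0 mul1r addrC subrK.
have cK := rccont_ckernel.
have [B [B0 BP]] : exists B : R, 0 < B /\ forall t, cmod (ckernel r w t) <= B.
  exists (r / (r - cmod w)); split; first by rewrite divr_gt0// subr_gt0.
  move=> t; rewrite /ckernel !cmodM cmodV cmod_real cmod_cis (gtr0_norm r0) mulr1 cmod_i.
  rewrite mul1r ler_wpM2l ?(ltW r0)// lef_pV2 ?posrE ?cmod_gt0 ?circle_neq ?subr_gt0//.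
  exact: circle_dist.
apply: cmod_eq_le => e e0.
have P0 : 0 < 2 * pi :> R by rewrite mulr_gt0 ?pi_gt0.
have [l lP] := dF w.
have [d d0 dP] := lP 1 ltr01.
(* With [e1] bounding [p s t - F w] and [B] the kernel, the final estimate [2 * (e1 * B) * (2 * pi)]
   is exactly [e]. *)
pose e1 : R := e / (2 * B * (2 * pi)).
have e10 : 0 < e1 by rewrite divr_gt0// !mulr_gt0// pi_gt0.
have L0 : 0 < cmod l + 1 by have := cmod_ge0 l; lra.
(* Within distance [d] of [w] the increment of [F] is at most [cmod l + 1] times the distance, hence
   at most [e1] within distance [m]. *)
pose m : R := Num.min d (e1 / (cmod l + 1)).
have m0 : 0 < m by rewrite lt_min d0 divr_gt0.
have r20 : 0 < 2 * r by rewrite mulr_gt0.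
(* [gam s t - w] has modulus at most [expR s * (2 * r)], so this [s] brings the whole curve within
   [m] of [w]. *)
pose s : R := Num.min 0 (ln (m / (2 * r))).
have s0 : s <= 0 by rewrite ge_min lexx.
have es : expR s <= m / (2 * r).
  rewrite -[leRHS]lnK ?posrE ?divr_gt0// ler_expR /s.
  by rewrite ge_min lexx orbT.
rewrite (Es s s0) -csegintZ//.
have -> : csegint (q s) 0 (2 * pi) - csegint (fun t => F w * ckernel r w t) 0 (2 * pi) =
    csegint (fun t => (p s t - F w) * ckernel r w t) 0 (2 * pi).
  have -> : (fun t => (p s t - F w) * ckernel r w t) =
      (fun t => q s t + -1 * (F w * ckernel r w t)).
    by apply/funext => t; rewrite /q; ring.
  rewrite csegintD ?csegintZ//; [by rewrite mulN1r|..];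
    by do ?apply: rccontM => //; exact: rccont_cst.
have -> : e = 2 * (e1 * B) * (2 * pi - 0).
  rewrite /e1 subr0; move: (2 * pi) P0 => tp tp0; field.
  by rewrite !gt_eqF.
apply: csegint_le_norm => //.
  by apply: rccontM => //; apply: rccontD => //; exact: rccont_cst.
move=> t _; rewrite cmodM ler_pM ?cmod_ge0//.
have gm : cmod ((expR s)%:C * (r%:C * cis t - w)) <= m.
  rewrite cmodM cmod_real gtr0_norm ?expR_gt0//.
  have -> : m = m / (2 * r) * (2 * r) by field; rewrite gt_eqF.
  apply: ler_pM => //; rewrite ?expR_ge0 ?cmod_ge0//.
  have := cmodB_le (r%:C * cis t) w.
  rewrite cmodM cmod_real cmod_cis (gtr0_norm r0).
  by move: r0 wr; clear; lra.
have /dP h : cmod ((expR s)%:C * (r%:C * cis t - w)) <= d.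
  by apply: le_trans gm _; rewrite ge_min lexx.
move: h gm; rewrite -/(gam s t) -/(p s t); set u := _%:C * _ => h gm.
have : cmod u * (cmod l + 1) <= e1.
  rewrite -ler_pdivlMr//; apply: le_trans gm _.
  by rewrite ge_min lexx orbT.
have -> : p s t - F w = (p s t - F w - l * u) + l * u by ring.
have := cmodD_le (p s t - F w - l * u) (l * u); rewrite cmodM; lra.
Qed.

Lemma rccont_circle F : cdiff F -> rccont (fun t => F (r%:C * cis t)).
Proof.
move=> dF.
have H s t : exists a b, tderiv (fun _ t => F (r%:C * cis t)) s t a b.
  have [l lP] := dF (r%:C * cis t).
  have h := tderivM (tderiv_cst r%:C s t) (tderiv_cis s t).
  do 2 eexists; exact: tderiv_comp h lP.
exact: ((tderiv_rccont H).2 0).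
Qed.

(** Cauchy's formula for the [k]-th Taylor coefficient, on the circle of radius [r]. The inverse of
    [r * cis t] is written with [cis (- t)], so that its continuity follows from that of [cis]. *)
Definition fcoef F k : R[i] :=
  ((2 * pi)^-1)%:C * csegint (fun t => F (r%:C * cis t) * (r%:C^-1 * cis (- t)) ^+ k) 0 (2 * pi).

Lemma rccont_cisN : rccont (fun t => r%:C^-1 * cis (- t)).
Proof.
apply: rccontM; first exact: rccont_cst.
have [h1 h2] := rccont_cis; split=> x.
- have -> : @complex.Re R \o (fun t => cis (- t)) = @complex.Re R \o cis.
    by apply/funext => t /=; rewrite cosN.
  exact: h1.
- have -> : @complex.Im R \o (fun t => cis (- t)) = (fun t => - (@complex.Im R \o cis) t).
    by apply/funext => t /=; rewrite sinN.
  by apply: cvgN; exact: h2.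
Qed.

Lemma circleV t : r%:C^-1 * cis (- t) = (r%:C * cis t)^-1.
Proof.
have h : cis (- t) * cis t = 1 by rewrite -cisD addNr cis0.
have rn0 : r%:C != 0 by rewrite -cmod_gt0 cmod_real gtr0_norm.
have -> : cis (- t) = (cis t)^-1 by rewrite -[LHS](mulfK (cis_neq0 t)) h mul1r.
by rewrite invfM.
Qed.

Lemma cmod_circleV t : cmod (r%:C^-1 * cis (- t)) = r^-1.
Proof. by rewrite cmodM cmodV cmod_real cmod_cis (gtr0_norm r0) mulr1. Qed.

(** With z = [r * cis t] the kernel is ['i / (1 - w / z)]; cutting the geometric series after [N]
    terms leaves a multiple of the kernel itself. *)
Lemma ckernel_geometric N t : ckernel r w t =
  'i * (\sum_(k < N) (w * (r%:C^-1 * cis (- t))) ^+ k) +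
  (w * (r%:C^-1 * cis (- t))) ^+ N * ckernel r w t.
Proof.
have rn0 : r%:C != 0 by rewrite -cmod_gt0 cmod_real gtr0_norm.
have zn0 : r%:C * cis t != 0 by rewrite mulf_neq0// cis_neq0.
have zw := circle_neq t.
rewrite /ckernel circleV; set z := r%:C * cis t in zn0 zw *; set x := w * z^-1.
have x1 : 1 - x != 0.
  by rewrite /x -[1](divff zn0) -mulrBl mulf_neq0// invr_neq0.
have -> : \sum_(k < N) x ^+ k = (1 - x ^+ N) / (1 - x).
  apply: (mulIf x1); rewrite divfK// mulrC -[1 - x]opprB mulNr -subrX1 opprB //.
have -> : 'i * z / (z - w) = 'i / (1 - x) :> R[i].
  by rewrite /x; field; rewrite zn0 zw.
by field.
Qed.

Lemma csegint_kernel_expansion F N : cdiff F ->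
  csegint (fun t => F (r%:C * cis t) * ckernel r w t) 0 (2 * pi) =
  'i * (2 * pi)%:C * (\sum_(k < N) fcoef F k * w ^+ k) +
  csegint (fun t => F (r%:C * cis t) *
    ((w * (r%:C^-1 * cis (- t))) ^+ N * ckernel r w t)) 0 (2 * pi).
Proof.
move=> dF; have cF := rccont_circle dF; have cN := rccont_cisN.
pose g k t := 'i * w ^+ k * (F (r%:C * cis t) * (r%:C^-1 * cis (- t)) ^+ k).
have cg0 k : rccont (fun t => F (r%:C * cis t) * (r%:C^-1 * cis (- t)) ^+ k).
  by apply: rccontM => //; exact: rccontX.
have cg k : rccont (g k) by apply: rccontM => //; exact: rccont_cst.
have [h1 h2] := @csegint_sum R 'I_N (index_enum _) g 0 (2 * pi) cg.
have -> : (fun t => F (r%:C * cis t) * ckernel r w t) =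
    (fun t => \sum_(k < N) g k t + F (r%:C * cis t) *
      ((w * (r%:C^-1 * cis (- t))) ^+ N * ckernel r w t)).
  apply/funext => t; rewrite {1}(ckernel_geometric N) mulrDr; congr (_ + _).
  rewrite mulrCA mulr_sumr mulr_sumr; apply: eq_bigr => k _.
  by rewrite /g exprMn; ring.
rewrite csegintD//; last first.
  apply: rccontM => //; apply: rccontM; last exact: rccont_ckernel.
  by apply: rccontX; apply: rccontM => //; exact: rccont_cst.
congr (_ + _); rewrite h2 mulr_sumr; apply: eq_bigr => k _.
have pE : (2 * pi)%:C * ((2 * pi)^-1)%:C = 1 :> R[i].
  by rewrite -rmorphM mulfV// gt_eqF// mulr_gt0// pi_gt0.
rewrite /g csegintZ// /fcoef; move: (csegint _ _ _) => c.
rewrite -[LHS]mul1r -pE; ring.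
Qed.

(** The constant collects 2 from [csegint_le_norm], the bound 2 of the kernel for [cmod w <= r / 2],
    and the length [2 * pi]. *)
Lemma kernel_remainder_le F N M : cdiff F -> cmod w <= r / 2 ->
  (forall t, 0 <= t <= 2 * pi -> cmod (F (r%:C * cis t)) <= M) ->
  cmod (csegint (fun t => F (r%:C * cis t) *
    ((w * (r%:C^-1 * cis (- t))) ^+ N * ckernel r w t)) 0 (2 * pi)) <=
  8 * pi * M * (cmod w / r) ^+ N.
Proof.
move=> dF wr2 FM.
have -> : 8 * pi * M * (cmod w / r) ^+ N =
    2 * (M * ((cmod w / r) ^+ N * 2)) * (2 * pi - 0) by ring.
apply: csegint_le_norm.
- apply: rccontM; first exact: rccont_circle.
  apply: rccontM; last exact: rccont_ckernel.
  by apply: rccontX; apply: rccontM; [exact: rccont_cst|exact: rccont_cisN].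
- by rewrite mulr_ge0// pi_ge0.
move=> t tpi; rewrite cmodM ler_pM ?cmod_ge0 ?FM// cmodM cmodX cmodM cmod_circleV.
by rewrite ler_wpM2l ?exprn_ge0 ?divr_ge0 ?cmod_ge0 ?(ltW r0)// cmod_ckernel.
Qed.

Lemma csegint_cisN k : (0 < k)%N -> csegint (fun t => cis (- t) ^+ k) 0 (2 * pi) = 0.
Proof.
move=> k0; have kR : k%:R != 0 :> R by rewrite pnatr_eq0 -lt0n.
have P0 : 0 < 2 * pi :> R by rewrite mulr_gt0 ?pi_gt0.
have E2 : cis (k%:R * (2 * pi)) = 1 by rewrite -cisX cis2pi expr1n.
have cE : cos (k%:R * (2 * pi)) = 1 := congr1 (@complex.Re R) E2.
have sE : sin (k%:R * (2 * pi)) = 0 := congr1 (@complex.Im R) E2.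
have dk (x : R) : is_derive x (1 : R) (fun t : R => k%:R * t) k%:R.
  have := @is_deriveZ _ _ _ id k%:R x 1 1 _; rewrite /GRing.scale /= mulr1.
  by apply; exact: is_derive_id.
have ck : continuous (fun t : R => k%:R * t) by move=> x; apply: cvgMr; exact: cvg_id.
apply/eqP; rewrite eq_complex; apply/andP; split; apply/eqP.
- rewrite /csegint /=.
  have -> : @complex.Re R \o (fun t => cis (- t) ^+ k) = (fun t => cos (k%:R * t)).
    by apply/funext => t /=; rewrite cisX mulrN /= cosN.
  have dF (x : R) : is_derive x (1 : R) (fun t : R => k%:R^-1 * sin (k%:R * t)) (cos (k%:R * x)).
    have h := is_derive1_comp (is_derive_sin (k%:R * x)) (dk x).
    have := @is_deriveZ _ _ _ _ k%:R^-1 _ _ _ h; rewrite /GRing.scale /=.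
    by rewrite mulrC mulfK.
  have cf : continuous (fun t : R => cos (k%:R * t)).
    by move=> x; apply: (@continuous_comp _ _ _ _ cos); [exact: ck|exact: continuous_cos].
  by rewrite (segint_derive P0 cf dF) sE !mulr0 sin0 mulr0 subrr.
- rewrite /csegint /=.
  have -> : @complex.Im R \o (fun t => cis (- t) ^+ k) = (fun t => - sin (k%:R * t)).
    by apply/funext => t /=; rewrite cisX mulrN /= sinN.
  have dF (x : R) : is_derive x (1 : R) (fun t : R => k%:R^-1 * cos (k%:R * t)) (- sin (k%:R * x)).
    have h := is_derive1_comp (is_derive_cos (k%:R * x)) (dk x).
    have := @is_deriveZ _ _ _ _ k%:R^-1 _ _ _ h; rewrite /GRing.scale /=.
    by rewrite mulrC mulfK.
  have cf : continuous (fun t : R => - sin (k%:R * t)).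
    by move=> x; apply: cvgN; apply: (@continuous_comp _ _ _ _ sin);
      [exact: ck|exact: continuous_sin].
  by rewrite (segint_derive P0 cf dF) cE mulr0 cos0 subrr.
Qed.

End fixed_radius.

End cauchy.

(** * Taylor coefficients and the Taylor remainder *)

Section taylor.
Variable R : realType.
Implicit Types (r M : R) (w z : R[i]) (F : R[i] -> R[i]).

Lemma circle_bounded F r : cdiff F ->
  exists M, forall t, 0 <= t <= 2 * pi -> cmod (F (r%:C * cis t)) <= M.
Proof.
move=> dF; have [c1 c2] := rccont_circle r dF.
have pi20 : 0 <= 2 * pi :> R by rewrite mulr_ge0// pi_ge0.
have bnd (f : R -> R) : continuous f ->
    exists M, forall t, 0 <= t <= 2 * pi -> `|f t| <= M.
  move=> cf; have cnf : {within `[0, 2 * pi], continuous (fun t => `|f t|)}.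
    apply: continuous_subspaceT => x.
    by apply: continuous_comp; [exact: cf|exact: norm_continuous].
  by have [c _ cM] := EVT_max pi20 cnf; exists `|f c| => t tP; apply: cM; rewrite in_itv.
have [M1 M1P] := bnd _ c1; have [M2 M2P] := bnd _ c2.
exists (M1 + M2) => t tP; apply: le_trans (cmod_le_ReIm _) _.
by apply: lerD; [exact: M1P|exact: M2P].
Qed.

Lemma fcoef_le F r M k : cdiff F -> 0 < r ->
  (forall t, 0 <= t <= 2 * pi -> cmod (F (r%:C * cis t)) <= M) ->
  cmod (fcoef r F k) * r ^+ k <= 2 * M.
Proof.
move=> dF r0 FM; have P0 : 0 < 2 * pi :> R by rewrite mulr_gt0// pi_gt0.
have rk : 0 < r ^+ k by rewrite exprn_gt0.
rewrite -ler_pdivlMr// /fcoef cmodM cmod_real gtr0_norm ?invr_gt0//.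
rewrite mulrC ler_pdivrMr//.
have -> : 2 * M / r ^+ k * (2 * pi) = 2 * (M * (r ^+ k)^-1) * (2 * pi - 0) by ring.
apply: csegint_le_norm.
- by apply: rccontM; [exact: rccont_circle|apply: rccontX; exact: rccont_cisN].
- exact: ltW.
by move=> t tP; rewrite cmodM cmodX cmod_circleV// exprVn ler_wpM2r ?invr_ge0 ?(ltW rk) ?FM.
Qed.

Lemma cdiff_cst (c : R[i]) : cdiff (fun=> c).
Proof.
move=> z; exists 0 => e e0; exists 1 => // u _.
by rewrite subrr mul0r subrr cmod0 mulr_ge0 ?cmod_ge0// ltW.
Qed.

Lemma fcoef_cst1 r k : 0 < r -> fcoef r (fun=> 1) k = (k == 0%N)%:R.
Proof.
move=> r0; have P0 : 0 < 2 * pi :> R by rewrite mulr_gt0// pi_gt0.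
have cN : rccont (fun t : R => (cis (- t)) ^+ k).
  have := rccontX k (rccont_cisN (1 : R)); under eq_fun do rewrite invr1 mul1r; exact.
rewrite /fcoef.
have -> : (fun t => 1 * (r%:C^-1 * cis (- t)) ^+ k) = (fun t => (r%:C^-1) ^+ k * cis (- t) ^+ k).
  by apply/funext => t; rewrite mul1r exprMn.
rewrite csegintZ//; case: k cN => [|k] cN; last by rewrite csegint_cisN// !mulr0.
rewrite expr0 mul1r /csegint.
have -> : @complex.Re R \o (fun t => cis (- t) ^+ 0) = cst 1 by apply/funext.
have -> : @complex.Im R \o (fun t => cis (- t) ^+ 0) = cst 0 by apply/funext.
rewrite !segint_cst ?(ltW P0)// mul0r mul1r subr0.
rewrite -[_ +i* 0]/((2 * pi)%:C) -rmorphM mulVf //.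
by rewrite mulf_neq0// gt_eqF// pi_gt0.
Qed.

(** The winding number is read off the kernel expansion of the constant function 1: its only nonzero
    coefficient is the one of index 0, and the remainder tends to 0. *)
Lemma csegint_ckernel r w : 0 < r -> cmod w <= r / 2 ->
  csegint (ckernel r w) 0 (2 * pi) = 'i * (2 * pi)%:C.
Proof.
move=> r0 wr2; have wr : cmod w < r by move: r0 wr2; clear; lra.
apply: cmod_eq_le => e e0.
have P8 : 0 < 8 * pi :> R by rewrite mulr_gt0// pi_gt0.
(* [N.+1] terms, so that the partial sum contains the index 0. *)
have [N] : exists N, 8 * pi * (cmod w / r) ^+ N.+1 <= e.
  have : (fun n => (8 * pi) * (cmod w / r) ^+ n) @ \oo --> 8 * pi * 0.
    apply: cvgMr; apply: cvg_expr; rewrite ger0_norm ?divr_ge0 ?cmod_ge0 ?(ltW r0)//.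
    by rewrite ltr_pdivrMr// mul1r.
  rewrite mulr0 => /cvgrPdist_lt /(_ _ e0) [N _ /(_ N.+1 (leqnSn N))].
  rewrite /= sub0r normrN => H; exists N.
  exact: le_trans (ler_norm _) (ltW H).
move=> Ne; have E := csegint_kernel_expansion r0 wr N.+1 (cdiff_cst 1).
rewrite -[LHS]/(csegint (fun t => 1 * ckernel r w t) 0 (2 * pi)) in E.
have S1 : \sum_(k < N.+1) fcoef r (fun=> 1) k * w ^+ k = 1.
  rewrite big_ord_recl fcoef_cst1// expr0 mulr1 big1 ?addr0// => i _.
  by rewrite fcoef_cst1// mul0r.
have -> : ckernel r w = (fun t => 1 * ckernel r w t) by apply/funext => t; rewrite mul1r.
rewrite E S1 mulr1 addrC addKr.
have -> : e = e * 1 by rewrite mulr1.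
apply: le_trans (kernel_remainder_le r0 wr N.+1 (M := 1) (cdiff_cst 1) wr2 _) _.
  by move=> t _; rewrite cmod1.
by rewrite !mulr1.
Qed.

Lemma taylor_circle F r M w N : cdiff F -> 0 < r -> cmod w <= r / 2 ->
  (forall t, 0 <= t <= 2 * pi -> cmod (F (r%:C * cis t)) <= M) ->
  cmod (F w - \sum_(k < N) fcoef r F k * w ^+ k) <= 4 * M * (cmod w / r) ^+ N.
Proof.
move=> dF r0 wr2 FM; have wr : cmod w < r by move: r0 wr2; clear; lra.
have P0 : 0 < 2 * pi :> R by rewrite mulr_gt0// pi_gt0.
have := kernel_remainder_le r0 wr N dF wr2 FM.
have := csegint_kernel_expansion r0 wr N dF.
rewrite cauchy_kernel// csegint_ckernel//.
set X := csegint _ _ _; set S := \sum_(k < N) _ => EX XM.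
have {EX} EX : X = 'i * (2 * pi)%:C * (F w - S) by rewrite mulrBr mulrC EX; ring.
rewrite -(ler_pM2l P0); move: XM; rewrite EX !cmodM cmod_i cmod_real gtr0_norm// mul1r.
by move=> h; apply: le_trans h _; rewrite le_eqVlt; apply/orP; left; apply/eqP; ring.
Qed.

(** Strong induction: once the coefficients below [k] agree, the case [N = k + 1] gives
    [cmod (a k - b k) <= C * cmod w], and [w] tends to 0. *)
Lemma coef_uniq (a b : nat -> R[i]) r : 0 < r ->
  (forall N, exists C : R, forall w, cmod w <= r ->
    cmod (\sum_(k < N) a k * w ^+ k - \sum_(k < N) b k * w ^+ k) <= C * cmod w ^+ N) ->
  a = b.
Proof.
move=> r0 H; apply/funext; elim/ltn_ind => k IH; have [C CP] := H k.+1.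
apply: cmod_eq_le => e e0; have C0 : 0 < `|C| + 1 by rewrite ltr_wpDl.
pose d := Num.min r (e / (`|C| + 1)).
have d0 : 0 < d by rewrite lt_min r0 divr_gt0.
have dC : cmod d%:C = d by rewrite cmod_real gtr0_norm.
have := CP d%:C; rewrite dC ge_min lexx => /(_ isT).
rewrite -sumrB big_ord_recr /= big1 ?add0r; last first.
  by move=> i _; rewrite IH// subrr.
rewrite -mulrBl cmodM cmodX dC exprS mulrA ler_pM2r ?exprn_gt0// => h.
apply: le_trans h _.
apply: (@le_trans _ _ ((`|C| + 1) * d)).
  rewrite ler_pM2r//; have := ler_norm C; lra.
by rewrite mulrC -ler_pdivlMr// ge_min lexx orbT.
Qed.

(** Both families approximate [F] to every order near 0, by [taylor_circle] on the two circles, so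
    [coef_uniq] identifies them. *)
Lemma fcoef_radius F r : cdiff F -> 0 < r -> fcoef r F = fcoef 1 F.
Proof.
move=> dF r0; have [M1 M1P] := circle_bounded 1 dF; have [M2 M2P] := circle_bounded r dF.
have m0 : 0 < Num.min r 1 / 2 by rewrite divr_gt0// lt_min r0 ltr01.
apply: (coef_uniq m0) => N; exists (4 * M2 / r ^+ N + 4 * M1) => w wm.
have w1 : cmod w <= 1 / 2.
  by apply: le_trans wm _; rewrite ler_pM2r ?invr_gt0// ge_min lexx orbT.
have w2 : cmod w <= r / 2.
  by apply: le_trans wm _; rewrite ler_pM2r ?invr_gt0// ge_min lexx.
have h1 := taylor_circle N dF ltr01 w1 M1P.
have h2 := taylor_circle N dF r0 w2 M2P.
have tri (S1 S2 x : R[i]) (a b : R) :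
    cmod (x - S1) <= a -> cmod (x - S2) <= b -> cmod (S2 - S1) <= b + a.
  have -> : S2 - S1 = (x - S1) - (x - S2) by ring.
  by move=> ha hb; apply: le_trans (cmodB_le _ _) _; rewrite addrC lerD.
apply: le_trans (tri _ _ _ _ _ h1 h2) _.
rewrite divr1 expr_div_n.
by rewrite le_eqVlt; apply/orP; left; apply/eqP; ring.
Qed.

(** By [fcoef_radius] the radius is immaterial; fixing it to 1 makes the coefficients depend on [F]
    alone. *)
Definition tcoef F k : R[i] := fcoef 1 F k.

Lemma tcoef_le F r M k : cdiff F -> 0 < r ->
  (forall z, cmod z <= r -> cmod (F z) <= M) -> cmod (tcoef F k) * r ^+ k <= 2 * M.
Proof.
move=> dF r0 FM; rewrite /tcoef -(fcoef_radius dF r0); apply: fcoef_le => // t _.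
by apply: FM; rewrite cmodM cmod_real cmod_cis mulr1 gtr0_norm.
Qed.

Lemma taylor F r M w N : cdiff F -> 0 < r -> cmod w <= r / 2 ->
  (forall z, cmod z <= r -> cmod (F z) <= M) ->
  cmod (F w - \sum_(k < N) tcoef F k * w ^+ k) <= 4 * M * (cmod w / r) ^+ N.
Proof.
move=> dF r0 wr FM; rewrite /tcoef -(fcoef_radius dF r0); apply: taylor_circle => // t _.
by apply: FM; rewrite cmodM cmod_real cmod_cis mulr1 gtr0_norm.
Qed.

End taylor.

(** * Entire functions of several variables *)

Section complex_limit.
Variable R : realType.
Implicit Types (u v : nat -> R[i]) (l : R[i]).

Definition ccvg u l := forall e : R, 0 < e ->
  exists N, forall m, (N <= m)%N -> cmod (u m - l) <= e.

Lemma ccvg_le u l M : ccvg u l -> (forall m, cmod (u m) <= M) -> cmod l <= M.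
Proof.
move=> ul uM; apply/ler_addgt0Pr => e e0; have [N /(_ N (leqnn N))] := ul e e0.
by rewrite cmodBC; have := cmodD_le (l - u N) (u N); rewrite subrK; have := uM N; lra.
Qed.

Lemma ccvg_cst l : ccvg (fun=> l) l.
Proof. by move=> e e0; exists 0%N => m _; rewrite subrr cmod0 ltW. Qed.

Lemma ccvgD u v l k : ccvg u l -> ccvg v k -> ccvg (fun m => u m + v m) (l + k).
Proof.
move=> ul vk e e0; have e2 : 0 < e / 2 by rewrite divr_gt0.
have [N NP] := ul _ e2; have [N' N'P] := vk _ e2.
exists (maxn N N') => m; rewrite geq_max => /andP[/NP h1 /N'P h2].
have -> : u m + v m - (l + k) = (u m - l) + (v m - k) by ring.
by apply: le_trans (cmodD_le _ _) _; lra.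
Qed.

Lemma ccvgZ (c : R[i]) u l : ccvg u l -> ccvg (fun m => c * u m) (c * l).
Proof.
move=> ul e e0; have c0 : 0 < cmod c + 1 by rewrite ltr_wpDl ?cmod_ge0.
have [N NP] := ul _ (divr_gt0 e0 c0); exists N => m /NP h.
rewrite -mulrBr cmodM; apply: (@le_trans _ _ ((cmod c + 1) * (e / (cmod c + 1)))).
  by apply: ler_pM; rewrite ?cmod_ge0// lerDl.
by rewrite mulrC divfK// gt_eqF.
Qed.

Lemma ccvgB u v l k : ccvg u l -> ccvg v k -> ccvg (fun m => u m - v m) (l - k).
Proof.
move=> ul vk; rewrite -mulN1r; under [u in ccvg u]eq_fun do rewrite -mulN1r.
by apply: ccvgD => //; exact: ccvgZ.
Qed.

Lemma ccvg_sum (I : Type) (s : seq I) (u : I -> nat -> R[i]) (l : I -> R[i]) :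
  (forall i, ccvg (u i) (l i)) ->
  ccvg (fun m => \sum_(i <- s) u i m) (\sum_(i <- s) l i).
Proof.
move=> ul; elim: s => [|i s IH].
  by under [u in ccvg u]eq_fun do rewrite big_nil; rewrite big_nil; exact: ccvg_cst.
by under [u in ccvg u]eq_fun do rewrite big_cons; rewrite big_cons; exact: ccvgD.
Qed.

Lemma ccvg_uniq u l k : ccvg u l -> ccvg u k -> l = k.
Proof.
move=> ul uk; apply: cmod_eq_le => e e0.
have h := ccvgB ul uk; apply: ccvg_le (ccvgB ul uk) _ => m.
by rewrite subrr cmod0 ltW.
Qed.

Lemma ccvg_cauchy u : (forall e : R, 0 < e -> exists N, forall m p, (N <= m)%N ->
  (N <= p)%N -> cmod (u m - u p) <= e) -> exists l, ccvg u l.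
Proof.
move=> H.
have cv (g : R[i] -> R) : (forall x y, `|g x - g y| <= cmod (x - y)) ->
    exists l : R, g (u m) @[m --> \oo] --> l.
  move=> gl; apply/cvg_ex; apply/cauchy_cvgP; apply/cauchy_exP => e e0.
  have [N NP] := H _ (divr_gt0 e0 (ltr0n R 2)).
  exists (g (u N)); exists N => // m /= Nm; rewrite /ball /=.
  apply: le_lt_trans (gl _ _) _; apply: le_lt_trans (NP _ _ (leqnn N) Nm) _.
  by rewrite ltr_pdivrMr// ltr_pMr// ltr1n.
have [|a aP] := cv (@complex.Re R); first by move=> x y; rewrite -raddfB Re_le_cmod.
have [|b bP] := cv (@complex.Im R); first by move=> x y; rewrite -raddfB Im_le_cmod.
exists (a +i* b) => e e0; have e2 : 0 < e / 2 by rewrite divr_gt0.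
move/cvgrPdist_le : aP => /(_ _ e2)[N _ NP]; move/cvgrPdist_le : bP => /(_ _ e2)[N' _ N'P].
exists (maxn N N') => m; rewrite geq_max => /andP[/NP h1 /N'P h2].
rewrite cmodBC; apply: le_trans (cmod_le_ReIm _) _.
move: h1 h2; case: (u m) => x y /=; lra.
Qed.

End complex_limit.

(** * Differentiability in several variables and second-order bounds *)

Section entire_functions.
Variables (R : realType) (n : nat).
Local Notation vec := 'cV[R[i]]_n.
Implicit Types (z w : vec) (f g : vec -> R[i]) (r rho e : R) (i j : 'I_n).

Definition polydisc z r := forall j, cmod (z j 0) <= r.

Lemma polydiscD z w r s : polydisc z r -> polydisc w s -> polydisc (z + w) (r + s).
Proof.
by move=> hz hw j; rewrite mxE; apply: le_trans (cmodD_le _ _) _; exact: lerD.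
Qed.

Lemma polydiscZ (c : R[i]) z r : polydisc z r -> polydisc (c *: z) (cmod c * r).
Proof. by move=> hz j; rewrite mxE cmodM ler_wpM2l ?cmod_ge0. Qed.

Lemma le_polydisc z r s : r <= s -> polydisc z r -> polydisc z s.
Proof. by move=> rs hz j; exact: le_trans (hz j) rs. Qed.

Lemma polydisc_ex z : exists2 r, 0 < r & polydisc z r.
Proof.
exists (\sum_j cmod (z j 0) + 1).
  by rewrite ltr_wpDl// sumr_ge0// => j _; exact: cmod_ge0.
move=> j; rewrite (bigD1 j)//= -addrA lerDl addr_ge0// sumr_ge0// => k _.
exact: cmod_ge0.
Qed.

Lemma polydisc_delta (c : R[i]) j : polydisc (c *: delta_mx j 0) (cmod c).
Proof.
move=> k; rewrite !mxE andbT; case: (k == j); first by rewrite mulr1.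
by rewrite mulr0 cmod0 cmod_ge0.
Qed.

(* Complex differentiability on C^n, for the sup norm of the coordinates. *)
Definition ent f := forall z, exists l : 'I_n -> R[i], forall e, 0 < e ->
  exists2 d : R, 0 < d & forall rho w, 0 <= rho <= d -> polydisc w rho ->
    cmod (f (z + w) - f z - \sum_j l j * w j 0) <= e * rho.

Lemma ent_lip f z : ent f -> exists K d : R, [/\ 0 < K, 0 < d &
  forall rho w, 0 <= rho <= d -> polydisc w rho -> cmod (f (z + w) - f z) <= K * rho].
Proof.
move=> /(_ z)[l /(_ 1 ltr01)[d d0 dP]].
exists (1 + \sum_j cmod (l j)), d; split=> //.
  by rewrite ltr_wpDr// sumr_ge0// => j _; exact: cmod_ge0.
move=> rho w hr hw; have h := dP _ _ hr hw.
have -> : f (z + w) - f z = (f (z + w) - f z - \sum_j l j * w j 0) + \sum_j l j * w j 0.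
  by ring.
apply: le_trans (cmodD_le _ _) _; rewrite mulrDl; apply: lerD => //.
apply: le_trans (cmod_sum _ _ _) _; rewrite mulr_suml; apply: ler_sum => j _.
by rewrite cmodM ler_wpM2l ?cmod_ge0.
Qed.

Lemma ent_cst (c : R[i]) : ent (fun=> c).
Proof.
move=> z; exists (fun=> 0) => e e0; exists 1 => // rho w /andP[r0 _] _.
by rewrite subrr big1 ?subr0 ?cmod0 ?mulr_ge0 ?(ltW e0)// => j _; rewrite mul0r.
Qed.

Lemma ent_coord j : ent (fun z => z j 0).
Proof.
move=> z; exists (fun k => (k == j)%:R) => e e0; exists 1 => // rho w /andP[r0 _] _.
rewrite mxE (bigD1 j)//= eqxx mul1r big1; last by move=> k /negbTE->; rewrite mul0r.
have -> : z j 0 + w j 0 - z j 0 - (w j 0 + 0) = 0 by ring.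
by rewrite cmod0 mulr_ge0// ltW.
Qed.

Lemma entD f g : ent f -> ent g -> ent (fun z => f z + g z).
Proof.
move=> ef eg z; have [l lP] := ef z; have [k kP] := eg z.
exists (fun j => l j + k j) => e e0; have e2 : 0 < e / 2 by rewrite divr_gt0.
have [d d0 dP] := lP _ e2; have [d' d'0 d'P] := kP _ e2.
exists (Num.min d d'); first by rewrite lt_min d0.
move=> rho w; rewrite le_min => /and3P[r0 rd rd'] hw.
have h1 := dP rho w (introT andP (conj r0 rd)) hw.
have h2 := d'P rho w (introT andP (conj r0 rd')) hw.
have -> : \sum_j (l j + k j) * w j 0 = \sum_j l j * w j 0 + \sum_j k j * w j 0.
  by rewrite -big_split; apply: eq_bigr => j _; rewrite mulrDl.
move: h1 h2; set S1 := \sum_j l _ * _; set S2 := \sum_j k _ * _ => h1 h2.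
have -> : f (z + w) + g (z + w) - (f z + g z) - (S1 + S2) =
  (f (z + w) - f z - S1) + (g (z + w) - g z - S2) by ring.
by apply: le_trans (cmodD_le _ _) _; lra.
Qed.

Lemma entM f g : ent f -> ent g -> ent (fun z => f z * g z).
Proof.
move=> ef eg z; have [l lP] := ef z; have [k kP] := eg z.
have [K [t [K0 t0 tP]]] := ent_lip z ef; have [K' [t' [K'0 t'0 t'P]]] := ent_lip z eg.
exists (fun j => l j * g z + f z * k j) => e e0.
set p0 := f z; set q0 := g z.
pose A := cmod p0 + cmod q0 + 1.
have A0 : 0 < A by have := cmod_ge0 p0; have := cmod_ge0 q0; rewrite /A; lra.
have e1 : 0 < e / (2 * A) by rewrite divr_gt0// mulr_gt0.
have [d d0 dP] := lP _ e1; have [d' d'0 d'P] := kP _ e1.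
have m0 : 0 < e / (2 * K * K') by rewrite divr_gt0// !mulr_gt0.
exists (Num.min (Num.min d d') (Num.min (Num.min t t') (e / (2 * K * K')))).
  by rewrite !lt_min d0 d'0 t0 t'0 m0.
move=> rho w; rewrite !le_min => /andP[r0 /andP[/andP[rd rd']]].
move=> /andP[/andP[rt rt'] re] hw.
have h1 := dP rho w (introT andP (conj r0 rd)) hw.
have h2 := d'P rho w (introT andP (conj r0 rd')) hw.
have h3 := tP rho w (introT andP (conj r0 rt)) hw.
have h4 := t'P rho w (introT andP (conj r0 rt')) hw.
have -> : \sum_j (l j * q0 + p0 * k j) * w j 0 =
    (\sum_j l j * w j 0) * q0 + p0 * \sum_j k j * w j 0.
  by rewrite mulr_suml mulr_sumr -big_split; apply: eq_bigr => j _ /=; ring.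
move: h1 h2 h3 h4; rewrite -/p0 -/q0.
set P := _ - \sum_j l _ * _; set Q := _ - \sum_j k _ * _ => h1 h2 h3 h4.
set X := cmod _; have -> : X = cmod (P * q0 + p0 * Q + (f (z + w) - p0) * (g (z + w) - q0)).
  by congr cmod; rewrite /P /Q; ring.
apply: le_trans (cmodD_le _ _) _.
apply: le_trans (lerD (cmodD_le _ _) (lexx _)) _; rewrite !cmodM.
have i1 := ler_wpM2r (cmod_ge0 q0) h1.
have i2 := ler_wpM2l (cmod_ge0 p0) h2.
have i3 := ler_pM (cmod_ge0 _) (cmod_ge0 _) h3 h4.
have i4 : K * rho * (K' * rho) <= e / 2 * rho.
  have -> : K * rho * (K' * rho) = (rho * (2 * K * K')) / 2 * rho by field.
  by rewrite ler_wpM2r// ler_wpM2r ?invr_ge0// -ler_pdivlMr ?mulr_gt0.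
have i5 : e / (2 * A) * rho * (cmod p0 + cmod q0) <= e / 2 * rho.
  have -> : e / 2 * rho = e / (2 * A) * rho * A by field; rewrite gt_eqF.
  rewrite ler_wpM2l//; first by rewrite mulr_ge0// ltW.
  by rewrite /A; lra.
lra.
Qed.

Lemma ent_sum (I : Type) (s : seq I) (f : I -> vec -> R[i]) :
  (forall i : I, ent (f i)) -> ent (fun z => \sum_(i <- s) f i z).
Proof.
move=> ef; elim: s => [|i s IH].
  by under [f in ent f]eq_fun do rewrite big_nil; exact: ent_cst.
by under [f in ent f]eq_fun do rewrite big_cons; exact: entD.
Qed.

Lemma ent_prod (I : Type) (s : seq I) (f : I -> vec -> R[i]) :
  (forall i : I, ent (f i)) -> ent (fun z => \prod_(i <- s) f i z).
Proof.
move=> ef; elim: s => [|i s IH].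
  by under [f in ent f]eq_fun do rewrite big_nil; exact: ent_cst.
by under [f in ent f]eq_fun do rewrite big_cons; exact: entM.
Qed.

Lemma entX f k : ent f -> ent (fun z => f z ^+ k).
Proof.
move=> ef; elim: k => [|k IH]; first exact: ent_cst.
by under [f in ent f]eq_fun do rewrite exprS; exact: entM.
Qed.

Definition upd z j (t : R[i]) : vec := \col_i (if i == j then t else z i 0).

Lemma upd_id z j : upd z j (z j 0) = z.
Proof. by apply/colP => i; rewrite mxE; case: eqP => // ->. Qed.

Lemma updD z w j t : upd (z + w) j t = upd z j t + upd w j 0.
Proof. by apply/colP => i; rewrite !mxE; case: eqP => // _; rewrite addr0. Qed.

Lemma upd_upd z j s t : upd (upd z j s) j t = upd z j t.
Proof. by apply/colP => i; rewrite !mxE; case: eqP. Qed.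

Lemma upd_comm z i j s t : i != j -> upd (upd z i s) j t = upd (upd z j t) i s.
Proof.
move=> ij; apply/colP => k; rewrite !mxE; case: eqP => [->|//].
by rewrite eq_sym (negbTE ij).
Qed.

Lemma polydisc_upd z j t r : polydisc z r -> cmod t <= r -> polydisc (upd z j t) r.
Proof. by move=> hz ht i; rewrite mxE; case: eqP. Qed.

Lemma ent_upd f j t : ent f -> ent (fun z => f (upd z j t)).
Proof.
move=> ef z; have [l lP] := ef (upd z j t).
exists (fun i => if i == j then 0 else l i) => e e0; have [d d0 dP] := lP e e0.
exists d => // rho w hr hw; rewrite updD.
have -> : \sum_i (if i == j then 0 else l i) * w i 0 = \sum_i l i * upd w j 0 i 0.
  by apply: eq_bigr => i _; rewrite mxE; case: eqP; rewrite ?mulr0 ?mul0r.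
apply: dP => //; apply: polydisc_upd => //.
by rewrite cmod0; case/andP: hr.
Qed.

Lemma ent_line_at f z w (l : 'I_n -> R[i]) :
  (forall e, 0 < e -> exists2 d : R, 0 < d & forall rho w, 0 <= rho <= d -> polydisc w rho ->
    cmod (f (z + w) - f z - \sum_j l j * w j 0) <= e * rho) ->
  cdiff_at (fun t => f (z + t *: w)) 0 (\sum_j l j * w j 0).
Proof.
move=> lP e e0; have [K K0 Kw] := polydisc_ex w.
have [d d0 dP] := lP (e / K) (divr_gt0 e0 K0).
exists (d / K) => [|u ud]; first by rewrite divr_gt0.
have := dP (cmod u * K) (u *: w) _ (polydiscZ u Kw).
rewrite mulr_ge0 ?cmod_ge0 ?(ltW K0)//= -ler_pdivlMr// => /(_ ud).
have -> : e / K * (cmod u * K) = e * cmod u by field; rewrite gt_eqF.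
rewrite add0r scale0r addr0; have -> // : \sum_j l j * (u *: w) j 0 = (\sum_j l j * w j 0) * u.
by rewrite mulr_suml; apply: eq_bigr => j _; rewrite mxE; ring.
Qed.

Lemma ent_line f z w : ent f -> cdiff (fun t => f (z + t *: w)).
Proof.
move=> ef t; have [l lP] := ef (z + t *: w).
exists (\sum_j l j * w j 0) => e e0; have [d d0 dP] := ent_line_at w lP e0.
exists d => // u /dP; rewrite add0r scale0r addr0.
by rewrite scalerDl addrA.
Qed.

Lemma ent_upd_line f z j : ent f -> cdiff (fun t => f (upd z j t)).
Proof.
move=> ef; have -> : (fun t => f (upd z j t)) =
    (fun t => f (upd z j 0 + t *: delta_mx j 0)).
  apply/funext => t; congr f; apply/colP => i; rewrite !mxE andbT.
  by case: eqP => _; rewrite ?mulr1 ?mulr0 ?add0r ?addr0.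
exact: ent_line.
Qed.

(** Near 0 the function is approximated both by its derivative, up to [o(u)], and by two Taylor
    terms, up to [O(u ^ 2)]; dividing the difference by [u] compares the slopes. *)
Lemma tcoef_derive (F : R[i] -> R[i]) (l : R[i]) r M : cdiff F -> 0 < r ->
  (forall t, cmod t <= r -> cmod (F t) <= M) -> cdiff_at F 0 l -> tcoef F 1 = l.
Proof.
move=> dF r0 FM dl; apply: cmod_eq_le => e e0; have e2 : 0 < e / 2 by rewrite divr_gt0.
have [d d0 dP] := dl _ e2.
have M0 : 0 <= M by apply: le_trans (FM 0 _); rewrite ?cmod_ge0// cmod0 ltW.
pose B := 4 * M / r ^+ 2 + 1.
have B0 : 0 < B by rewrite ltr_wpDl// divr_ge0 ?mulr_ge0 ?exprn_ge0// ltW.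
(* The three bounds make available the derivative estimate, the Taylor estimate, and
   [4 * M * (u / r) ^ 2 <= e / 2 * u]. *)
pose u := Num.min (Num.min d (r / 2)) (e / 2 / B).
have u0 : 0 < u by rewrite !lt_min d0 !divr_gt0.
have uC : cmod u%:C = u by rewrite cmod_real gtr0_norm.
have := dP u%:C; rewrite uC !ge_min lexx => /(_ isT); rewrite add0r => h1.
have := @taylor R F r M u%:C 2 dF r0 _ FM; rewrite uC !ge_min lexx orbT => /(_ isT).
have := @taylor R F r M 0 1 dF r0 _ FM; rewrite cmod0 divr_ge0 ?(ltW r0)// => /(_ isT).
rewrite mul0r expr1 mulr0 big_ord1 expr0 mulr1 => h0.
have F0 : F 0 = tcoef F 0.
  by apply: cmod_eq_le => e' e'0; apply: le_trans h0 (ltW e'0).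
rewrite !big_ord_recr big_ord0 /= add0r expr0 mulr1 expr1 => h2.
move: h1; rewrite F0.
move=> h1; rewrite -(ler_pM2r u0) -[X in _ * X]uC -cmodM.
have -> : (tcoef F 1 - l) * u%:C = (F u%:C - tcoef F 0 - l * u%:C) -
  (F u%:C - (tcoef F 0 + tcoef F 1 * u%:C)) by ring.
apply: le_trans (cmodB_le _ _) _.
have h3 : 4 * M * (u / r) ^+ 2 <= e / 2 * u.
  have -> : 4 * M * (u / r) ^+ 2 = 4 * M / r ^+ 2 * u * u by field; rewrite gt_eqF.
  rewrite ler_pM2r//; apply: (@le_trans _ _ (u * B)).
    by rewrite mulrC ler_pM2l// /B lerDl.
  by rewrite -ler_pdivlMr// !ge_min lexx !orbT.
lra.
Qed.

(** Taylor with two terms on the complex line through [z] in the direction [w]. The bound depends on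
    [f] only through [M], so it is uniform over a locally bounded family; this is what makes limits
    tractable. *)
Lemma ent_quadratic f z M (l : 'I_n -> R[i]) : ent f ->
  (forall w, polydisc w 1 -> cmod (f (z + w)) <= M) ->
  (forall e, 0 < e -> exists2 d : R, 0 < d & forall rho w, 0 <= rho <= d -> polydisc w rho ->
    cmod (f (z + w) - f z - \sum_j l j * w j 0) <= e * rho) ->
  forall rho w, 0 <= rho <= 2^-1 -> polydisc w rho ->
    cmod (f (z + w) - f z - \sum_j l j * w j 0) <= 4 * M * rho ^+ 2.
Proof.
move=> ef fM lP rho w /andP[]; rewrite le_eqVlt => /predU1P[<- _|rho0 rho2] hw.
  have -> : w = 0.
    apply/colP => j; rewrite mxE; apply/eqP; rewrite -cmod_eq0 eq_le cmod_ge0.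
    by rewrite hw.
  rewrite addr0 subrr sub0r big1 ?oppr0 ?cmod0 ?expr0n ?mulr0//.
  by move=> j _; rewrite mxE mulr0.
have rhoN : rho%:C != 0 :> R[i] by rewrite -cmod_gt0 cmod_real normr_gt0 gt_eqF.
(* Normalizing the direction into the unit polydisc brings out the factor [rho ^ 2]: the line is
   evaluated at the parameter [rho], at most half the radius 1. *)
pose v := rho%:C^-1 *: w.
have hv : polydisc v 1.
  have := polydiscZ rho%:C^-1 hw; rewrite cmodV cmod_real gtr0_norm// mulVf//.
  by rewrite gt_eqF.
pose F t := f (z + t *: v).
have dF : cdiff F by exact: ent_line.
have FM t : cmod t <= 1 -> cmod (F t) <= M.
  by move=> t1; apply/fM/(le_polydisc t1); rewrite -[cmod t]mulr1; exact: polydiscZ.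
have t1 := tcoef_derive dF ltr01 FM (ent_line_at v lP).
have := @taylor R F 1 M 0 1 dF ltr01 _ FM; rewrite cmod0 divr_ge0// => /(_ isT).
rewrite mul0r expr1 mulr0 big_ord1 expr0 mulr1 => h0.
have {}h0 : F 0 = tcoef F 0.
  by apply: cmod_eq_le => e' e'0; apply: le_trans h0 (ltW e'0).
have rC : cmod rho%:C = rho by rewrite cmod_real gtr0_norm.
have := @taylor R F 1 M rho%:C 2 dF ltr01 _ FM; rewrite rC div1r => /(_ rho2).
rewrite !big_ord_recr big_ord0 /= add0r expr0 mulr1 expr1 t1 -h0 divr1.
rewrite /F scale0r addr0 scalerA mulfV// scale1r.
have -> : (\sum_j l j * v j 0) * rho%:C = \sum_j l j * w j 0.
  by rewrite mulr_suml; apply: eq_bigr => j _; rewrite mxE; field.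
by rewrite opprD addrA.
Qed.

End entire_functions.

(** * Limits of entire functions and coefficients in one coordinate *)

Section entire_limits.
Variables (R : realType) (n : nat).
Local Notation vec := 'cV[R[i]]_n.
Implicit Types (z w : vec) (f g : vec -> R[i]) (r rho e M : R) (i j : 'I_n).

(** Compactness is applied to a cube of real vectors of length [n + n], whose image under [c]
    contains the polydisc. *)
Lemma ent_bounded f r : ent f -> exists M, forall z, polydisc z r -> cmod (f z) <= M.
Proof.
move=> ef; pose c (x : 'rV[R]_(n + n)) : vec :=
  \col_j (x 0 (lshift n j) +i* x 0 (rshift n j)).
pose g (x : 'rV[R]_(n + n)) : R := cmod (f (c x)).
pose K := [set x : 'rV[R]_(n + n) | forall i : 'I_(n + n), `[- r, r]%classic (x ord0 i)].
have cK : compact K.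
  by apply: (@rV_compact R (n + n) (fun=> `[- r, r]%classic)) => i; exact: segment_compact.
have cg : continuous g.
  move=> x; apply/(@cvgrPdist_le _ _ _ (nbhs x) (nbhs_filter x)) => e e0.
  have [L [d [L0 d0 dP]]] := ent_lip (c x) ef.
  pose rho := Num.min d (e / L).
  have rho0 : 0 < rho by rewrite lt_min d0 divr_gt0.
  apply/nbhs_ballP; exists (rho / 2); first by rewrite /= divr_gt0.
  move=> y [_ xy]; rewrite distrC /g.
  have hw : polydisc (c y - c x) rho.
    move=> j; rewrite !mxE; apply: le_trans (cmod_le_ReIm _) _ => /=.
    have h1 : `|x 0 (lshift n j) - y 0 (lshift n j)| < rho / 2 by exact: xy.
    have h2 : `|x 0 (rshift n j) - y 0 (rshift n j)| < rho / 2 by exact: xy.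
    rewrite distrC [X in _ + X]distrC; lra.
  have := dP rho _ _ hw; rewrite (ltW rho0) ge_min lexx => /(_ isT).
  rewrite (addrC (c x)) subrK => h.
  apply: (@le_trans _ _ (L * rho)); last by rewrite mulrC -ler_pdivlMr// ge_min lexx orbT.
  have a1 := cmodD_le (f (c y) - f (c x)) (f (c x)).
  have a2 := cmodD_le (f (c x) - f (c y)) (f (c y)).
  rewrite !subrK (cmodBC (f (c x))) in a1 a2.
  by rewrite ler_norml; apply/andP; split; lra.
have [M [_ MP]] : bounded_set (g @` K).
  by apply: compact_bounded; apply: continuous_compact => //; exact: continuous_subspaceT.
exists (M + 1) => z zr.
pose x : 'rV[R]_(n + n) :=
  row_mx (\row_j complex.Re (z j 0)) (\row_j complex.Im (z j 0)).
have cx : c x = z.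
  apply/colP => j; rewrite mxE row_mxEl row_mxEr !mxE.
  by case: (z j 0).
have Kx : K x.
  move=> i; rewrite /= in_itv /= -ler_norml.
  rewrite -(fintype.splitK i); case: (fintype.split i) => j /=; rewrite ?row_mxEl ?row_mxEr mxE.
    exact: le_trans (Re_le_cmod _) (zr j).
  exact: le_trans (Im_le_cmod _) (zr j).
have /MP : M < M + 1 by rewrite ltrDl.
move=> /(_ (g x) (ex_intro2 _ _ x Kx erefl)); rewrite /g cx.
exact: le_trans (ler_norm _).
Qed.

(** The quadratic bound holds with one constant for all [m]. It forces the derivatives at [z] to
    form Cauchy sequences, and then passes to the limit itself. *)
Lemma ent_limit (f_ : nat -> vec -> R[i]) f :
  (forall m, ent (f_ m)) ->
  (forall r, exists M, forall m z, polydisc z r -> cmod (f_ m z) <= M) ->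
  (forall z, ccvg (f_^~ z) (f z)) -> ent f.
Proof.
move=> ef bf cf z; have [r r0 hz] := polydisc_ex z.
have [M MP] := bf (r + 1).
have M0 : 0 <= M.
  by apply: le_trans (MP 0%N z _); [exact: cmod_ge0|apply: le_polydisc hz; rewrite lerDl].
have hM m w : polydisc w 1 -> cmod (f_ m (z + w)) <= M.
  by move=> hw; apply: MP; exact: polydiscD.
pose l_ m := projT1 (cid (ef m z)); have l_P m := projT2 (cid (ef m z)).
have Q m rho w := @ent_quadratic R n (f_ m) z M (l_ m) (ef m) (hM m) (l_P m) rho w.
have half0 : 0 < 2^-1 :> R by rewrite invr_gt0.
have [l lP] : exists l : 'I_n -> R[i], forall j, ccvg (l_^~ j) (l j).
  suff H j : exists y, ccvg (l_^~ j) y by have [l lP] := choice H; exists l.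
  apply: ccvg_cauchy => e e0.
  (* The two quadratic errors sum to [8 * M * rho ^ 2], at most [e / 2 * rho] for this [rho]; the
     four values of [f_] are taken within [e * rho / 8] of their limits and account for the other
     half. *)
  pose rho : R := Num.min 2^-1 (e / (16 * M + 1)).
  have B0 : 0 < 16 * M + 1 by rewrite ltr_wpDl// mulr_ge0.
  have rho0 : 0 < rho by rewrite lt_min half0 divr_gt0.
  have rC : cmod rho%:C = rho by rewrite cmod_real gtr0_norm.
  pose w : vec := rho%:C *: delta_mx j 0.
  have hw : polydisc w rho by have := polydisc_delta rho%:C j; rewrite rC.
  have e8 : 0 < e * rho / 8 by rewrite divr_gt0// mulr_gt0.
  have [N1 N1P] := cf z _ e8; have [N2 N2P] := cf (z + w) _ e8.
  exists (maxn N1 N2) => m p; rewrite !geq_max => /andP[m1 m2] /andP[p1 p2].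
  have hr : 0 <= rho <= 2^-1 by rewrite (ltW rho0) ge_min lexx.
  have := Q m rho w hr hw; have := Q p rho w hr hw.
  have Sw m' : \sum_i l_ m' i * w i 0 = l_ m' j * rho%:C.
    rewrite (bigD1 j)//= !mxE !eqxx mulr1 big1 ?addr0// => i ij.
    by rewrite !mxE (negbTE ij) !mulr0.
  rewrite !Sw; move: (N1P _ m1) (N1P _ p1) (N2P _ m2) (N2P _ p2).
  set a := f_ m z; set a' := f_ p z; set b := f_ m _; set b' := f_ p _.
  move=> h1 h2 h3 h4 h5 h6.
  rewrite -(ler_pM2r rho0) -[X in cmod _ * X]rC -cmodM.
  have -> : (l_ m j - l_ p j) * rho%:C = (b' - a' - l_ p j * rho%:C) -
    (b - a - l_ m j * rho%:C) + ((b - f (z + w)) - (b' - f (z + w))) -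
    ((a - f z) - (a' - f z)) by ring.
  apply: le_trans (cmodB_le _ _) _.
  have := cmodD_le (b' - a' - l_ p j * rho%:C - (b - a - l_ m j * rho%:C))
    (b - f (z + w) - (b' - f (z + w))).
  have := cmodB_le (b' - a' - l_ p j * rho%:C) (b - a - l_ m j * rho%:C).
  have := cmodB_le (b - f (z + w)) (b' - f (z + w)).
  have := cmodB_le (a - f z) (a' - f z).
  have : 8 * M * rho ^+ 2 <= e / 2 * rho.
    have -> : 8 * M * rho ^+ 2 = (16 * M * rho) / 2 * rho by field.
    rewrite ler_pM2r// ler_pM2r//; apply: (@le_trans _ _ ((16 * M + 1) * rho)).
      by rewrite ler_pM2r// lerDl.
    by rewrite mulrC -ler_pdivlMr// ge_min lexx orbT.
  lra.
have QL rho w : 0 <= rho <= 2^-1 -> polydisc w rho ->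
    cmod (f (z + w) - f z - \sum_j l j * w j 0) <= 4 * M * rho ^+ 2.
  move=> hr hw; apply: ccvg_le (fun m => Q m rho w hr hw).
  apply: ccvgB; first exact: ccvgB.
  apply: ccvg_sum => j; rewrite mulrC; under [u in ccvg u]eq_fun do rewrite mulrC.
  exact: ccvgZ.
exists l => e e0; have B0 : 0 < 4 * M + 1 by rewrite ltr_wpDl// mulr_ge0.
exists (Num.min 2^-1 (e / (4 * M + 1))); first by rewrite lt_min half0 divr_gt0.
move=> rho w /andP[r0']; rewrite le_min => /andP[r2 re] hw.
apply: le_trans (QL rho w _ hw) _; first by rewrite r0'.
rewrite expr2 mulrA ler_wpM2r//; apply: (@le_trans _ _ ((4 * M + 1) * rho)).
  by rewrite ler_wpM2r// lerDl.
by rewrite mulrC -ler_pdivlMr.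
Qed.

(** Kept as a function on all of C^n, though it does not depend on the [j]-th coordinate, so that
    the operation can be iterated over the variables. *)
Definition pcoef j k f : vec -> R[i] := fun z => tcoef (fun t => f (upd z j t)) k.

Lemma pcoef_le f j k z r M : ent f -> 0 < r ->
  (forall z, polydisc z r -> cmod (f z) <= M) -> polydisc z r ->
  cmod (pcoef j k f z) * r ^+ k <= 2 * M.
Proof.
move=> ef r0 fM hz; apply: tcoef_le => //; first exact: ent_upd_line.
by move=> t tr; apply: fM; exact: polydisc_upd.
Qed.

Lemma pcoef_taylor f j z r M N : ent f -> 0 < r ->
  (forall z, polydisc z r -> cmod (f z) <= M) -> polydisc z r -> cmod (z j 0) <= r / 2 ->
  cmod (f z - \sum_(k < N) pcoef j k f z * z j 0 ^+ k) <= 4 * M * (cmod (z j 0) / r) ^+ N.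
Proof.
move=> ef r0 fM hz zj.
have := @taylor R (fun t => f (upd z j t)) r M (z j 0) N (ent_upd_line z j ef) r0 zj.
by rewrite upd_id; apply => t tr; apply: fM; exact: polydisc_upd.
Qed.

(* The [k]-th coefficient is the locally bounded limit of the difference
   quotients [(f (upd z j t) - sum_(i < k) pcoef j i f z * t ^ i) / t ^ k]. *)
Lemma ent_pcoef f j k : ent f -> ent (pcoef j k f).
Proof.
move=> ef; elim/ltn_ind: k => k IH.
(* Starting at 1/2, the largest point at which [taylor] with radius 1 applies. *)
pose t m : R := m.+2%:R^-1.
have t0 m : 0 < t m by rewrite invr_gt0.
have t2 m : t m <= 2^-1 by rewrite lef_pV2 ?posrE// ler_nat.
have tC m : cmod (t m)%:C = t m by rewrite cmod_real gtr0_norm.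
pose g m z := (f (upd z j (t m)%:C) - \sum_(i < k) pcoef j i f z * (t m)%:C ^+ i) *
  ((t m)%:C ^+ k)^-1.
(* The Taylor remainder after [k + 1] terms, divided by [t ^ k], leaves one factor [t]. The estimate
   is uniform on the polydisc, so it gives both the local bound and the convergence. *)
have est z r M : 1 <= r -> polydisc z r -> (forall z, polydisc z r -> cmod (f z) <= M) ->
    forall m, cmod (g m z - pcoef j k f z) <= 4 * M * t m.
  move=> r1 hz fM m.
  have tk : (t m)%:C ^+ k != 0 by rewrite expf_neq0// -cmod_gt0 tC.
  have := @taylor R (fun u => f (upd z j u)) 1 M (t m)%:C k.+1 (ent_upd_line z j ef) ltr01.
  rewrite tC div1r divr1 => /(_ (t2 m)) H.
  have {}H := H _; rewrite big_ord_recr /= -/(pcoef j k f z) in H.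
  have -> : g m z - pcoef j k f z = (f (upd z j (t m)%:C) -
     (\sum_(i < k) pcoef j i f z * (t m)%:C ^+ i + pcoef j k f z * (t m)%:C ^+ k)) *
     ((t m)%:C ^+ k)^-1.
    by rewrite /g opprD addrA [in RHS]mulrBl mulfK.
  rewrite cmodM cmodV cmodX tC ler_pdivrMr ?exprn_gt0// -[leRHS]mulrA -exprS.
  by apply: H => u u1; apply: fM; apply: polydisc_upd => //; exact: le_trans u1 r1.
apply: (@ent_limit g).
- move=> m; apply: entM; last exact: ent_cst.
  apply: entD; first exact: ent_upd.
  have -> : (fun z => - \sum_(i < k) pcoef j i f z * (t m)%:C ^+ i) =
      (fun z => \sum_(i < k) pcoef j i f z * - (t m)%:C ^+ i).
    apply/funext => z; rewrite -sumrN; apply: eq_bigr => i _; by rewrite mulrN.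
  by apply: ent_sum => i; apply: entM; [exact: IH|exact: ent_cst].
- move=> r; pose r' := Num.max r 1; have r'1 : 1 <= r' by rewrite le_max lexx orbT.
  have r'0 : 0 < r' by exact: lt_le_trans r'1.
  have [M MP] := ent_bounded r' ef; exists (6 * M) => m z zr.
  have zr' : polydisc z r' by apply: le_polydisc zr; rewrite le_max lexx.
  have M0 : 0 <= M by exact: le_trans (cmod_ge0 _) (MP z zr').
  have h1 := est z r' M r'1 zr' MP m.
  have h2 := pcoef_le j k ef r'0 MP zr'.
  have h3 : cmod (pcoef j k f z) <= 2 * M.
    by apply: le_trans h2; rewrite ler_peMr ?cmod_ge0// exprn_ege1.
  have := cmodD_le (g m z - pcoef j k f z) (pcoef j k f z); rewrite subrK.
  have : 4 * M * t m <= 4 * M by rewrite ler_piMr ?mulr_ge0//; have := t2 m; lra.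
  lra.
- move=> z e e0; have [r r0 hz] := polydisc_ex z.
  pose r' := Num.max r 1; have r'1 : 1 <= r' by rewrite le_max lexx orbT.
  have zr' : polydisc z r' by apply: le_polydisc hz; rewrite le_max lexx.
  have [M MP] := ent_bounded r' ef.
  have M0 : 0 <= M by exact: le_trans (cmod_ge0 _) (MP z zr').
  have B0 : 0 < 4 * M + 1 by rewrite ltr_wpDl// mulr_ge0.
  have := near_infty_natSinv_lt (PosNum (divr_gt0 e0 B0)) => -[N _ NP].
  exists N => m Nm; apply: le_trans (est z r' M r'1 zr' MP m) _.
  have tm : t m <= e / (4 * M + 1).
    apply/ltW/(le_lt_trans _ (NP m Nm)).
    by rewrite /t lef_pV2 ?posrE// ler_nat.
  apply: (@le_trans _ _ ((4 * M + 1) * (e / (4 * M + 1)))).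
    by apply: ler_pM; rewrite ?mulr_ge0 ?(ltW (t0 m))// lerDl.
  by rewrite mulrC divfK// gt_eqF.
Qed.

Definition indep j f := forall z t, f (upd z j t) = f z.

Lemma indep_pcoef i j k f : indep i f -> indep i (pcoef j k f).
Proof.
move=> fi z t; rewrite /pcoef; have [->|ij] := eqVneq i j.
  by rewrite (_ : (fun u => f (upd (upd z j t) j u)) = fun u => f (upd z j u))//;
    apply/funext => u; rewrite upd_upd.
rewrite (_ : (fun u => f (upd (upd z i t) j u)) = fun u => f (upd z j u))//.
by apply/funext => u; rewrite upd_comm// fi.
Qed.

Lemma indep_pcoef_self j k f : indep j (pcoef j k f).
Proof.
move=> z t; rewrite /pcoef.
rewrite (_ : (fun u => f (upd (upd z j t) j u)) = fun u => f (upd z j u))//.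
by apply/funext => u; rewrite upd_upd.
Qed.

Lemma indep_all f z w : (forall j, indep j f) -> f z = f w.
Proof.
move=> fi.
have H (s : seq 'I_n) : f (\col_i (if i \in s then w i 0 else z i 0)) = f z.
  elim: s => [|j s <-].
    by congr f; apply/colP => i; rewrite mxE.
  rewrite -[RHS](fi j _ (w j 0)); congr f; apply/colP => i; rewrite !mxE inE.
  by case: eqP => [->|].
rewrite -(H (enum 'I_n)); congr f; apply/colP => i.
by rewrite mxE mem_enum.
Qed.

End entire_limits.

(** * Multiple power series *)

Section power_series.
Variables (R : realType) (n : nat).
Local Notation vec := 'cV[R[i]]_n.
Local Notation idx := {ffun 'I_n -> nat}.
Implicit Types (z w : vec) (f g : vec -> R[i]) (r rho e M : R) (i j : 'I_n)
  (x y : idx) (s : seq 'I_n) (c : idx -> R[i]).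

Definition fupd x j k : idx := [ffun i => if i == j then k else x i].

(** Entries off [s] are 0. The recursion on [s] lets a sum over multi-indices unfold one variable at
    a time. *)
Fixpoint boxs s N : seq idx := if s is j :: s' then
  [seq fupd x j k | k <- iota 0 N, x <- boxs s' N] else [:: [ffun=> 0%N]].

Lemma mem_boxs s N x : uniq s ->
  (x \in boxs s N) = [forall i, if i \in s then (x i < N)%N else x i == 0%N].
Proof.
elim: s x => [|j s IH] x /=.
  move=> _; rewrite inE; apply/eqP/forallP => [-> i|H]; first by rewrite ffunE.
  by apply/ffunP => i; rewrite ffunE; apply/eqP/H.
move=> /andP[js us]; apply/allpairsPdep/forallP.
  move=> [k [y [kN yb ->]]] i; rewrite ffunE inE.
  move: yb; rewrite IH// => /forallP/(_ i) yi.
  case: (i == j) => //=.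
  by move: kN; rewrite mem_iota add0n.
move=> H; exists (x j), (fupd x j 0); split.
- by have := H j; rewrite inE eqxx /= mem_iota add0n.
- rewrite IH//; apply/forallP => i; rewrite ffunE.
  have := H i; rewrite inE; case: eqP => [-> _|//] /=.
  by rewrite (negbTE js).
- by apply/ffunP => i; rewrite !ffunE; case: eqP => [->|].
Qed.

Lemma uniq_boxs s N : uniq s -> uniq (boxs s N).
Proof.
elim: s => //= j s IH /andP[js us].
apply: allpairs_uniq_dep; [exact: iota_uniq|by move=> k _; exact: IH|].
move=> [k x] [k' x'] /allpairsPdep[k1 [x1 [_ x1b [-> ->]]]]
  /allpairsPdep[k2 [x2 [_ x2b [-> ->]]]] /= E.
have kk : k1 = k2 by have := congr1 (fun u : idx => u j) E; rewrite !ffunE eqxx.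
have x0 u : u \in boxs s N -> u j = 0%N.
  by rewrite mem_boxs// => /forallP/(_ j); rewrite (negbTE js) => /eqP.
congr existT; rewrite ?kk//; apply/ffunP => i.
have := congr1 (fun u : idx => u i) E; rewrite !ffunE; case: eqP => // -> _.
by rewrite !x0.
Qed.

Lemma big_boxs_cons (V : nmodType) (F : idx -> V) j s N :
  \sum_(x <- boxs (j :: s) N) F x = \sum_(k < N) \sum_(x <- boxs s N) F (fupd x j k).
Proof.
rewrite /= big_allpairs_dep.
have -> : iota 0 N = index_iota 0 N by rewrite /index_iota subn0.
by rewrite big_mkord.
Qed.

Fixpoint pcoefs s x f : vec -> R[i] :=
  if s is j :: s' then pcoefs s' x (pcoef j (x j) f) else f.

Lemma pcoefs_fupd s x j k f : j \notin s -> pcoefs s (fupd x j k) f = pcoefs s x f.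
Proof.
elim: s f => //= i s IH f; rewrite inE negb_or => /andP[ji js].
by rewrite IH// ffunE eq_sym (negbTE ji).
Qed.

Lemma indep_pcoefs i s x f : indep i f -> indep i (pcoefs s x f).
Proof. by elim: s f => //= j s IH f fi; apply: IH; exact: indep_pcoef. Qed.

Lemma indep_pcoefs_mem i s x f : i \in s -> indep i (pcoefs s x f).
Proof.
elim: s f => //= j s IH f; rewrite inE => /predU1P[->|/IH//].
by apply: indep_pcoefs; exact: indep_pcoef_self.
Qed.

Definition mons s x z : R[i] := \prod_(j <- s) z j 0 ^+ x j.

Lemma mons_fupd s x j k z : j \notin s -> mons s (fupd x j k) z = mons s x z.
Proof.
move=> js; rewrite /mons !big_seq; apply: eq_bigr => i is_; rewrite ffunE.
by case: eqP => // ij; rewrite -ij is_ in js.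
Qed.

Lemma pcoefs_le s x f z r M : ent f -> 0 < r ->
  (forall z, polydisc z r -> cmod (f z) <= M) -> polydisc z r ->
  cmod (pcoefs s x f z) * r ^+ (\sum_(j <- s) x j) <= 2 ^+ size s * M.
Proof.
move=> ef r0; elim: s f ef M => [|j s IH] f ef M fM zr.
  by rewrite big_nil expr0 mulr1 expr0 mul1r; exact: fM.
have rk : 0 < r ^+ x j by rewrite exprn_gt0.
rewrite big_cons exprD mulrCA /= -ler_pdivlMl//.
apply: le_trans (IH _ (ent_pcoef j (x j) ef) (2 * M / r ^+ x j) _ zr) _.
  by move=> w wr; rewrite ler_pdivlMr//; exact: pcoef_le.
by rewrite exprSr le_eqVlt; apply/orP; left; apply/eqP; field; rewrite gt_eqF.
Qed.

Lemma geometric_half_le N : \sum_(k < N) 2^-1 ^+ k <= 2 :> R.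
Proof.
have : (1 - 2^-1) * (\sum_(k < N) 2^-1 ^+ k) <= 1 :> R.
  rewrite -[1 - _]opprB mulNr -subrX1 opprB lerBlDr lerDl.
  by rewrite exprn_ge0.
lra.
Qed.

(** Expanding in [z j] costs [4 * M * 2^-1 ^ N]. The coefficient functions are bounded by
    [2 * M / r ^ k], and expanding them in the other variables costs [K] times that; the factor
    [(r / 2) ^ k] turns the sum over [k] into a geometric one, at most 2. Hence [4 + 4 * K]. *)
Lemma boxs_approx s : uniq s -> exists2 K : R, 0 <= K & forall f z r M N,
  ent f -> 0 < r -> (forall z, polydisc z r -> cmod (f z) <= M) -> polydisc z (r / 2) ->
  cmod (f z - \sum_(x <- boxs s N) pcoefs s x f z * mons s x z) <= K * M * 2^-1 ^+ N.
Proof.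
elim: s => [|j s IH] /= us.
  exists 0 => // f z r M N _ _ _ _; rewrite big_seq1 /mons big_nil mulr1 subrr cmod0.
  by rewrite !mul0r.
case/andP: us => js us; have [K K0 KP] := IH us.
exists (4 + 4 * K); first by rewrite addr_ge0// mulr_ge0.
move=> f z r M N ef r0 fM zr2.
have zr : polydisc z r by apply: le_polydisc zr2; lra.
have M0 : 0 <= M by exact: le_trans (cmod_ge0 _) (fM z zr).
rewrite big_boxs_cons.
have -> : \sum_(k < N) \sum_(x <- boxs s N) pcoefs (j :: s) (fupd x j k) f z *
    mons (j :: s) (fupd x j k) z = \sum_(k < N) z j 0 ^+ k *
    \sum_(x <- boxs s N) pcoefs s x (pcoef j k f) z * mons s x z.
  apply: eq_bigr => k _; rewrite mulr_sumr; apply: eq_bigr => x _ /=.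
  rewrite pcoefs_fupd// [mons (j :: s) _ _]big_cons -/(mons _ _ _) mons_fupd//.
  by rewrite ffunE eqxx mulrCA.
set S := \sum_(k < N) _.
have -> : f z - S = (f z - \sum_(k < N) pcoef j k f z * z j 0 ^+ k) +
    \sum_(k < N) z j 0 ^+ k * (pcoef j k f z -
      \sum_(x <- boxs s N) pcoefs s x (pcoef j k f) z * mons s x z).
  rewrite -addrA; congr (_ + _); rewrite /S -sumrN -sumrN -big_split /=.
  by apply: eq_bigr => k _; ring.
apply: le_trans (cmodD_le _ _) _; rewrite mulrDl mulrDl; apply: lerD.
  apply: le_trans (pcoef_taylor N ef r0 fM zr (zr2 j)) _.
  rewrite ler_wpM2l ?mulr_ge0// lerXn2r ?nnegrE ?divr_ge0 ?cmod_ge0 ?(ltW r0)//.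
  by rewrite ler_pdivrMr// mulrC; exact: zr2.
apply: le_trans (cmod_sum _ _ _) _.
apply: (@le_trans _ _ (\sum_(k < N) 2^-1 ^+ k * (2 * K * M * 2^-1 ^+ N))).
  apply: ler_sum => k _; rewrite cmodM cmodX.
  have rk : 0 < r ^+ k by rewrite exprn_gt0.
  have h := KP (pcoef j k f) z r (2 * M / r ^+ k) N (ent_pcoef j k ef) r0 _ zr2.
  apply: (@le_trans _ _ ((r / 2) ^+ k * (K * (2 * M / r ^+ k) * 2^-1 ^+ N))).
    apply: ler_pM; rewrite ?exprn_ge0 ?cmod_ge0//.
      by rewrite lerXn2r ?nnegrE ?divr_ge0 ?cmod_ge0 ?(ltW r0)//; exact: zr2.
    by apply: h => w wr; rewrite ler_pdivlMr//; exact: pcoef_le.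
  rewrite exprMn le_eqVlt; apply/orP; left; apply/eqP.
  by field; rewrite gt_eqF.
rewrite -mulr_suml.
have -> : 4 * K * M * 2^-1 ^+ N = 2 * (2 * K * M * 2^-1 ^+ N) by ring.
rewrite ler_wpM2r ?mulr_ge0 ?exprn_ge0//.
by have := geometric_half_le N; lra.
Qed.

Definition mon x z : R[i] := \prod_j z j 0 ^+ x j.

Definition deg x : nat := \sum_j x j.

Definition box N : seq idx := boxs (enum 'I_n) N.

Lemma mem_box N x : (x \in box N) = [forall i, (x i < N)%N].
Proof.
by rewrite mem_boxs ?enum_uniq//; apply: eq_forallb => i; rewrite mem_enum.
Qed.

Lemma uniq_box N : uniq (box N).
Proof. exact/uniq_boxs/enum_uniq. Qed.

Lemma mem_box_ex x : exists N, forall N', (N <= N')%N -> x \in box N'.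
Proof.
exists (\sum_i x i).+1 => N' NN'; rewrite mem_box; apply/forallP => i.
by apply: leq_trans NN'; rewrite ltnS (bigD1 i)//= leq_addr.
Qed.

Lemma box_subset N N' : (N <= N')%N -> {subset box N <= box N'}.
Proof.
move=> NN' x; rewrite !mem_box => /forallP H; apply/forallP => i.
exact: leq_trans (H i) NN'.
Qed.

Lemma big_box_split (V : zmodType) (F : idx -> V) N N' : (N <= N')%N ->
  \sum_(x <- box N') F x - \sum_(x <- box N) F x =
  \sum_(x <- box N' | x \notin box N) F x.
Proof.
move=> NN'; rewrite (bigID (mem (box N)) xpredT)/= addrC.
suff -> : \sum_(x <- box N' | x \in box N) F x = \sum_(x <- box N) F x by rewrite addrK.
rewrite -big_filter; apply: perm_big; apply: uniq_perm.
- by rewrite filter_uniq// uniq_box.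
- exact: uniq_box.
move=> x; rewrite mem_filter; apply/andP/idP => [[]//|xN].
by split=> //; exact: box_subset xN.
Qed.

(** The Cauchy estimates at every radius. [ent_expansion] and [expansion_ent] tie this growth
    condition to entire functions in both directions. *)
Definition bounded_coef c := forall r, 0 < r ->
  exists M, forall x, cmod (c x) * r ^+ deg x <= M.

Definition expands c f := forall z, ccvg (fun N => \sum_(x <- box N) c x * mon x z) (f z).

Theorem ent_expansion f : ent f -> exists2 c, bounded_coef c & expands c f.
Proof.
(* Once coefficients have been taken in all variables the result is constant, by [indep_all], so it
   may be evaluated at 0. *)
move=> ef; pose c x := pcoefs (enum 'I_n) x f 0.
have cE x z : pcoefs (enum 'I_n) x f z = c x.
  by apply: indep_all => j; apply: indep_pcoefs_mem; rewrite mem_enum.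
exists c.
- move=> r r0; have [M MP] := ent_bounded r ef.
  exists (2 ^+ size (enum 'I_n) * M) => x.
  have -> : deg x = \sum_(j <- enum 'I_n) x j by rewrite /deg big_enum.
  by apply: pcoefs_le => // j; rewrite mxE cmod0 ltW.
- move=> z e e0; have [r r0 zr] := polydisc_ex z.
  (* The radius is doubled because [boxs_approx] speaks of the polydisc of half the radius. *)
  have r20 : 0 < 2 * r by rewrite mulr_gt0.
  have [M MP] := ent_bounded (2 * r) ef.
  have [K K0 KP] := boxs_approx (enum_uniq 'I_n).
  have zr2 : polydisc z (2 * r / 2) by rewrite mulrAC divff// mul1r.
  have M0 : 0 <= M.
    by apply: le_trans (cmod_ge0 _) (MP z _); apply: le_polydisc zr; lra.
  have KM0 : 0 < K * M + 1 by rewrite ltr_wpDl// mulr_ge0.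
  have : (fun n => (K * M + 1) * 2^-1 ^+ n) @ \oo --> (K * M + 1) * 0.
    by apply: cvgMr; apply: cvg_expr; rewrite ger0_norm; lra.
  rewrite mulr0 => /cvgrPdist_le /(_ _ e0) [N _ NP]; exists N => m /NP.
  rewrite sub0r normrN => h; rewrite cmodBC.
  have := KP f z (2 * r) M m ef r20 MP zr2.
  have -> : \sum_(x <- boxs (enum 'I_n) m) pcoefs (enum 'I_n) x f z * mons (enum 'I_n) x z =
      \sum_(x <- box m) c x * mon x z.
    by apply: eq_bigr => x _; rewrite cE /mons /mon big_enum.
  move=> h'; apply: le_trans h' _; apply: le_trans (le_trans (ler_norm _) h).
  by rewrite ler_wpM2r ?exprn_ge0// lerDl.
Qed.

Lemma ent_mon x : ent (mon x).
Proof. by apply: ent_prod => j; apply: entX; exact: ent_coord. Qed.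

Lemma cmod_mon_le x z r : polydisc z r -> cmod (mon x z) <= r ^+ deg x.
Proof.
move=> zr; rewrite /mon cmod_prod /deg.
rewrite (big_morph _ (exprD r) (expr0 r)).
apply: ler_prod => j _; rewrite cmod_ge0 cmodX /=.
have r0 : 0 <= r by exact: le_trans (cmod_ge0 _) (zr j).
by rewrite lerXn2r ?nnegrE ?cmod_ge0//; exact: zr.
Qed.

(** The sum over the cube factors into [n] geometric sums, each at most 2. *)
Lemma sum_box_geometric N : \sum_(x <- box N) 2^-1 ^+ deg x <= 2 ^+ n :> R.
Proof.
have H s : uniq s -> \sum_(x <- boxs s N) 2^-1 ^+ (\sum_(j <- s) x j) <= 2 ^+ size s :> R.
  elim: s => [|j s IH] /= us; first by rewrite big_seq1 big_nil expr0.
  case/andP: us => js us; rewrite big_boxs_cons.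
  have -> : \sum_(k < N) \sum_(x <- boxs s N) 2^-1 ^+ (\sum_(i <- j :: s) fupd x j k i) =
      (\sum_(k < N) 2^-1 ^+ k) * \sum_(x <- boxs s N) 2^-1 ^+ (\sum_(i <- s) x i) :> R.
    rewrite mulr_suml; apply: eq_bigr => k _; rewrite mulr_sumr; apply: eq_bigr => x _.
    rewrite big_cons exprD ffunE eqxx; congr (_ * _ ^+ _); rewrite !big_seq.
    apply: eq_bigr => i is_; rewrite ffunE; case: eqP => // ij.
    by rewrite -ij is_ in js.
  rewrite exprS; apply: ler_pM; rewrite ?IH//.
  - by apply: sumr_ge0 => k _; rewrite exprn_ge0.
  - by apply: sumr_ge0 => k _; rewrite exprn_ge0.
  exact: geometric_half_le.
have := H _ (enum_uniq 'I_n); rewrite -cardE card_ord; apply: le_trans.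
rewrite le_eqVlt; apply/orP; left; apply/eqP; apply: eq_bigr => x _.
by rewrite /deg big_enum.
Qed.

Lemma coef_mon_le c M r z x : 0 < r -> (forall x, cmod (c x) * (2 * r) ^+ deg x <= M) ->
  polydisc z r -> cmod (c x * mon x z) <= M * 2^-1 ^+ deg x.
Proof.
move=> r0 cM zr; have r2 : 0 < (2 * r) ^+ deg x by rewrite exprn_gt0// mulr_gt0.
rewrite cmodM; apply: (@le_trans _ _ (M / (2 * r) ^+ deg x * r ^+ deg x)).
  by apply: ler_pM; rewrite ?cmod_ge0 ?ler_pdivlMr ?cmod_mon_le.
rewrite exprMn exprVn le_eqVlt; apply/orP; left; apply/eqP.
by field; rewrite !gt_eqF// exprn_gt0.
Qed.

(** Weierstrass majorant: coefficient bounds at radius [2 * r] dominate the terms at radius [r] by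
    [M * 2^-1 ^ deg x]. The right-hand side is an increment of a bounded monotone sequence, which
    yields the Cauchy property. *)
Lemma box_diff_le c M r z N N' : 0 < r -> (forall x, cmod (c x) * (2 * r) ^+ deg x <= M) ->
  polydisc z r -> (N <= N')%N ->
  cmod (\sum_(x <- box N') c x * mon x z - \sum_(x <- box N) c x * mon x z) <=
  M * \sum_(x <- box N') 2^-1 ^+ deg x - M * \sum_(x <- box N) 2^-1 ^+ deg x.
Proof.
move=> r0 cM zr NN'; rewrite -mulrBr !big_box_split//.
apply: le_trans (cmod_sum _ _ _) _; rewrite mulr_sumr; apply: ler_sum => x _.
exact: coef_mon_le x r0 cM zr.
Qed.

Lemma box_sum_le c M r z N : 0 < r -> (forall x, cmod (c x) * (2 * r) ^+ deg x <= M) ->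
  polydisc z r -> cmod (\sum_(x <- box N) c x * mon x z) <= M * 2 ^+ n.
Proof.
move=> r0 cM zr.
have M0 : 0 <= M.
  apply: le_trans (cM [ffun=> 0%N]); rewrite mulr_ge0 ?cmod_ge0 ?exprn_ge0//.
  by rewrite mulr_ge0// ltW.
apply: (@le_trans _ _ (M * \sum_(x <- box N) 2^-1 ^+ deg x)); last first.
  by rewrite ler_wpM2l// sum_box_geometric.
apply: le_trans (cmod_sum _ _ _) _; rewrite mulr_sumr; apply: ler_sum => x _.
exact: coef_mon_le x r0 cM zr.
Qed.

Theorem expansion_ent c : bounded_coef c -> exists2 g, ent g & expands c g.
Proof.
move=> bc; pose S N z := \sum_(x <- box N) c x * mon x z.
have [g gP] : exists g, forall z, ccvg (S^~ z) (g z).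
  suff H z : exists l, ccvg (S^~ z) l by have [g gP] := choice H; exists g.
  have [r r0 zr] := polydisc_ex z; have [M MP] := bc (2 * r) (mulr_gt0 (ltr0n R 2) r0).
  have M0 : 0 <= M.
    apply: le_trans (MP [ffun=> 0%N]); rewrite mulr_ge0 ?cmod_ge0 ?exprn_ge0//.
    by rewrite mulr_ge0// ltW.
  pose a N : R := M * \sum_(x <- box N) 2^-1 ^+ deg x.
  have ca : cvgn a.
    apply: nondecreasing_is_cvgn.
      move=> N N' NN'; rewrite /a ler_wpM2l// -subr_ge0 big_box_split//.
      by apply: sumr_ge0 => x _; rewrite exprn_ge0.
    exists (M * 2 ^+ n) => _ [N _ <-].
    by rewrite /a ler_wpM2l// sum_box_geometric.
  apply: ccvg_cauchy => e e0; have e2 : 0 < e / 2 by rewrite divr_gt0.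
  move/cvg_ex : ca => [l /cvgrPdist_le /(_ _ e2)[N _ NP]]; exists N.
  have W m p : (N <= m)%N -> (m <= p)%N -> cmod (S m z - S p z) <= e.
    move=> Nm mp; rewrite cmodBC; apply: le_trans (box_diff_le r0 MP zr mp) _.
    rewrite -/(a p) -/(a m); have := NP m Nm; have := NP p (leq_trans Nm mp).
    by rewrite /= !ler_norml => /andP[? ?] /andP[? ?]; lra.
  move=> m p Nm Np; case/orP: (leq_total m p) => h; first exact: W.
  by rewrite cmodBC; exact: W.
exists g; last by [].
apply: (@ent_limit _ _ S) => //.
- by move=> m; apply: ent_sum => x; apply: entM; [exact: ent_cst|exact: ent_mon].
move=> r; pose r' := Num.max r 1.
have r'0 : 0 < r' by rewrite lt_max ltr01 orbT.
have [M MP] := bc (2 * r') (mulr_gt0 (ltr0n R 2) r'0).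
exists (M * 2 ^+ n) => m z zr; apply: (box_sum_le _ r'0 MP).
by apply: le_polydisc zr; rewrite le_max lexx.
Qed.

End power_series.

(** * From differentiability in normed spaces to the epsilon form *)

Section differentiable_eps.
Variables (K : numFieldType) (V W : normedModType K).
Implicit Types (f : V -> W) (x : V).

Lemma differentiable_eps f x : differentiable f x -> exists L : {linear V -> W},
  forall e : K, 0 < e -> \forall h \near (0 : V), `|f (x + h) - f x - L h| <= e * `|h|.
Proof.
move=> dfx; have /eqaddoP H := diff_locally dfx; exists ('d f x) => e e0.
apply: filterS (H _ e0) => h; apply: le_trans.
rewrite /= -[(f \o shift x - (cst (f x) + 'd f x)) h]/(f (h + x) - (f x + 'd f x h)).
by rewrite opprD addrA [x + h]addrC.
Qed.

Lemma eps_differentiable f x (L : {linear V -> W}) : continuous L ->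
  (forall e : K, 0 < e -> \forall h \near (0 : V), `|f (x + h) - f x - L h| <= e * `|h|) ->
  differentiable f x.
Proof.
move=> cL H; have E : f \o shift x = cst (f x) + L +o_ (0 : V) id.
  apply/eqaddoP => e e0; apply: filterS (H _ e0) => h; apply: le_trans.
  rewrite -[(f \o shift x - (cst (f x) + L)) h]/(f (h + x) - (f x + L h)).
  by rewrite opprD addrA [x + h]addrC.
have D := diff_unique cL E.
by apply/diff_locallyP; rewrite D.
Qed.

End differentiable_eps.

Lemma continuous_linear_form (K : numFieldType) n (l : 'I_n -> K) :
  continuous (fun w : 'cV[K]_n => \sum_j l j * w j 0).
Proof.
suff H s : continuous (fun w : 'cV[K]_n => \sum_(j <- s) l j * w j 0) by exact: H.
elim: s => [|j s IH].
  have -> : (fun w : 'cV[K]_n => \sum_(j <- [::]) l j * w j 0) = cst 0.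
    by apply/funext => w; rewrite big_nil.
  exact: cst_continuous.
have -> : (fun w : 'cV[K]_n => \sum_(j <- j :: s) l j * w j 0) =
    (fun w => l j * w j 0 + \sum_(j <- s) l j * w j 0).
  by apply/funext => w; rewrite big_cons.
move=> w; pose F := nbhs_filter w.
have h := @cvgMl_tmp K _ (nbhs w) F _ (l j) _ (@coord_continuous K n 1 j 0 w).
exact: (@cvgD K K _ (nbhs w) F _ _ _ _ h (IH w)).
Qed.

Section entire_ent.
Variables (R : realType) (n : nat).
Local Notation vec := 'cV[R[i]]_n.
Implicit Types (z w : vec) (f : vec -> R[i]) (r rho e : R) (j : 'I_n).

Lemma normr_cmod (x : R[i]) : `|x| = (cmod x)%:C.
Proof. by []. Qed.

Lemma norm_vec_ge w j : (cmod (w j 0))%:C <= `|w|.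
Proof.
rewrite -normr_cmod [leRHS]/Num.Def.normr /= mx_normE -[leLHS]nngE num_le.
exact: (@le_bigmax _ _ _ _ _ (j, 0)).
Qed.

Lemma norm_vec_le w r : 0 <= r -> polydisc w r -> `|w| <= r%:C.
Proof.
move=> r0 wr; rewrite {1}/Num.Def.normr /=.
have [->|/mx_norm_neq0[[j k] ->]] := eqVneq (mx_norm w) 0.
  by rewrite lecR.
by rewrite normr_cmod lecR /= ord1; exact: wr.
Qed.

(** Norms and tolerances of the normed space take values in [R[i]], where a positive element is
    real; this brings them back to [R]. *)
Lemma posC (eps : R[i]) : 0 < eps -> exists2 e : R, 0 < e & eps = e%:C.
Proof.
case: eps => a b; rewrite ltcE /= => /andP[/eqP b0 a0].
by exists a => //; rewrite b0.
Qed.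

Lemma entire_ent f : entire f -> ent f.
Proof.
move=> ef z; have [L LP] := differentiable_eps (ef z).
exists (fun j => L (delta_mx j 0)) => e e0.
have eC0 : 0 < e%:C :> R[i] by rewrite ltcR.
have /nbhs_ballP[d /= d0 dP] := LP _ eC0.
have [d' d'0 dE] := posC d0.
(* Half the radius, because balls are open whereas [ent] admits [rho] equal to its bound. *)
exists (d' / 2) => [|rho w /andP[rho0 rhod] wr]; first by rewrite divr_gt0.
have wd : `|w| < d.
  by rewrite dE; apply: le_lt_trans (norm_vec_le rho0 wr) _; rewrite ltcR; lra.
have := dP w; rewrite mx_norm_ball /ball_ /= sub0r normrN => /(_ wd).
have -> : \sum_j L (delta_mx j 0) * w j 0 = L w.
  have LZ (a : R[i]) (u : vec) : L (a *: u) = L u * a by rewrite mulrC; exact: (linearZ_LR L).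
  rewrite {2}(matrix_sum_delta w) raddf_sum; apply: eq_bigr => j _.
  by rewrite big_ord1; exact: esym (LZ _ _).
rewrite normr_cmod => h; rewrite -lecR; apply: le_trans h _.
rewrite rmorphM ler_wpM2l ?lecR ?(ltW e0)//.
exact: norm_vec_le.
Qed.

Lemma ent_entire f : ent f -> entire f.
Proof.
move=> ef z; have [l lP] := ef z.
pose L w : R[i]^o := \sum_j l j * w j 0.
have lL : linear L.
  move=> a u v; rewrite /L scaler_sumr -big_split /=; apply: eq_bigr => j _.
  by rewrite !mxE /GRing.scale /=; ring.
pose Lm := GRing.isLinear.Build R[i] vec R[i]^o _ L lL.
pose Ll : {linear vec -> R[i]^o} := HB.pack L Lm.
apply: (@eps_differentiable _ _ _ _ _ Ll).
  exact: continuous_linear_form.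
move=> eps /posC[e e0 ->]; have [d d0 dP] := lP e e0.
have dC0 : 0 < d%:C :> R[i] by rewrite ltcR.
apply/nbhs_ballP; exists d%:C => //= w; rewrite mx_norm_ball /ball_ /= sub0r normrN => wd.
have [r r0 wE] : exists2 r, 0 <= r & `|w| = r%:C.
  have := normr_ge0 w; case: (`|w|) => a b; rewrite lecE /= => /andP[/eqP b0 a0].
  by exists a => //; rewrite b0.
move: wd; rewrite wE ltcR => rd.
rewrite normr_cmod -rmorphM lecR; apply: dP; first by rewrite r0 ltW.
by move=> j; rewrite -lecR -wE; exact: norm_vec_ge.
Qed.

End entire_ent.

(** * Lebesgue measure on C^n *)

Section scaling_maps.
Context d (T : measurableType d) (R : realType).
Implicit Types (mu : {measure set T -> \bar R}) (f : T -> T) (c : R).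

(** Preimages are measured, so a dilation by [a] carries the factor [a^-1] in each real
    dimension. *)
Definition scales (mu : set T -> \bar R) f c := measurable_fun setT f /\
  forall A, measurable A -> mu (f @^-1` A) = (c%:E * mu A)%E.

Lemma scales_id mu : scales mu id 1.
Proof. by split=> [|A mA]; [exact: measurable_id|rewrite mul1e]. Qed.

Lemma scales_comp mu f g c k : scales mu f c -> scales mu g k -> scales mu (g \o f) (c * k).
Proof.
move=> [mf fc] [mg gk]; split; first exact: measurableT_comp.
move=> A mA; rewrite EFinM -muleA -gk// -fc//.
by rewrite -[X in measurable X]setTI; exact: mg.
Qed.

Lemma scales_integral mu f c (g : T -> \bar R) : 0 <= c -> scales mu f c ->
  measurable_fun setT g -> (forall x, 0 <= g x)%E ->
  (\int[mu]_x g (f x) = c%:E * \int[mu]_x g x)%E.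
Proof.
move=> c0 [mf fc] mg g0.
rewrite -[LHS](@ge0_integral_pushforward _ _ _ _ _ f mf mu setT g)//.
rewrite -(@ge0_integral_mscale _ _ _ mu setT measurableT (NngNum c0) g)//.
apply: eq_measure_integral => A mA _.
exact: fc.
Qed.

End scaling_maps.

Section scaling_lebesgue.
Variable R : realType.
Local Notation mu := (@lebesgue_measure R).

Lemma scales_lebesgue_add (t : R) : scales mu (fun x => x + t) 1.
Proof.
have mf : measurable_fun setT (fun x : R => x + t).
  by apply: measurable_funD; [exact: measurable_id|exact: measurable_cst].
split=> // A mA; rewrite mul1e.
pose nu := pushforward mu (fun x : measurableTypeR R => x + t : measurableTypeR R).
apply/esym/(@lebesgue_measure_unique R nu) => // _ [[x y] _ <-].
rewrite /nu /= /pushforward.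
have -> : (fun u => u + t) @^-1` [set` `]x, y]] = [set` `]x - t, y - t]].
  by apply/seteqP; split=> u /=; rewrite !in_itv /= ltrBlDr lerBrDr.
rewrite !lebesgue_measure_itv /= !lte_fin ltrD2r.
by case: ifP => // _; rewrite -!EFinB; congr EFin; ring.
Qed.

Lemma scales_lebesgue_mul (a : R) : 0 < a -> scales mu (fun x => a * x) a^-1.
Proof.
move=> a0; have mf : measurable_fun setT (fun x : R => a * x).
  by apply: measurable_funM; [exact: measurable_cst|exact: measurable_id].
split=> // A mA.
pose nu := pushforward mu (fun x : measurableTypeR R => a * x : measurableTypeR R).
have aE : (a%:E * mu ((fun x => (a * x)%R) @^-1` A) = mu A)%E.
  pose anu := mscale (NngNum (ltW a0)) nu.
  rewrite -[LHS]/(anu mf A); apply/esym/(@lebesgue_measure_unique R (anu mf)) => // _ [[x y] _ <-].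
  rewrite /anu /= /mscale /= /nu /pushforward.
  have -> : (fun u => a * u) @^-1` [set` `]x, y]] = [set` `]x / a, y / a]].
    by apply/seteqP; split=> u /=; rewrite !in_itv /= ltr_pdivrMr// ler_pdivlMr// mulrC.
  rewrite !lebesgue_measure_itv /= !lte_fin ltr_pM2r ?invr_gt0//.
  case: ifP => // _; last by rewrite mule0.
  by rewrite -!EFinB -EFinM; congr EFin; field; rewrite gt_eqF.
by rewrite -aE muleA -EFinM mulVf ?mul1e// gt_eqF.
Qed.

End scaling_lebesgue.

Section scaling_product.
Context d1 d2 (T1 : measurableType d1) (T2 : measurableType d2) (R : realType).
Variables (m1 : {sigma_finite_measure set T1 -> \bar R})
  (m2 : {sigma_finite_measure set T2 -> \bar R}).

Lemma scales_prod f g c k : 0 <= c -> 0 <= k -> scales m1 f c -> scales m2 g k ->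
  scales (m1 \x m2)%E (fun p => (f p.1, g p.2)) (c * k).
Proof.
move=> c0 k0 sf sg; have [mf _] := sf; have [mg gk] := sg.
have mfg : measurable_fun setT (fun p : T1 * T2 => (f p.1, g p.2)).
  apply/measurable_fun_pairP; split => /=.
    exact: (measurableT_comp mf measurable_fst).
  exact: (measurableT_comp mg measurable_snd).
split=> // A mA; rewrite /product_measure1 EFinM -muleA.
have mx := measurable_fun_xsection m2 mA.
rewrite -ge0_integralZl//.
rewrite -(scales_integral c0 sf); last 2 first.
- exact: measurable_funeM.
- by move=> x; apply: mule_ge0.
apply: eq_integral => x _ /=; rewrite -gk; last exact: measurable_xsection.
congr (m2 _); apply/seteqP; split=> y /=; rewrite /xsection /= !inE; exact.
Qed.

(** Allows slicing in the other direction, as a shear along the first factor requires. *)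
Lemma product_measure12 A : measurable A -> (m1 \x m2)%E A = (m1 \x^ m2)%E A.
Proof.
by move=> mA; apply: product_measure_unique => // B C mB mC; exact: product_measure2E.
Qed.

Lemma scales_shear2 (g : T1 -> T2 -> T2) :
  measurable_fun setT (fun p : T1 * T2 => g p.1 p.2) -> (forall x, scales m2 (g x) 1) ->
  scales (m1 \x m2)%E (fun p => (p.1, g p.1 p.2)) 1.
Proof.
move=> mg sg; have mf : measurable_fun setT (fun p : T1 * T2 => (p.1, g p.1 p.2)).
  by apply/measurable_fun_pairP; split => //=; exact: measurable_fst.
split=> // A mA; rewrite mul1e /product_measure1.
apply: eq_integral => x _ /=; rewrite -[RHS]mul1e -(sg x).2; last exact: measurable_xsection.
congr (m2 _); apply/seteqP; split=> y /=; rewrite /xsection /= !inE; exact.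
Qed.

Lemma scales_shear1 (g : T2 -> T1 -> T1) :
  measurable_fun setT (fun p : T1 * T2 => g p.2 p.1) -> (forall y, scales m1 (g y) 1) ->
  scales (m1 \x m2)%E (fun p => (g p.2 p.1, p.2)) 1.
Proof.
move=> mg sg; have mf : measurable_fun setT (fun p : T1 * T2 => (g p.2 p.1, p.2)).
  by apply/measurable_fun_pairP; split => //=; exact: measurable_snd.
split=> // A mA; rewrite mul1e !product_measure12//; last first.
  by rewrite -[X in measurable X]setTI; exact: mf.
rewrite /product_measure2.
apply: eq_integral => y _ /=; rewrite -[RHS]mul1e -(sg y).2; last exact: measurable_ysection.
congr (m1 _); apply/seteqP; split=> x /=; rewrite /ysection /= !inE; exact.
Qed.

End scaling_product.

Section scaling_plane.
Variable R : realType.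
Local Notation R2 := (measurableTypeR R * measurableTypeR R)%type.

Lemma scales_R2_mul (a : R) : 0 < a ->
  scales (@lebesgue_R2 R) (fun p => (a * p.1, a * p.2)) (a ^- 2).
Proof.
move=> a0; rewrite -exprVn expr2; have ai : 0 <= a^-1 by rewrite invr_ge0 ltW.
exact: (scales_prod ai ai (scales_lebesgue_mul a0) (scales_lebesgue_mul a0)).
Qed.

(* A rotation other than a half-turn is a product of three shears. *)
Lemma scales_R2_rot (c s : R) : c ^+ 2 + s ^+ 2 = 1 -> -1 < c ->
  scales (@lebesgue_R2 R) (fun p => (c * p.1 - s * p.2, s * p.1 + c * p.2)) 1.
Proof.
move=> cs c1; have c0 : 1 + c != 0 by apply: lt0r_neq0; lra.
(* The tangent of half the angle, undefined exactly for the half-turn. The shears are x - t y, y + s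
   x, and x - t y again. *)
pose t := s / (1 + c).
have m1 : measurable_fun setT (fst : R2 -> R) by exact: measurable_fst.
have m2 : measurable_fun setT (snd : R2 -> R) by exact: measurable_snd.
have S1 : scales (@lebesgue_R2 R) (fun p => (p.1 + (- t * p.2), p.2)) 1.
  apply: (@scales_shear1 _ _ _ _ R (@lebesgue_measure R) (@lebesgue_measure R)
    (fun y x : measurableTypeR R => x + (- t * y))).
    by apply: measurable_funD => //; apply: measurable_funM => //; exact: measurable_cst.
  by move=> y; exact: scales_lebesgue_add.
have S2 : scales (@lebesgue_R2 R) (fun p => (p.1, p.2 + s * p.1)) 1.
  apply: (@scales_shear2 _ _ _ _ R (@lebesgue_measure R) (@lebesgue_measure R)
    (fun x y : measurableTypeR R => y + s * x)).
    by apply: measurable_funD => //; apply: measurable_funM => //; exact: measurable_cst.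
  by move=> y; exact: scales_lebesgue_add.
have := scales_comp S1 (scales_comp S2 S1); rewrite !mulr1.
congr (scales _ _ _); apply/funext => -[x y] /=.
have E1 : 1 - t * s = c.
  have -> : 1 - t * s = (1 + c - s ^+ 2) / (1 + c) by rewrite /t; field.
  have -> : 1 + c - s ^+ 2 = c * (1 + c) by rewrite mulrDr mulr1 -expr2; lra.
  by rewrite mulfK.
have E2 : t + t * c = s by rewrite /t; field.
congr pair.
  have -> : c * x - s * y = (1 - t * s) * x - (t + t * (1 - t * s)) * y by rewrite E1 E2.
  ring.
have -> : s * x + c * y = s * x + (1 - t * s) * y by rewrite E1.
ring.
Qed.

End scaling_plane.

Section scaling_tuple.
Context d (T : measurableType d) (R : realType).
Variable mu : {sigma_finite_measure set T -> \bar R}.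

Definition tmap n (a : 'I_n -> T -> T) (t : n.-tuple T) : n.-tuple T :=
  [tuple a i (tnth t i) | i < n].

Lemma measurable_tmap n (a : 'I_n -> T -> T) :
  (forall i, measurable_fun setT (a i)) -> measurable_fun setT (tmap a).
Proof.
move=> ma; apply/measurable_fun_tnthP => i /=.
rewrite (_ : _ \o _ = a i \o (fun t => tnth t i)); last first.
  by apply/funext => t /=; rewrite tnth_mktuple.
by apply: measurableT_comp => //; exact: measurable_tnth.
Qed.

Lemma tmap_tcons n (a : 'I_n.+1 -> T -> T) p :
  tmap a (tcons p) = tcons (a ord0 p.1, tmap (fun i => a (lift ord0 i)) p.2).
Proof.
apply: eq_from_tnth => i; rewrite tnth_mktuple.
case: (unliftP ord0 i) => [j ->|->]; last by rewrite !tnth0.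
by rewrite !tnthS tnth_mktuple.
Qed.

Lemma scales_tuple n (a : 'I_n -> T -> T) (c : 'I_n -> R) :
  (forall i, 0 <= c i) -> (forall i, scales mu (a i) (c i)) ->
  scales (tuple_measure mu n) (tmap a) (\prod_i c i).
Proof.
elim: n a c => [|n IH] a c c0 sa.
  rewrite big_ord0; have -> : tmap a = id by apply/funext => t; rewrite [LHS]tuple0 [RHS]tuple0.
  exact: scales_id.
split; first by apply: measurable_tmap => i; exact: (sa i).1.
move=> A mA; rewrite big_ord_recl /=.
rewrite /tuple_measureS /pushforward -comp_preimage.
have mtA : measurable (@tcons _ T n @^-1` A).
  by rewrite -[X in measurable X]setTI; exact: measurable_tcons.
have := (scales_prod (c0 ord0) _ (sa ord0) (IH (fun i => a (lift ord0 i)) _ _ _)).2 _ mtA.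
move=> <-.
- congr ((_ \x _)%E _); apply/seteqP; split=> p; rewrite /= tmap_tcons; exact.
- by apply: prodr_ge0.
- by [].
- by move=> i; exact: sa.
Qed.

End scaling_tuple.

Section measure_preserving.
Context d (T : measurableType d) (R : realType).
Variable mu : {measure set T -> \bar R}.

Lemma scales1_integral f (g : T -> \bar R) : scales mu f 1 -> measurable_fun setT g ->
  (\int[mu]_x g (f x) = \int[mu]_x g x)%E.
Proof.
move=> sf mg; rewrite integralE [RHS]integralE.
have h1 := scales_integral ler01 sf (measurable_funepos mg) (fun x => funepos_ge0 g x).
have h2 := scales_integral ler01 sf (measurable_funeneg mg) (fun x => funeneg_ge0 g x).
rewrite mul1e in h1; rewrite mul1e in h2; rewrite -h1 -h2.
by congr (_ - _)%E; apply: eq_integral => x _; rewrite !(funeposE, funenegE).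
Qed.

Lemma mu_ext_preimage_le f X : scales mu f 1 -> (mu_ext mu (f @^-1` X) <= mu_ext mu X)%E.
Proof.
move=> [mf fc]; apply: le_ereal_inf_tmp => _ [A [mA XA] <-].
apply: ereal_inf_lbound; exists (fun k => f @^-1` A k).
  split=> [k|x /= /XA[k _ Ak]]; last by exists k.
  by rewrite -[X in measurable X]setTI; exact: mf.
by apply: eq_eseriesr => k _; rewrite fc// mul1e.
Qed.

(** Countable measurable covers are pulled back by [f], and by [f'] for the converse. [X] is
    arbitrary, as needed to transport the Caratheodory splitting condition. *)
Lemma mu_ext_preimage f f' X : scales mu f 1 -> scales mu f' 1 ->
  cancel f' f -> mu_ext mu (f @^-1` X) = mu_ext mu X.
Proof.
move=> sf sf' K; apply/eqP; rewrite eq_le mu_ext_preimage_le//=.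
apply: le_trans (mu_ext_preimage_le _ sf').
by rewrite -comp_preimage (_ : f \o f' = id) ?preimage_id//; apply/funext.
Qed.

End measure_preserving.

(** * Coordinates on C^n and rotations of one coordinate *)

Section lebesgue_Cn_maps.
Variables (R : realType) (n : nat).
Local Notation R2 := (measurableTypeR R * measurableTypeR R)%type.
Local Notation vec := 'cV[R[i]]_n.
Implicit Types (z : vec) (A : set vec).

Definition uncvec z : n.-tuple R2 :=
  [tuple (complex.Re (z j 0), complex.Im (z j 0)) | j < n].

Lemma uncvecK : cancel uncvec (@cvec R n).
Proof. by move=> z; apply/colP => j; rewrite mxE tnth_mktuple; case: (z j 0). Qed.

Lemma cvecK : cancel (@cvec R n) uncvec.
Proof. by move=> t; apply: eq_from_tnth => j; rewrite tnth_mktuple mxE /=; case: (tnth t j). Qed.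

Lemma lebesgue_Cn_Borel A : measurable (@cvec R n @^-1` A) ->
  lebesgue_Cn (A : set (Cn R n)) = tuple_measure (@lebesgue_R2 R) n (@cvec R n @^-1` A).
Proof. by move=> mA; rewrite /lebesgue_Cn /lebesgue_outer measurable_mu_extE. Qed.

Lemma measurable_uncvec : measurable_fun setT (uncvec : Cn R n -> n.-tuple R2).
Proof.
move=> _ B mB; rewrite setTI; apply: lebesgue_measurable_Borel.
by rewrite -comp_preimage (_ : uncvec \o @cvec R n = id) ?preimage_id//; apply/funext/cvecK.
Qed.

(** [uncvec] pushes the measure on C^n forward to the tuple measure, as both agree on Borel sets;
    integrals of Borel functions can then be computed on tuples. *)
Lemma lebesgue_Cn_integral (G : n.-tuple R2 -> \bar R) :
  measurable_fun setT G -> (forall t, 0 <= G t)%E ->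
  (\int[@lebesgue_Cn R n]_z G (uncvec z) = \int[tuple_measure (@lebesgue_R2 R) n]_t G t)%E.
Proof.
move=> mG G0.
rewrite -[LHS](@ge0_integral_pushforward _ _ (Cn R n) (n.-tuple R2) R uncvec
  measurable_uncvec lebesgue_Cn setT G)//.
apply: eq_measure_integral => [|mu A mA _]; first exact: measurable_uncvec.
rewrite -[LHS]/(lebesgue_Cn (uncvec @^-1` A)).
have E : @cvec R n @^-1` (uncvec @^-1` A) = A.
  by rewrite -comp_preimage (_ : uncvec \o @cvec R n = id) ?preimage_id//; apply/funext/cvecK.
by rewrite lebesgue_Cn_Borel E.
Qed.

Definition rot j (w : R[i]) z := upd z j (w * z j 0).

Lemma rotK j w : w != 0 -> cancel (rot j w^-1) (rot j w).
Proof.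
move=> w0 z; rewrite /rot upd_upd; apply/colP => i; rewrite !mxE eqxx.
by case: eqP => // ->; rewrite mulrA mulfV// mul1r.
Qed.

Lemma scales_rot_tuple j w : cmod w = 1 -> -1 < complex.Re w ->
  scales (tuple_measure (@lebesgue_R2 R) n)
    (tmap (fun i => if i == j then fun p : R2 => (complex.Re w * p.1 - complex.Im w * p.2,
      complex.Im w * p.1 + complex.Re w * p.2) else id)) 1.
Proof.
move=> w1 wr; have -> : 1 = \prod_(i < n) 1 :> R by rewrite big1_eq.
apply: scales_tuple => // i; case: eqP => _; last exact: scales_id.
by apply: scales_R2_rot => //; rewrite -cmod_sqr w1 expr1n.
Qed.

Lemma rot_uncvec j w z : uncvec (rot j w z) =
  tmap (fun i => if i == j then fun p : R2 => (complex.Re w * p.1 - complex.Im w * p.2,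
      complex.Im w * p.1 + complex.Re w * p.2) else id) (uncvec z).
Proof.
apply: eq_from_tnth => i; rewrite !tnth_mktuple mxE; case: eqP => [->|//].
by case: w (z j 0) => a b [x y] /=; congr pair; rewrite addrC.
Qed.

Lemma ReV_gt (w : R[i]) : cmod w = 1 -> -1 < complex.Re w -> -1 < complex.Re w^-1.
Proof.
case: w => a b w1 /= h; have := cmod_sqr (a +i* b); rewrite w1 expr1n /= => <-.
by rewrite divr1.
Qed.

Lemma lebesgue_outer_rot j w A : cmod w = 1 -> -1 < complex.Re w ->
  lebesgue_outer (rot j w @^-1` A) = lebesgue_outer A.
Proof.
move=> w1 wr; rewrite /lebesgue_outer.
have wV : cmod w^-1 = 1 by rewrite cmodV w1 invr1.
have w0 : w != 0 by rewrite -cmod_gt0 w1.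
have s := scales_rot_tuple j w1 wr; have s' := scales_rot_tuple j wV (ReV_gt w1 wr).
rewrite -(mu_ext_preimage (@cvec R n @^-1` A) s s').
  congr (mu_ext _ _); apply/funext => t; congr (A _).
  by rewrite -[in RHS](cvecK t) -rot_uncvec uncvecK.
move=> t; rewrite -(cvecK t) -!rot_uncvec; congr uncvec; exact: rotK.
Qed.

(** Measurability of the rotation concerns all Caratheodory-measurable sets; it follows from
    invariance of the outer measure by carrying the splitting condition along the inverse
    rotation. *)
Lemma scales_rot j w : cmod w = 1 -> -1 < complex.Re w ->
  scales (@lebesgue_Cn R n) (rot j w : Cn R n -> Cn R n) 1.
Proof.
move=> w1 wr; have wV : cmod w^-1 = 1 by rewrite cmodV w1 invr1.
have w0 : w != 0 by rewrite -cmod_gt0 w1.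
have wVr := ReV_gt w1 wr.
have KV : rot j w^-1 \o rot j w = id.
  by apply/funext => z /=; have := @rotK j w^-1; rewrite invrK invr_eq0 => /(_ w0); exact.
split; last by move=> A mA; rewrite mul1e; exact: lebesgue_outer_rot.
move=> _ A mA; rewrite setTI.
have cA : caratheodory_measurable (@lebesgue_outer R n) A := mA.
suff : caratheodory_measurable (@lebesgue_outer R n) (rot j w @^-1` A) by [].
move=> X; rewrite -(lebesgue_outer_rot j X wV wVr) (cA (rot j w^-1 @^-1` X)).
rewrite -(lebesgue_outer_rot j (_ `&` A) w1 wr) -(lebesgue_outer_rot j (_ `&` ~` A) w1 wr).
have KX : rot j w @^-1` (rot j w^-1 @^-1` X) = X by rewrite -comp_preimage KV preimage_id.
by rewrite !preimage_setI preimage_setC KX.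
Qed.

End lebesgue_Cn_maps.

Lemma integral_indicT d (T : measurableType d) (R : realType)
    (mu : {measure set T -> \bar R}) (A : set T) :
  measurable A -> (\int[mu]_x (\1_A x)%:E = mu A)%E.
Proof. by move=> mA; rewrite integral_indic// setIT. Qed.

Lemma ge0_integralZl_EFin_fun d (T : measurableType d) (R : realType)
    (mu : {measure set T -> \bar R}) (f : T -> R) (c : R) :
  measurable_fun setT f -> (forall x, 0 <= f x) -> 0 <= c ->
  (\int[mu]_x (c%:E * (f x)%:E) = c%:E * \int[mu]_x (f x)%:E)%E.
Proof.
move=> mf f0 c0; apply: ge0_integralZl; rewrite ?lee_fin//; first exact/measurable_EFinP.
by move=> x _; rewrite lee_fin.
Qed.

Lemma ge0_le_integral_EFin d (X : measurableType d) (R : realType)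
    (mu : {measure set X -> \bar R}) (p q : X -> R) :
  measurable_fun setT p -> measurable_fun setT q -> (forall x, 0 <= p x) ->
  (forall x, p x <= q x) -> (\int[mu]_x (p x)%:E <= \int[mu]_x (q x)%:E)%E.
Proof.
move=> mp mq p0 pq; apply: ge0_le_integral => //; try exact/measurable_EFinP.
  by move=> x _; rewrite lee_fin.
by move=> x _; rewrite lee_fin.
Qed.

Section measurable_comparison.
Context d (X : measurableType d) (R : realType).

Lemma measurable_bool (b : X -> bool) :
  measurable [set x | b x] -> measurable_fun setT (fun x => (b x)%:R : R).
Proof.
move=> mb; have -> : (fun x => (b x)%:R : R) = \1_[set x | b x].
  by apply/funext => x; rewrite indicE mem_setE.
exact: measurable_indic.
Qed.

Lemma measurable_lt_set (f g : X -> R) :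
  measurable_fun setT f -> measurable_fun setT g -> measurable [set x | f x < g x].
Proof.
move=> mf mg.
have -> : [set x | f x < g x] = setT `&` (fun x => f x < g x) @^-1` [set true].
  by rewrite setTI.
by apply: (measurable_fun_ltr mf mg).
Qed.

Lemma measurable_le_set (f g : X -> R) :
  measurable_fun setT f -> measurable_fun setT g -> measurable [set x | f x <= g x].
Proof.
move=> mf mg.
have -> : [set x | f x <= g x] = setT `&` (fun x => f x <= g x) @^-1` [set true].
  by rewrite setTI.
by apply: (measurable_fun_ler mf mg).
Qed.

End measurable_comparison.

(** * Integrability of radial functions on C^n *)

Section radial_integrals.
Variables (R : realType) (n : nat).
Local Notation R2 := (measurableTypeR R * measurableTypeR R)%type.
Local Notation leb := (@lebesgue_measure R).
Local Notation tmu := (tuple_measure (@lebesgue_R2 R) n).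

Definition tnorm (p : n.-tuple R2) : R := cnorm (@cvec R n p).

Lemma tnormE p : tnorm p = Num.sqrt (\sum_j ((tnth p j).1 ^+ 2 + (tnth p j).2 ^+ 2)).
Proof.
by rewrite /tnorm /cnorm; congr Num.sqrt; apply: eq_bigr => j _; rewrite mxE normc_sqr.
Qed.

Lemma tnorm_ge0 p : 0 <= tnorm p.
Proof. exact: sqrtr_ge0. Qed.

Lemma measurable_tnorm : measurable_fun setT tnorm.
Proof.
pose q (p : n.-tuple R2) : R := \sum_j ((tnth p j).1 ^+ 2 + (tnth p j).2 ^+ 2).
have -> : tnorm = Num.sqrt \o q by apply/funext => p; rewrite tnormE.
have mq : measurable_fun setT q.
  apply: measurable_sum => j; have mt := @measurable_tnth _ R2 n j.
  apply: measurable_funD; apply: measurable_funX.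
    exact: (measurableT_comp measurable_fst mt).
  exact: (measurableT_comp measurable_snd mt).
apply: (measurableT_comp _ mq).
by apply: continuous_measurable_fun => x; exact: sqrt_continuous.
Qed.

Definition tscale (a : R) := tmap (fun (_ : 'I_n) (p : R2) => (a * p.1, a * p.2)).

Lemma tnorm_scale a p : 0 <= a -> tnorm (tscale a p) = a * tnorm p.
Proof.
move=> a0; rewrite !tnormE.
have aE (S : R) : a * Num.sqrt S = Num.sqrt (a ^+ 2 * S).
  by rewrite sqrtrM ?sqr_ge0// sqrtr_sqr ger0_norm.
rewrite aE mulr_sumr; congr Num.sqrt; apply: eq_bigr => j _; rewrite tnth_mktuple /=.
by rewrite !exprMn mulrDr.
Qed.

Lemma scales_tscale a : 0 < a -> scales tmu (tscale a) (a ^- (2 * n)).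
Proof.
move=> a0; have -> : a ^- (2 * n) = \prod_(i < n) a ^- 2.
  by rewrite prodr_const card_ord -exprVn exprM exprVn.
apply: scales_tuple => i; first by rewrite invr_ge0 exprn_ge0// ltW.
exact: scales_R2_mul.
Qed.

Definition tbox (Q : set R2) : set (n.-tuple R2) := [set p | forall i, Q (tnth p i)].

End radial_integrals.

Lemma measurable_tbox (R : realType) n
    (Q : set (measurableTypeR R * measurableTypeR R)) : measurable Q ->
  measurable (@tbox R n Q).
Proof.
move=> mQ; have -> : @tbox R n Q = \bigcap_(i in [set: 'I_n]) ((fun p => tnth p i) @^-1` Q).
  by apply/seteqP; split=> p /= H i; [move=> _|]; exact: H.
apply: fin_bigcap_measurable => // i _.
by rewrite -[X in measurable X]setTI; exact: (@measurable_tnth _ _ n i).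
Qed.

Lemma tuple_measure_tbox (R : realType) n
    (Q : set (measurableTypeR R * measurableTypeR R)) (q : R) : measurable Q ->
  lebesgue_R2 Q = q%:E -> tuple_measure (@lebesgue_R2 R) n (@tbox R n Q) = (q ^+ n)%:E.
Proof.
move=> mQ Qq; elim: n => [|n IH].
  rewrite /= expr0 diracE (_ : _ \in _) //.
  by rewrite inE => -[].
rewrite /= /tuple_measureS /pushforward.
have -> : (@tcons _ (measurableTypeR R * measurableTypeR R)%type n @^-1` (@tbox R n.+1 Q)) =
    Q `*` @tbox R n Q.
  apply/seteqP; split=> -[x p] /=.
    move=> H; split; first by have := H ord0; rewrite tnth0.
    by move=> i; have := H (lift ord0 i); rewrite tnthS.
  move=> [Qx Qp] i; case: (unliftP ord0 i) => [j ->|->]; last by rewrite tnth0.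
  by rewrite tnthS; exact: Qp.
rewrite product_measure1E//; last exact: measurable_tbox.
by rewrite IH exprS EFinM -Qq.
Qed.

Section radial_fubini.
Variables (R : realType) (n : nat).
Local Notation R2 := (measurableTypeR R * measurableTypeR R)%type.
Local Notation leb := (@lebesgue_measure R).
Local Notation tmu := (tuple_measure (@lebesgue_R2 R) n).
Hypothesis n0 : (0 < n)%N.

Lemma lebesgue_R2_square (a b : R) : a <= b ->
  lebesgue_R2 (`[a, b]%classic `*` `[a, b]%classic) = ((b - a) ^+ 2)%:E.
Proof.
move=> ab; rewrite /lebesgue_R2 product_measure1E//.
have E : leb `[a, b]%classic = (b - a)%:E.
  rewrite lebesgue_measure_itv /= lte_fin; case: ltP => [_|ba]; first by rewrite EFinB.
  by rewrite (le_anti (introT andP (conj ab ba))) subrr.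
by rewrite [X in (X * _)%E]E [X in (_ * X)%E]E -EFinM expr2.
Qed.

Lemma tnorm_lt_finite (r : R) : 0 <= r -> (tmu [set p | (tnorm p < r)%R] < +oo)%E.
Proof.
move=> r0; pose Q : set R2 := `[- r, r]%classic `*` `[- r, r]%classic.
have mQ : measurable Q by apply: measurableX.
have rr : - r <= r by lra.
have E := tuple_measure_tbox n mQ (lebesgue_R2_square rr).
apply: (@le_lt_trans _ _ (tmu (@tbox R n Q))); last by rewrite E ltry.
apply: le_measure; rewrite ?inE; [|exact: measurable_tbox|].
  by apply: measurable_lt_set; [exact: (@measurable_tnorm R n)|exact: measurable_cst].
move=> p /= pr i; have H : (tnth p i).1 ^+ 2 + (tnth p i).2 ^+ 2 <= r ^+ 2.
  rewrite -(sqr_sqrtr (_ : 0 <= (tnth p i).1 ^+ 2 + (tnth p i).2 ^+ 2)); last first.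
    by rewrite addr_ge0// sqr_ge0.
  rewrite lerXn2r ?nnegrE ?sqrtr_ge0//; apply: le_trans (ltW pr).
  rewrite tnormE ler_sqrt; last by apply: sumr_ge0 => j _; rewrite addr_ge0// sqr_ge0.
  rewrite (bigD1 i)//= lerDl; apply: sumr_ge0 => j _; by rewrite addr_ge0// sqr_ge0.
have h1 := sqr_ge0 (tnth p i).1; have h2 := sqr_ge0 (tnth p i).2.
have B (x : R) : x ^+ 2 <= r ^+ 2 -> - r <= x <= r.
  by move=> xr; rewrite -ler_norml -(@ler_sqr R) ?nnegrE// real_normK ?num_real.
by split; rewrite /= in_itv /=; apply: B; lra.
Qed.

Section radial_finite.
Variable Q : R -> R.
Hypotheses (mQ : measurable_fun setT Q) (Q0 : forall r, 0 <= Q r).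

Hypothesis Qoo : (\int[leb]_(r in `[0%R, +oo[) (r ^+ (2 * n - 1) * Q r)%:E < +oo)%E.

Let k := (2 * n - 1)%N.
Let G (r : R) : R := (0 <= r)%R%:R * (r ^+ k * Q r).
Let shell (p : n.-tuple R2) : R := (1 < tnorm p)%R%:R * (tnorm p < 2)%R%:R.
Let F (x : R * n.-tuple R2) : R := shell x.2 * ((0 < x.1)%R%:R * (x.1 ^+ k * Q (x.1 * tnorm x.2))).
(** [H t] lives on the shell dilated by [t]. [K] multiplies it by [t^-1], spelled [expR (- ln t)]
    for measurability; it is what becomes of [F] under the substitution [p -> t p]. *)
Let H (t : R) (p : n.-tuple R2) : R :=
  (t < tnorm p)%R%:R * (tnorm p < 2 * t)%R%:R * Q (tnorm p).
Let K (x : R * n.-tuple R2) : R := (0 < x.1)%R%:R * (expR (- ln x.1) * H x.1 x.2).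

Let mt2 : measurable_fun setT (fun x : R * n.-tuple R2 => tnorm x.2).
Proof. exact: (measurableT_comp (@measurable_tnorm R n) measurable_snd). Qed.

Let mt1 : measurable_fun setT (fun x : R * n.-tuple R2 => x.1).
Proof. exact: measurable_fst. Qed.

Let mcst d (X : measurableType d) (c : R) : measurable_fun setT (fun _ : X => c).
Proof. exact: measurable_cst. Qed.

Let mshell : measurable_fun setT shell.
Proof.
by apply: measurable_funM; apply: measurable_bool; apply: measurable_lt_set => //;
  exact: measurable_tnorm.
Qed.

Let mG : measurable_fun setT G.
Proof.
apply: measurable_funM; last first.
  by apply: measurable_funM => //; apply: measurable_funX; exact: measurable_id.
by apply: measurable_bool; apply: measurable_le_set => //; exact: measurable_id.
Qed.

Let mF : measurable_fun setT F.
Proof.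
apply: measurable_funM; first exact: (measurableT_comp mshell measurable_snd).
apply: measurable_funM; first by apply: measurable_bool; exact: measurable_lt_set.
apply: measurable_funM; first exact: measurable_funX.
by apply: (measurableT_comp mQ); exact: measurable_funM.
Qed.

Let mH t : measurable_fun setT (H t).
Proof.
have mN := @measurable_tnorm R n.
apply: measurable_funM; last exact: (measurableT_comp mQ mN).
by apply: measurable_funM; apply: measurable_bool; apply: measurable_lt_set.
Qed.

Let mK : measurable_fun setT K.
Proof.
apply: measurable_funM; first by apply: measurable_bool; exact: measurable_lt_set.
apply: measurable_funM.
  apply: (measurableT_comp (@measurable_expR R)); apply: measurable_funN.
  exact: (measurableT_comp (@measurable_ln R) mt1).
apply: measurable_funM; last exact: (measurableT_comp mQ mt2).
apply: measurable_funM; apply: measurable_bool; apply: measurable_lt_set => //.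
exact: measurable_funM.
Qed.

Let shell_ge0 p : 0 <= shell p.
Proof. by rewrite mulr_ge0. Qed.

Let F_ge0 x : 0 <= F x.
Proof.
rewrite /F mulr_ge0//; case: ltP => x0; rewrite ?mul0r// mul1r mulr_ge0//.
by rewrite exprn_ge0// ltW.
Qed.

Let H_ge0 t p : 0 <= H t p.
Proof. by rewrite /H !mulr_ge0. Qed.

Let K_ge0 x : 0 <= K x.
Proof. by rewrite /K !mulr_ge0// expR_ge0. Qed.

Let G_ge0 r : 0 <= G r.
Proof.
rewrite /G; case: (leP 0 r) => r0; rewrite /= ?mul0r// mul1r.
by rewrite mulr_ge0// exprn_ge0.
Qed.

Let intG : (\int[leb]_r (G r)%:E < +oo)%E.
Proof.
move: Qoo; rewrite integral_mkcond; congr (_ < _)%E; apply: eq_integral => r _.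
rewrite patchE /G mem_setE in_itv /= andbT; case: ifP => _; last by rewrite mul0r.
by rewrite mul1r.
Qed.

(** For [p] in the shell, substitute [r = tnorm p * t]. Since [tnorm p > 1], both [t ^ k <= r ^ k]
    and the Jacobian [(tnorm p)^-1 <= 1] go in the right direction, so the inner integral is at most
    that of [G]; the shell has finite measure. *)
Let intF1 : (\int[tmu]_p \int[leb]_t (F (t, p))%:E < +oo)%E.
Proof.
apply: (@le_lt_trans _ _ (\int[tmu]_p ((shell p)%:E * \int[leb]_r (G r)%:E))%E).
  apply: ge0_le_integral => //.
  - by move=> p _; apply: integral_ge0 => t _; rewrite lee_fin.
  - apply: (@measurable_fun_fubini_tonelli_G _ _ _ _ _ leb (fun x => (F x)%:E)).
      exact/measurable_EFinP.
    by move=> x; rewrite lee_fin.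
  - by apply: emeasurable_funM => //; exact/measurable_EFinP.
  move=> p _; rewrite -ge0_integralZl//; last 3 first.
  - exact/measurable_EFinP.
  - by move=> r _; rewrite lee_fin.
  - by rewrite lee_fin.
  have [p1|p1] := ltP 1 (tnorm p); last first.
    rewrite [leLHS]integral0_eq; last first.
      by move=> t _; rewrite /F /shell /= (ltNge 1) p1 /= !mul0r.
    by apply: integral_ge0 => r _; rewrite mule_ge0 ?lee_fin.
  have p0 : 0 < tnorm p by exact: lt_trans p1.
  apply: (@le_trans _ _ (\int[leb]_t ((shell p)%:E * (G (tnorm p * t))%:E))%E).
    apply: ge0_le_integral => //.
    - by move=> t _; rewrite lee_fin.
    - by apply/measurable_EFinP; apply: (measurableT_comp mF); exact: measurable_pair2.
    - apply: measurable_funeM; apply/measurable_EFinP; apply: (measurableT_comp mG).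
      by apply: measurable_funM => //; exact: measurable_id.
    move=> t _; rewrite -EFinM lee_fin /F /= ler_wpM2l//.
    case: (ltP 0 t) => t0 /=; last by rewrite mul0r.
    rewrite mul1r /G mulr_ge0 ?(ltW p0) ?(ltW t0)//= mul1r [t * _]mulrC ler_wpM2r//.
    by rewrite exprMn ler_peMl ?exprn_ge0 ?(ltW t0)// exprn_ege1// ltW.
  rewrite (@scales_integral _ (measurableTypeR R) R leb (fun t => tnorm p * t) (tnorm p)^-1
    (fun r => ((shell p)%:E * (G r)%:E)%E) _ (scales_lebesgue_mul p0)).
  - rewrite -[leRHS]mul1e; apply: lee_wpmul2r.
      by apply: integral_ge0 => r _; rewrite mule_ge0 ?lee_fin.
    by rewrite lee_fin invf_le1// ltW.
  - by rewrite invr_ge0 ltW.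
  - by apply: measurable_funeM; exact/measurable_EFinP.
  - by move=> r; rewrite mule_ge0 ?lee_fin.
have fin : (\int[leb]_r (G r)%:E)%E \is a fin_num.
  by rewrite ge0_fin_numE//; apply: integral_ge0 => r _; rewrite lee_fin.
have T0 : 0 <= fine (\int[leb]_r (G r)%:E)%E.
  by rewrite fine_ge0//; apply: integral_ge0 => r _; rewrite lee_fin.
rewrite -(fineK fin); under eq_integral do rewrite muleC.
rewrite ge0_integralZl_EFin_fun//; apply: lte_mul_pinfty => //.
have two0 : 0 <= 2 :> R by [].
apply: le_lt_trans (tnorm_lt_finite two0).
rewrite -integral_indicT//; last first.
  by apply: measurable_lt_set => //; exact: (@measurable_tnorm R n).
apply: ge0_le_integral => //.
- by move=> p _; rewrite lee_fin.
- exact/measurable_EFinP.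
- apply/measurable_EFinP; apply: measurable_indic.
  by apply: measurable_lt_set => //; exact: (@measurable_tnorm R n).
move=> p _; rewrite lee_fin indicE mem_setE /shell ler_piMl// lern1.
by case: (_ < _).
Qed.

(** For fixed [t > 0] the dilation by [t] contributes [t ^- (2 * n)], and [t ^ k] with
    [k = 2 * n - 1] reduces this to [t^-1]. *)
Let intFK : (\int[leb]_t \int[tmu]_p (F (t, p))%:E = \int[leb]_t \int[tmu]_p (K (t, p))%:E)%E.
Proof.
apply: eq_integral => t _; case: (ltP 0 t) => t0; last first.
  by rewrite !integral0_eq// => p _; rewrite /F /K /= (ltNge 0) t0 /= !(mul0r, mulr0).
have tk : t ^+ k * t ^- (2 * n) = t^-1.
  have -> : (2 * n)%N = k.+1 by rewrite /k subn1 prednK// muln_gt0.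
  by rewrite exprSr invfM mulrA mulfV ?mul1r// expf_neq0// gt_eqF.
rewrite (_ : \int[tmu]_p (F (t, p))%:E =
    \int[tmu]_p ((t ^+ k)%:E * (H t (tscale t p))%:E))%E; last first.
  apply: eq_integral => p _; rewrite -EFinM /F /H /shell /= t0 /= mul1r tnorm_scale ?(ltW t0)//.
  rewrite -[X in (X < t * _)]mulr1 ltr_pM2l// [2 * t]mulrC ltr_pM2l//.
  by congr EFin; ring.
rewrite ge0_integralZl_EFin_fun//; last 2 first.
- by apply: (measurableT_comp (mH t)); exact: (scales_tscale n t0).1.
- by rewrite exprn_ge0// ltW.
rewrite (scales_integral (g := fun p => (H t p)%:E) _ (scales_tscale n t0)); last 3 first.
- by rewrite invr_ge0 exprn_ge0// ltW.
- exact/measurable_EFinP.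
- by move=> p; rewrite lee_fin.
rewrite muleA -EFinM tk -ge0_integralZl_EFin_fun//; last by rewrite invr_ge0 ltW.
apply: eq_integral => p _; rewrite -EFinM /K /= t0 /= mul1r.
by rewrite expRN lnK.
Qed.

(** With [a = tnorm p], the function [K] is [t^-1 * Q a] for [t] between [a / 2] and [a]; there
    [t^-1 >= a^-1], and the interval has length [a / 2]. *)
Let intK p : 0 < tnorm p -> ((2^-1 * Q (tnorm p))%:E <= \int[leb]_t (K (t, p))%:E)%E.
Proof.
move=> p0; set a := tnorm p in p0 *.
have mI : measurable (`]a / 2, a[%classic : set (measurableTypeR R)) by exact: measurable_itv.
have Qa : 0 <= Q a / a by exact: divr_ge0 (Q0 _) (ltW p0).
have mind : measurable_fun setT (\1_(`]a / 2, a[%classic) : measurableTypeR R -> R).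
  exact: measurable_indic.
have -> : (2^-1 * Q a)%:E = (\int[leb]_t (Q a / a * \1_(`]a / 2, a[%classic) t)%:E)%E.
  under eq_integral do rewrite EFinM.
  rewrite (ge0_integralZl_EFin_fun _ mind _ Qa); last by move=> x; rewrite indicE ler0n.
  rewrite (_ : (\int[leb]_t (\1_(`]a / 2, a[%classic) t)%:E)%E = (a / 2)%:E); last first.
    rewrite integral_indicT//; apply: (eq_trans (lebesgue_measure_itv _)) => /=.
    by rewrite lte_fin ifT -?EFinB; [congr EFin; lra|lra].
  by rewrite -EFinM; congr EFin; field; rewrite gt_eqF.
apply: ge0_le_integral_EFin.
- by apply: measurable_funM mind; exact: measurable_cst.
- by apply: (measurableT_comp mK); exact: measurable_pair2.
- by move=> t; apply: mulr_ge0 Qa _; rewrite indicE ler0n.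
move=> t; rewrite indicE mem_setE in_itv /=.
have [/andP[h1 h2]|_] := boolP (_ < _ < _); last by rewrite mulr0.
have t0 : 0 < t by lra.
have t2 : a < 2 * t by lra.
rewrite mulr1 /K /= t0 mul1r /H /= -/a h2 t2 !mul1r expRN lnK// mulrC ler_wpM2r//.
by rewrite lef_pV2 ?posrE// ltW.
Qed.

(* Polar coordinates are avoided by computing the integral of
   [Q (t * |p|) * t ^ (2 * n - 1)] over [t > 0] and [1 < |p| < 2] in both orders. *)
Lemma radial_finite : (\int[tmu]_p (Q (tnorm p))%:E < +oo)%E.
Proof.
have mN := @measurable_tnorm R n.
pose P (p : n.-tuple R2) : R := (0 < tnorm p)%R%:R * Q (tnorm p).
(* [intK] says nothing at the origin; [Z] covers it by the constant [Q 0] on the unit ball, which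
   has finite measure. *)
pose Z (p : n.-tuple R2) : R := (tnorm p < 1)%R%:R * Q 0.
have mP : measurable_fun setT P.
  apply: measurable_funM; last exact: (measurableT_comp mQ mN).
  by apply: measurable_bool; exact: measurable_lt_set.
have mZ : measurable_fun setT Z.
  by apply: measurable_funM => //; apply: measurable_bool; exact: measurable_lt_set.
have P0 p : 0 <= P p by rewrite /P mulr_ge0.
have Z0 p : 0 <= Z p by rewrite /Z mulr_ge0.
apply: (@le_lt_trans _ _ (\int[tmu]_p (P p + Z p)%:E)%E).
  apply: ge0_le_integral_EFin.
  - exact: (measurableT_comp mQ mN).
  - exact: measurable_funD.
  - by move=> p; exact: Q0.
  move=> p; rewrite /P /Z.
  have := tnorm_ge0 p; rewrite le_eqVlt => /predU1P[<-|->].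
    by rewrite ltr01 ltxx mul0r add0r mul1r.
  by rewrite mul1r lerDl mulr_ge0.
under eq_integral do rewrite EFinD.
have mE (g : n.-tuple R2 -> R) : measurable_fun setT g -> measurable_fun setT (fun p => (g p)%:E).
  by move=> mg; exact/measurable_EFinP.
rewrite ge0_integralD; [|exact: measurableT|by move=> p _; exact: P0|exact: mE|
  by move=> p _; exact: Z0|exact: mE].
apply: lte_add_pinfty.
- have E2 : (\int[leb]_t \int[tmu]_p (F (t, p))%:E = \int[tmu]_p \int[leb]_t (F (t, p))%:E)%E.
    apply: (@fubini_tonelli _ _ _ _ R leb tmu (fun x => (F x)%:E)).
      exact/measurable_EFinP.
    by move=> x; rewrite lee_fin.
  have E3 : (\int[leb]_t \int[tmu]_p (K (t, p))%:E = \int[tmu]_p \int[leb]_t (K (t, p))%:E)%E.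
    apply: (@fubini_tonelli _ _ _ _ R leb tmu (fun x => (K x)%:E)).
      exact/measurable_EFinP.
    by move=> x; rewrite lee_fin.
  have KF : (\int[tmu]_p \int[leb]_t (K (t, p))%:E < +oo)%E by rewrite -E3 -intFK E2.
  have h : (2^-1%:E * \int[tmu]_p (P p)%:E < +oo)%E.
    apply: le_lt_trans KF; rewrite -ge0_integralZl_EFin_fun//.
    apply: ge0_le_integral; first exact: measurableT.
    - by move=> p _; rewrite mule_ge0 ?lee_fin.
    - by apply: measurable_funeM; exact/measurable_EFinP.
    - apply: (@measurable_fun_fubini_tonelli_G _ _ _ _ _ leb (fun x => (K x)%:E)).
        exact/measurable_EFinP.
      by move=> x; rewrite lee_fin.
    move=> p _; rewrite -EFinM /P; case: (ltP 0 (tnorm p)) => p0 /=.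
      by rewrite mul1r; exact: intK.
    by rewrite mul0r mulr0; apply: integral_ge0 => t _; rewrite lee_fin.
  move: h; case: (\int[tmu]_p (P p)%:E)%E => [r _| |]; rewrite ?ltry ?ltNyr//.
  by rewrite gt0_muley// lte_fin.
- have mb : measurable_fun setT (fun p : n.-tuple R2 => (tnorm p < 1)%R%:R : R).
    by apply: measurable_bool; exact: measurable_lt_set.
  rewrite (eq_integral (fun p => (Q 0)%:E * (((tnorm p < 1)%R%:R : R)%:E))%E); last first.
    by move=> p _; rewrite -EFinM mulrC.
  rewrite (ge0_integralZl_EFin_fun _ mb (fun p => ler0n _ _) (Q0 0)).
  apply: lte_mul_pinfty; [by rewrite lee_fin|by []|].
  apply: le_lt_trans (tnorm_lt_finite (@ler01 R)).
  have mA : measurable [set p : n.-tuple R2 | tnorm p < 1] by exact: measurable_lt_set.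
  rewrite -(integral_indicT tmu mA); apply: ge0_le_integral_EFin => //.
  by move=> p; rewrite indicE mem_setE.
Qed.

End radial_finite.

End radial_fubini.

Arguments cmod {R} x : simpl never.

(* Back on top of [complex_scope], so that [^*] means [Num.conj] and not [conjc]. *)
Local Open Scope ring_scope.

(** * Complex integrals and weighted L^2 spaces *)

Section conjugation.
Variable R : realType.
Implicit Types x y : R[i].

Lemma mul_conj x : x * x^* = (cmod x ^+ 2)%:C.
Proof.
rewrite cmod_sqr; case: x => a b; apply/eqP; rewrite eq_complex; apply/andP; split; apply/eqP;
  by rewrite /=; ring.
Qed.

Lemma conj_cmod1 x : cmod x = 1 -> x * x^* = 1.
Proof. by move=> x1; rewrite mul_conj x1 expr1n. Qed.

Lemma cmod_conj x : cmod x^* = cmod x.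
Proof. by case: x => a b; rewrite /cmod /= sqrrN. Qed.

End conjugation.

(** * Integration of complex functions *)

Section complex_integration.
Context d (X : measurableType d) (R : realType).
Variable mu : {measure set X -> \bar R}.
Implicit Types (f g : X -> R[i]) (p q : X -> R).

Definition Cmeas f := measurable_fun setT (fun x => complex.Re (f x)) /\
  measurable_fun setT (fun x => complex.Im (f x)).

Lemma Cmeas_cst (c : R[i]) : Cmeas (fun=> c).
Proof. by split; exact: measurable_cst. Qed.

Lemma CmeasE f p q : (forall x, f x = p x +i* q x) ->
  measurable_fun setT p -> measurable_fun setT q -> Cmeas f.
Proof.
move=> fE mp mq; rewrite /Cmeas.
by split; [apply: eq_measurable_fun mp|apply: eq_measurable_fun mq] => x _; rewrite fE.
Qed.

Lemma CmeasD f g : Cmeas f -> Cmeas g -> Cmeas (fun x => f x + g x).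
Proof.
move=> [fR fI] [gR gI].
apply: (CmeasE _ (measurable_funD fR gR) (measurable_funD fI gI)) => x /=.
by case: (f x) (g x) => ? ? [].
Qed.

Lemma CmeasM f g : Cmeas f -> Cmeas g -> Cmeas (fun x => f x * g x).
Proof.
move=> [fR fI] [gR gI].
apply: (CmeasE _ (measurable_funB (measurable_funM fR gR) (measurable_funM fI gI))
  (measurable_funD (measurable_funM fR gI) (measurable_funM fI gR))) => x /=.
by case: (f x) (g x) => ? ? [].
Qed.

Lemma Cmeas_conj f : Cmeas f -> Cmeas (fun x => (f x)^*).
Proof.
move=> [fR fI]; apply: (CmeasE _ fR (measurable_funN fI)) => x /=.
by case: (f x).
Qed.

Lemma Cmeas_real p : measurable_fun setT p -> Cmeas (fun x => (p x)%:C).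
Proof. by move=> mp; split => //; exact: measurable_cst. Qed.

Lemma CmeasB f g : Cmeas f -> Cmeas g -> Cmeas (fun x => f x - g x).
Proof.
move=> mf mg; under [f in Cmeas f]eq_fun do rewrite -mulN1r.
by apply: CmeasD => //; apply: CmeasM => //; exact: Cmeas_cst.
Qed.

Lemma Cmeas_prod (I : Type) (s : seq I) (F : I -> X -> R[i]) :
  (forall i, Cmeas (F i)) -> Cmeas (fun x => \prod_(i <- s) F i x).
Proof.
move=> mF; elim: s => [|i s IH].
  by under [f in Cmeas f]eq_fun do rewrite big_nil; exact: Cmeas_cst.
by under [f in Cmeas f]eq_fun do rewrite big_cons; exact: CmeasM.
Qed.

Lemma CmeasX f k : Cmeas f -> Cmeas (fun x => f x ^+ k).
Proof.
move=> mf; elim: k => [|k IH]; first exact: Cmeas_cst.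
by under [f in Cmeas f]eq_fun do rewrite exprS; exact: CmeasM.
Qed.

Lemma Cmeas_cmod2 f : Cmeas f -> measurable_fun setT (fun x => cmod (f x) ^+ 2).
Proof.
move=> [fR fI]; under eq_fun do rewrite cmod_sqr.
by apply: measurable_funD; exact: measurable_funX.
Qed.

Lemma Cmeas_cmod f : Cmeas f -> measurable_fun setT (fun x => cmod (f x)).
Proof.
move=> mf; rewrite (_ : (fun x => _) = Num.sqrt \o (fun x => cmod (f x) ^+ 2)); last first.
  by apply/funext => x /=; rewrite sqrtr_sqr ger0_norm// cmod_ge0.
apply: (measurableT_comp _ (Cmeas_cmod2 mf)).
by apply: continuous_measurable_fun => x; exact: sqrt_continuous.
Qed.

Definition rintegrable p := mu.-integrable setT (fun x => (p x)%:E).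

Lemma rintegrableD p q : rintegrable p -> rintegrable q -> rintegrable (fun x => p x + q x).
Proof.
move=> wip iq; rewrite /rintegrable; under eq_fun do rewrite EFinD.
exact: integrableD.
Qed.

Lemma rintegrableZ (c : R) p : rintegrable p -> rintegrable (fun x => c * p x).
Proof.
move=> wip; rewrite /rintegrable; under eq_fun do rewrite EFinM.
exact: integrableZl.
Qed.

Lemma rintegrable_le p q : measurable_fun setT p -> (forall x, `|p x| <= q x) ->
  rintegrable q -> rintegrable p.
Proof.
move=> mp pq; apply: le_integrable => //; first exact/measurable_EFinP.
by move=> x _; rewrite /= lee_fin (le_trans (pq x))// ler_norm.
Qed.

Lemma rintegrable_ge0 p : measurable_fun setT p -> (forall x, 0 <= p x) ->
  (\int[mu]_x (p x)%:E < +oo)%E -> rintegrable p.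
Proof.
move=> mp p0 poo; apply/integrableP; split; first exact/measurable_EFinP.
by under eq_integral do rewrite gee0_abs ?lee_fin//.
Qed.

Lemma rintegrable_lty p : rintegrable p -> (\int[mu]_x (p x)%:E < +oo)%E.
Proof. by move/integrable_lty; apply. Qed.

Lemma rintegralE p : rintegrable p -> ((\int[mu]_x p x)%R%:E = \int[mu]_x (p x)%:E)%E.
Proof. by move=> wip; rewrite fineK//; exact: integrable_fin_num. Qed.

Definition Cintegrable f := rintegrable (fun x => complex.Re (f x)) /\
  rintegrable (fun x => complex.Im (f x)).

Definition Cint f : R[i] :=
  (\int[mu]_x complex.Re (f x)) +i* (\int[mu]_x complex.Im (f x)).

Lemma CintE f p q : (forall x, f x = p x +i* q x) ->
  Cint f = (\int[mu]_x p x) +i* (\int[mu]_x q x).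
Proof.
by move=> fE; rewrite /Cint; congr (_ +i* _); apply: eq_Rintegral => x _; rewrite fE.
Qed.

Lemma Cintegrable_le f q : Cmeas f -> (forall x, cmod (f x) <= q x) ->
  rintegrable q -> Cintegrable f.
Proof.
move=> [fR fI] fq iq; split; apply: (rintegrable_le _ _ iq) => // x.
- exact: le_trans (Re_le_cmod _) (fq x).
- exact: le_trans (Im_le_cmod _) (fq x).
Qed.

Lemma CintD f g : Cintegrable f -> Cintegrable g ->
  Cint (fun x => f x + g x) = Cint f + Cint g.
Proof.
move=> [fR fI] [gR gI].
rewrite (CintE (p := fun x => complex.Re (f x) + complex.Re (g x))
  (q := fun x => complex.Im (f x) + complex.Im (g x))) ?RintegralD//.
by move=> x; case: (f x) (g x) => ? ? [].
Qed.

Lemma CintegrableE f p q : (forall x, f x = p x +i* q x) ->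
  rintegrable p -> rintegrable q -> Cintegrable f.
Proof.
move=> fE jp jq; rewrite /Cintegrable (_ : (fun x => complex.Re (f x)) = p).
  by rewrite (_ : (fun x => complex.Im (f x)) = q)//; apply/funext => x; rewrite fE.
by apply/funext => x; rewrite fE.
Qed.

Lemma CintegrableD f g : Cintegrable f -> Cintegrable g -> Cintegrable (fun x => f x + g x).
Proof.
move=> [fR fI] [gR gI].
apply: (CintegrableE _ (rintegrableD fR gR) (rintegrableD fI gI)) => x.
by case: (f x) (g x) => ? ? [].
Qed.

Lemma CintegrableZ (c : R[i]) f : Cintegrable f -> Cintegrable (fun x => c * f x).
Proof.
case: c => a b [fR fI].
apply: (CintegrableE _ (rintegrableD (rintegrableZ a fR) (rintegrableZ (- b) fI))
  (rintegrableD (rintegrableZ a fI) (rintegrableZ b fR))) => x.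
by case: (f x) => ? ?; rewrite mulNr.
Qed.

Lemma CintZ (c : R[i]) f : Cintegrable f -> Cint (fun x => c * f x) = c * Cint f.
Proof.
move=> [fR fI].
rewrite (CintE (p := fun x => complex.Re c * complex.Re (f x) + (- complex.Im c) * complex.Im (f x))
  (q := fun x => complex.Re c * complex.Im (f x) + complex.Im c * complex.Re (f x))); last first.
  by move=> x; case: c (f x) => ? ? [? ?] /=; rewrite mulNr.
rewrite !RintegralD ?RintegralZl//; try exact: rintegrableZ.
by rewrite /Cint; case: c => a b; rewrite mulNr.
Qed.

Lemma CintB f g : Cintegrable f -> Cintegrable g ->
  Cint (fun x => f x - g x) = Cint f - Cint g.
Proof.
move=> jf jg; under [f in Cint f]eq_fun do rewrite -mulN1r.
by rewrite CintD ?CintZ ?mulN1r//; exact: CintegrableZ.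
Qed.

Lemma Cint_conj f : Cintegrable f -> Cint (fun x => (f x)^*) = (Cint f)^*.
Proof.
move=> [fR fI].
rewrite (CintE (p := fun x => complex.Re (f x)) (q := fun x => (-1) * complex.Im (f x))).
  by rewrite RintegralZl// mulN1r.
by move=> x; case: (f x) => ? ?; rewrite mulN1r.
Qed.

Lemma Cint_sum (I : Type) (s : seq I) (F : I -> X -> R[i]) :
  (forall i, Cintegrable (F i)) ->
  Cintegrable (fun x => \sum_(i <- s) F i x) /\
  Cint (fun x => \sum_(i <- s) F i x) = \sum_(i <- s) Cint (F i).
Proof.
move=> jF; elim: s => [|i s [IH1 IH2]].
  under [f in Cintegrable f]eq_fun do rewrite big_nil.
  under [f in Cint f]eq_fun do rewrite big_nil.
  rewrite big_nil; split; first by split; exact: integrable0.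
  by rewrite /Cint Rintegral_cst// mul0r.
under [f in Cintegrable f]eq_fun do rewrite big_cons.
under [f in Cint f]eq_fun do rewrite big_cons.
by rewrite big_cons CintD// IH2; split => //; exact: CintegrableD.
Qed.

Lemma Cint_real p : Cint (fun x => (p x)%:C) = (\int[mu]_x p x)%:C.
Proof. by rewrite /Cint /= Rintegral_cst// mul0r. Qed.

Lemma Cint_le f q : Cmeas f -> (forall x, cmod (f x) <= q x) -> rintegrable q ->
  cmod (Cint f) <= 2 * \int[mu]_x q x.
Proof.
move=> mf fq iq; have [fR fI] := Cintegrable_le mf fq iq.
have H p : rintegrable p -> (forall x, `|p x| <= q x) -> `|\int[mu]_x p x| <= \int[mu]_x q x.
  move=> wip pq; apply: le_trans (le_normr_Rintegral _ wip) _ => //.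
  apply: le_Rintegral => //.
  by have := integrable_abse wip.
apply: le_trans (cmod_le_ReIm _) _; rewrite mulr_natl mulr2n /Cint /=.
apply: lerD; apply: H => // x.
- exact: le_trans (Re_le_cmod _) (fq x).
- exact: le_trans (Im_le_cmod _) (fq x).
Qed.

Lemma ae_eq_Cint f g : Cmeas f -> Cmeas g -> {ae mu, forall x, f x = g x} -> Cint f = Cint g.
Proof.
move=> [fR fI] [gR gI] fg; rewrite /Cint /Rintegral; congr (_ +i* _); congr fine.
- apply: ae_eq_integral => //; try exact/measurable_EFinP.
  by apply: filterS fg => x E _; rewrite E.
- apply: ae_eq_integral => //; try exact/measurable_EFinP.
  by apply: filterS fg => x E _; rewrite E.
Qed.

Lemma Cint_comp T f : scales mu T 1 -> Cmeas f -> Cint (f \o T) = Cint f.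
Proof.
move=> sT [fR fI]; rewrite /Cint /Rintegral; congr (_ +i* _); congr fine.
- by rewrite (scales1_integral sT (g := fun x => (complex.Re (f x))%:E))//; exact/measurable_EFinP.
- by rewrite (scales1_integral sT (g := fun x => (complex.Im (f x))%:E))//; exact/measurable_EFinP.
Qed.

(** The substitution [T] preserves the integral and also multiplies it by [c]. This is the source of
    all orthogonality relations below. *)
Lemma Cint_scaled_eq0 T f (c : R[i]) : scales mu T 1 -> Cmeas f -> Cintegrable f ->
  {ae mu, forall x, f (T x) = c * f x} -> c != 1 -> Cint f = 0.
Proof.
move=> sT mf jf fT c1; have E : Cint (f \o T) = Cint (fun x => c * f x).
  apply: ae_eq_Cint => //.
  - by split; [exact: (measurableT_comp mf.1 sT.1)|exact: (measurableT_comp mf.2 sT.1)].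
  - by apply: CmeasM => //; exact: Cmeas_cst.
move: E; rewrite Cint_comp// CintZ// => /eqP.
rewrite -[X in X == _]mul1r -subr_eq0 -mulrBl mulf_eq0 subr_eq0 eq_sym (negbTE c1) /=.
by move/eqP.
Qed.

(** Real dominated convergence is applied to [cmod (F k x - f x)] with majorant [q + q], and
    [Cint_le] carries the result to the complex integrals. *)
Lemma dominated_Cint (F : nat -> X -> R[i]) f q :
  (forall k, Cmeas (F k)) -> Cmeas f -> rintegrable q ->
  (forall k x, cmod (F k x) <= q x) -> (forall x, ccvg (F^~ x) (f x)) ->
  ccvg (fun k => Cint (F k)) (Cint f).
Proof.
move=> mF mf iq Fq Ff.
have fq x : cmod (f x) <= q x by apply: ccvg_le (Ff x) _ => k; exact: Fq.
have jF k := Cintegrable_le (mF k) (Fq k) iq.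
have jf := Cintegrable_le mf fq iq.
pose D k x := 2 * cmod (F k x - f x).
have iD k : rintegrable (fun x => cmod (F k x - f x)).
  apply: (@rintegrable_le _ (fun x => q x + q x)).
  - by apply: Cmeas_cmod; exact: CmeasB.
  - move=> x; rewrite ger0_norm ?cmod_ge0//; apply: le_trans (cmodB_le _ _) _.
    by apply: lerD.
  - exact: rintegrableD.
have H : (\int[mu]_x (cmod (F k x - f x))%:E)%E @[k --> \oo] --> 0%E.
  rewrite -[X in _ --> X](integral0 mu setT).
  suff [] : [/\ mu.-integrable setT (fun=> 0 : \bar R)%E,
    [sequence (\int[mu]_x `|(cmod (F n x - f x))%:E - 0|)%E]_n @ \oo --> 0%E &
    [sequence (\int[mu]_x (cmod (F n x - f x))%:E)%E]_n @ \oo --> (\int[mu]_x (0 : \bar R))%E] by [].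
  apply: (@dominated_convergence _ _ _ mu setT measurableT _ _ (fun x => (q x + q x)%:E)).
  - by move=> k; exact: measurable_int (iD k).
  - exact: measurable_cst.
  - apply: aeW => x _; apply/cvg_EFin; first by exists 0%N.
    apply/cvgrPdist_le => e e0; have [N NP] := Ff x e e0.
    exists N => // k /= Nk; rewrite sub0r normrN ger0_norm ?cmod_ge0//; exact: NP.
  - exact: rintegrableD.
  - apply: aeW => x k _; rewrite /= lee_fin ger0_norm ?cmod_ge0//.
    by apply: le_trans (cmodB_le _ _) _; apply: lerD.
move=> e e0; have e2 : 0 < e / 2 by rewrite divr_gt0.
have /fine_cvgP[_ /cvgrPdist_le/(_ _ e2)[N _ NP]] := H.
exists N => k /NP /=; rewrite sub0r normrN => h; rewrite -CintB//.
apply: le_trans (Cint_le (CmeasB (mF k) mf) (fun x => lexx _) (iD k)) _.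
have := ler_norm (\int[mu]_x cmod (F k x - f x)) => h2.
have {h h2} := le_trans h2 h; set t := \int[mu]_x _; clear; lra.
Qed.

End complex_integration.

(** * Weighted square-integrable functions and their inner product *)

Section weighted_L2.
Context d (X : measurableType d) (R : realType).
Variables (mu : {measure set X -> \bar R}) (w : X -> R).
Hypotheses (mw : measurable_fun setT w) (w0 : forall x, 0 <= w x).
Implicit Types (f g : X -> R[i]).

Definition wL2 f := Cmeas f /\ (\int[mu]_x (cmod (f x) ^+ 2 * w x)%:E < +oo)%E.

Definition wsqnorm f : R := \int[mu]_x (cmod (f x) ^+ 2 * w x).

Definition wip f g : R[i] := Cint mu (fun x => f x * (g x)^* * (w x)%:C).

Lemma L2_integrable f : wL2 f -> rintegrable mu (fun x => cmod (f x) ^+ 2 * w x).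
Proof.
move=> [mf foo]; apply: rintegrable_ge0 => //.
- by apply: measurable_funM => //; exact: Cmeas_cmod2.
- by move=> x; rewrite mulr_ge0 ?sqr_ge0.
Qed.

Lemma sqnorm_ge0 f : 0 <= wsqnorm f.
Proof. by apply: Rintegral_ge0 => x _; rewrite mulr_ge0 ?sqr_ge0. Qed.

Lemma L2_le f q : Cmeas f -> (forall x, cmod (f x) ^+ 2 * w x <= q x) -> rintegrable mu q ->
  wL2 f.
Proof.
move=> mf fq iq; split => //; apply: rintegrable_lty; apply: rintegrable_le iq.
  by apply: measurable_funM => //; exact: Cmeas_cmod2.
by move=> x; rewrite ger0_norm// mulr_ge0 ?sqr_ge0.
Qed.

Lemma L2_bounded_mul phi f (M : R) : Cmeas phi -> (forall x, cmod (phi x) <= M) -> wL2 f ->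
  wL2 (fun x => phi x * f x) /\ wsqnorm (fun x => phi x * f x) <= M ^+ 2 * wsqnorm f.
Proof.
move=> mphi phiM Lf; have jf := L2_integrable Lf.
have le x : cmod (phi x * f x) ^+ 2 * w x <= M ^+ 2 * (cmod (f x) ^+ 2 * w x).
  rewrite cmodM exprMn -mulrA; apply: ler_wpM2r; first by rewrite mulr_ge0 ?sqr_ge0.
  have M0 := le_trans (cmod_ge0 _) (phiM x).
  by rewrite lerXn2r ?nnegrE ?cmod_ge0//; exact: phiM.
have L : wL2 (fun x => phi x * f x).
  apply: L2_le le _; last exact: rintegrableZ.
  by apply: CmeasM => //; exact: Lf.1.
split => //; rewrite -RintegralZl//; apply: le_Rintegral => //; first exact: L2_integrable.
exact: rintegrableZ.
Qed.

Lemma L2Z (c : R[i]) f : wL2 f -> wL2 (fun x => c * f x).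
Proof. by move=> Lf; exact: (L2_bounded_mul (Cmeas_cst X c) (fun x => lexx _) Lf).1. Qed.

Lemma L2D f g : wL2 f -> wL2 g -> wL2 (fun x => f x + g x).
Proof.
move=> Lf Lg; have jf := L2_integrable Lf; have jg := L2_integrable Lg.
apply: (@L2_le _ (fun x => 2 * (cmod (f x) ^+ 2 * w x) + 2 * (cmod (g x) ^+ 2 * w x))).
- by apply: CmeasD; [exact: Lf.1|exact: Lg.1].
- move=> x; rewrite !mulrA -mulrDl ler_wpM2r//.
  have := cmodD_le (f x) (g x); have := cmod_ge0 (f x + g x).
  have := sqr_ge0 (cmod (f x) - cmod (g x)).
  set a := cmod (f x); set b := cmod (g x); set c := cmod _; clear => h1 h2 h3.
  have : c ^+ 2 <= (a + b) ^+ 2 by rewrite lerXn2r ?nnegrE//; exact: le_trans h3.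
  move: h1; rewrite sqrrB sqrrD; lra.
- by apply: rintegrableD; exact: rintegrableZ.
Qed.

Lemma L2B f g : wL2 f -> wL2 g -> wL2 (fun x => f x - g x).
Proof.
move=> Lf Lg; under [f in wL2 f]eq_fun do rewrite -mulN1r.
by apply: L2D => //; exact: L2Z.
Qed.

Lemma L20 : wL2 (fun=> 0).
Proof.
split; first exact: Cmeas_cst.
by under eq_integral do rewrite cmod0 expr0n /= mul0r; rewrite integral0.
Qed.

Lemma L2_sum (I : Type) (s : seq I) (F : I -> X -> R[i]) :
  (forall i, wL2 (F i)) -> wL2 (fun x => \sum_(i <- s) F i x).
Proof.
move=> mF; elim: s => [|i s IH].
  by under [f in wL2 f]eq_fun do rewrite big_nil; exact: L20.
by under [f in wL2 f]eq_fun do rewrite big_cons; exact: L2D.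
Qed.

Lemma Cmeas_ip f g : Cmeas f -> Cmeas g -> Cmeas (fun x => f x * (g x)^* * (w x)%:C).
Proof.
move=> mf mg; apply: CmeasM; last exact: Cmeas_real.
by apply: CmeasM => //; exact: Cmeas_conj.
Qed.

Lemma cmod_ip f g x : cmod (f x * (g x)^* * (w x)%:C) = cmod (f x) * cmod (g x) * w x.
Proof. by rewrite !cmodM cmod_conj cmod_real ger0_norm. Qed.

Lemma ip_bound f g (e : R) x : 0 < e -> cmod (f x) * cmod (g x) * w x <=
  2^-1 * (e * (cmod (f x) ^+ 2 * w x) + e^-1 * (cmod (g x) ^+ 2 * w x)).
Proof.
move=> e0; rewrite !mulrA -mulrDl mulrA ler_wpM2r//.
set a := cmod (f x); set b := cmod (g x).
have h : 0 <= e^-1 * (e * a - b) ^+ 2 by rewrite mulr_ge0 ?sqr_ge0// invr_ge0 ltW.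
have E : e^-1 * (e * a - b) ^+ 2 = e * a ^+ 2 + e^-1 * b ^+ 2 - 2 * (a * b).
  by field; rewrite gt_eqF.
by move: h; rewrite E; clear; lra.
Qed.

Lemma ip_integrable f g : wL2 f -> wL2 g ->
  rintegrable mu (fun x => cmod (f x) * cmod (g x) * w x).
Proof.
move=> Lf Lg; have jf := L2_integrable Lf; have jg := L2_integrable Lg.
apply: (@rintegrable_le _ _ _ _ _ (fun x => 2^-1 * (1 * (cmod (f x) ^+ 2 * w x) +
    1^-1 * (cmod (g x) ^+ 2 * w x)))).
- by do 2 (apply: measurable_funM => //); apply: Cmeas_cmod; [exact: Lf.1|exact: Lg.1].
- by move=> x; rewrite ger0_norm ?mulr_ge0 ?cmod_ge0//; exact: ip_bound.
- by apply: rintegrableZ; apply: rintegrableD; exact: rintegrableZ.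
Qed.

Lemma ip_Cintegrable f g : wL2 f -> wL2 g -> Cintegrable mu (fun x => f x * (g x)^* * (w x)%:C).
Proof.
move=> Lf Lg; apply: Cintegrable_le (ip_integrable Lf Lg).
- by apply: Cmeas_ip; [exact: Lf.1|exact: Lg.1].
- by move=> x; rewrite cmod_ip.
Qed.

(** The inequality [2 a b <= e a ^ 2 + e^-1 b ^ 2], integrated; the factor 1/2 in [ip_bound] absorbs
    the 2 of [Cint_le]. The free parameter [e] lets a small norm of one argument be played against a
    fixed norm of the other. *)
Lemma ip_le f g (e : R) : wL2 f -> wL2 g -> 0 < e ->
  cmod (wip f g) <= e * wsqnorm f + e^-1 * wsqnorm g.
Proof.
move=> Lf Lg e0; have jf := L2_integrable Lf; have jg := L2_integrable Lg.
apply: le_trans (Cint_le (Cmeas_ip Lf.1 Lg.1) (q := fun x =>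
  2^-1 * (e * (cmod (f x) ^+ 2 * w x) + e^-1 * (cmod (g x) ^+ 2 * w x))) _ _) _.
- by move=> x; rewrite cmod_ip; exact: ip_bound.
- by apply: rintegrableZ; apply: rintegrableD; exact: rintegrableZ.
rewrite RintegralZl//; last by apply: rintegrableD; exact: rintegrableZ.
rewrite RintegralD//; [|exact: rintegrableZ|exact: rintegrableZ].
by rewrite !RintegralZl// mulrA divff// mul1r.
Qed.

Lemma ipDl f g k : wL2 f -> wL2 g -> wL2 k -> wip (fun x => f x + g x) k = wip f k + wip g k.
Proof.
move=> Lf Lg Lk; rewrite /wip -CintD; [|exact: ip_Cintegrable|exact: ip_Cintegrable].
by congr (Cint _ _); apply/funext => x; rewrite !mulrDl.
Qed.

Lemma ipZl (c : R[i]) f k : wL2 f -> wL2 k -> wip (fun x => c * f x) k = c * wip f k.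
Proof.
move=> Lf Lk; rewrite /wip -CintZ; last exact: ip_Cintegrable.
by congr (Cint _ _); apply/funext => x; rewrite !mulrA.
Qed.

Lemma ipBl f g k : wL2 f -> wL2 g -> wL2 k -> wip (fun x => f x - g x) k = wip f k - wip g k.
Proof.
move=> Lf Lg Lk; rewrite /wip -CintB; [|exact: ip_Cintegrable|exact: ip_Cintegrable].
by congr (Cint _ _); apply/funext => x; rewrite !mulrBl.
Qed.

Lemma ip_conj f g : wL2 f -> wL2 g -> wip g f = (wip f g)^*.
Proof.
move=> Lf Lg; rewrite /wip -Cint_conj; last exact: ip_Cintegrable.
congr (Cint _ _); apply/funext => x; case: (f x) (g x) => a b [a' b']; simpc.
by congr (_ +i* _); ring.
Qed.

Lemma ipBr f g k : wL2 f -> wL2 g -> wL2 k -> wip k (fun x => f x - g x) = wip k f - wip k g.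
Proof.
move=> Lf Lg Lk; rewrite (ip_conj (L2B Lf Lg) Lk) (ip_conj Lf Lk) (ip_conj Lg Lk).
by rewrite ipBl// rmorphB.
Qed.

Lemma ipZr (c : R[i]) f k : wL2 f -> wL2 k -> wip k (fun x => c * f x) = c^* * wip k f.
Proof.
move=> Lf Lk; rewrite (ip_conj (L2Z c Lf) Lk) (ip_conj Lf Lk).
by rewrite ipZl// rmorphM.
Qed.

Lemma ip_suml (I : Type) (s : seq I) (F : I -> X -> R[i]) k : (forall i, wL2 (F i)) -> wL2 k ->
  wip (fun x => \sum_(i <- s) F i x) k = \sum_(i <- s) wip (F i) k.
Proof.
move=> LF Lk; rewrite /wip -(Cint_sum s (fun i => ip_Cintegrable (LF i) Lk)).2.
by congr (Cint _ _); apply/funext => x; rewrite !mulr_suml.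
Qed.

Lemma ip_sumr (I : Type) (s : seq I) (F : I -> X -> R[i]) k : (forall i, wL2 (F i)) -> wL2 k ->
  wip k (fun x => \sum_(i <- s) F i x) = \sum_(i <- s) wip k (F i).
Proof.
move=> LF Lk; rewrite (ip_conj (L2_sum s LF) Lk).
by rewrite ip_suml// rmorph_sum; apply: eq_bigr => i _; rewrite (ip_conj (LF i) Lk).
Qed.

Lemma ip_diag f : wip f f = (wsqnorm f)%:C.
Proof.
rewrite /wip /wsqnorm -Cint_real; congr (Cint _ _); apply/funext => x.
by rewrite rmorphM; congr (_ * _); rewrite cmod_sqr; case: (f x) => a b; simpc;
  congr (_ +i* _); ring.
Qed.

Lemma ae_eq_ip f f' g : Cmeas f -> Cmeas f' -> Cmeas g ->
  {ae mu, forall x, f x = f' x} -> wip f g = wip f' g.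
Proof.
move=> mf mf' mg ff'; apply: ae_eq_Cint; try exact: Cmeas_ip.
by apply: filterS ff' => x ->.
Qed.

(** Puts a pointwise limit into L^2 with the same norm bound; functions defined by power series
    enter the space this way. *)
Lemma fatou_L2 (F : nat -> X -> R[i]) f (C : R) : (forall k, wL2 (F k)) -> Cmeas f ->
  (forall x, ccvg (F^~ x) (f x)) -> (forall k, wsqnorm (F k) <= C) ->
  wL2 f /\ wsqnorm f <= C.
Proof.
move=> LF mf Ff FC.
have mm k : measurable_fun setT (fun x => (cmod (F k x) ^+ 2 * w x)%:E).
  exact: measurable_int (L2_integrable (LF k)).
have H : (\int[mu]_x (cmod (f x) ^+ 2 * w x)%:E <= C%:E)%E.
  have ge0 k x : [set: X] x -> (0 <= (cmod (F k x) ^+ 2 * w x)%:E)%E.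
    by move=> _; rewrite lee_fin mulr_ge0 ?sqr_ge0.
  have := fatou mu measurableT mm ge0.
  rewrite (eq_integral (fun x => (cmod (f x) ^+ 2 * w x)%:E)); last first.
    move=> x _; have cv : (cmod (F k x) ^+ 2 * w x)%:E @[k --> \oo] --> (cmod (f x) ^+ 2 * w x)%:E.
      apply/cvg_EFin; first by exists 0%N.
      apply: cvgMl; rewrite expr2; under eq_fun do rewrite expr2.
      have c1 : cmod (F k x) @[k --> \oo] --> cmod (f x).
        apply/cvgrPdist_le => e e0; have [N NP] := Ff x e e0.
        exists N => // k /= /NP; apply: le_trans.
        rewrite ler_norml cmodBC; have := cmodD_le (f x - F k x) (F k x).
        have := cmodD_le (F k x - f x) (f x); rewrite !subrK [cmod (F k x - _)]cmodBC.
        set a := cmod (f x); set b := cmod (F k x); set c := cmod _; clear => *.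
        by apply/andP; split; lra.
      exact: cvgM.
    by rewrite is_cvg_limn_einfE ?(cvg_lim _ cv)//; apply/cvg_ex; eexists; exact: cv.
  move=> /le_trans; apply; rewrite limn_einf_lim; apply: lime_le; first exact: is_cvg_einfs.
  apply: nearW => k; apply: (@le_trans _ _ (\int[mu]_x (cmod (F k x) ^+ 2 * w x)%:E)%E).
    by apply: ereal_inf_lbound; exists k => /=.
  by rewrite -rintegralE ?lee_fin; [exact: FC|exact: L2_integrable].
split; first by split => //; exact: le_lt_trans H (ltry _).
have Lf : wL2 f by split => //; exact: le_lt_trans H (ltry _).
by rewrite -lee_fin rintegralE//; exact: L2_integrable.
Qed.

End weighted_L2.

Lemma Cmeas_cvg d (X : measurableType d) (R : realType) (F : nat -> X -> R[i]) f :
  (forall k, Cmeas (F k)) -> (forall x, ccvg (F^~ x) (f x)) -> Cmeas f.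
Proof.
move=> mF Ff; split.
- apply: (@measurable_fun_cvg _ _ _ _ (fun k x => complex.Re (F k x))).
    by move=> k; exact: (mF k).1.
  move=> x _; apply/cvgrPdist_le => e e0; have [N NP] := Ff x e e0.
  exists N => // k /= Nk; rewrite -raddfB/= (le_trans (Re_le_cmod _))// cmodBC; exact: NP.
- apply: (@measurable_fun_cvg _ _ _ _ (fun k x => complex.Im (F k x))).
    by move=> k; exact: (mF k).2.
  move=> x _; apply/cvgrPdist_le => e e0; have [N NP] := Ff x e e0.
  exists N => // k /= Nk; rewrite -raddfB/= (le_trans (Im_le_cmod _))// cmodBC; exact: NP.
Qed.

(** * Pointwise convergent expansions in an orthogonal family *)

Section orthogonal_expansion.
Context d (X : measurableType d) (R : realType).
Variables (mu : {measure set X -> \bar R}) (w : X -> R).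
Hypotheses (mw : measurable_fun setT w) (w0 : forall x, 0 <= w x).
Local Notation L2 := (wL2 mu w).
Local Notation ip := (wip mu w).
Local Notation sqnorm := (wsqnorm mu w).

Lemma ip_cvg_r (G : X -> R[i]) (F : nat -> X -> R[i]) f q : Cmeas G ->
  (forall k, Cmeas (F k)) -> rintegrable mu q ->
  (forall k x, cmod (G x) * cmod (F k x) * w x <= q x) ->
  (forall x, ccvg (F^~ x) (f x)) -> ccvg (fun k => ip G (F k)) (ip G f).
Proof.
move=> mG mF iq Gq Ff; have mf := Cmeas_cvg mF Ff.
apply: (dominated_Cint (q := q)) => //.
- by move=> k; exact: Cmeas_ip.
- exact: Cmeas_ip.
- by move=> k x; rewrite cmod_ip.
- move=> x; have Fx := Ff x.
  have {}Fx : ccvg (fun k => (F k x)^*) (f x)^*.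
    move=> e' e'0; have [N NP] := Fx e' e'0; exists N => m /NP.
    by rewrite -[X in X <= _]cmod_conj rmorphB.
  have E u : G x * u * (w x)%:C = G x * (w x)%:C * u by ring.
  by rewrite E; under [u in ccvg u]eq_fun do rewrite E; exact: ccvgZ.
Qed.

Lemma ip_cvg_l (G : nat -> X -> R[i]) g f q : Cmeas f ->
  (forall k, Cmeas (G k)) -> rintegrable mu q ->
  (forall k x, cmod (G k x) * cmod (f x) * w x <= q x) ->
  (forall x, ccvg (G^~ x) (g x)) -> ccvg (fun k => ip (G k) f) (ip g f).
Proof.
move=> mf mG iq Gq Gg; have mg := Cmeas_cvg mG Gg.
apply: (dominated_Cint (q := q)) => //.
- by move=> k; exact: Cmeas_ip.
- exact: Cmeas_ip.
- by move=> k x; rewrite cmod_ip.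
- move=> x; have E u : u * (f x)^* * (w x)%:C = (f x)^* * (w x)%:C * u by ring.
  by rewrite E; under [u in ccvg u]eq_fun do rewrite E; exact: ccvgZ.
Qed.

Variables (I : eqType) (e : I -> X -> R[i]) (B : nat -> seq I).
Hypotheses (Le : forall i, L2 (e i)) (uB : forall N, uniq (B N))
  (orth : forall i j, i != j -> ip (e i) (e j) = 0).

Definition psum (c : I -> R[i]) N x := \sum_(i <- B N) c i * e i x.

Lemma L2_psum c N : L2 (psum c N).
Proof. by apply: (L2_sum mw w0) => i; exact: (L2Z mw w0). Qed.

Lemma ip_psuml c N g : L2 g -> ip (psum c N) g = \sum_(i <- B N) c i * ip (e i) g.
Proof.
move=> Lg; rewrite /psum (ip_suml mw w0 _ (F := fun i x => c i * e i x))//.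
  by apply: eq_bigr => i _; rewrite (ipZl mw w0).
by move=> i; exact: (L2Z mw w0).
Qed.

Lemma ip_psumr_scaled (psi : X -> R[i]) c N i : L2 (fun x => psi x * e i x) ->
  (forall j, i != j -> ip (fun x => psi x * e i x) (e j) = 0) ->
  ip (fun x => psi x * e i x) (psum c N) =
  if i \in B N then (c i)^* * ip (fun x => psi x * e i x) (e i) else 0.
Proof.
move=> Lp orthp; rewrite /psum (ip_sumr mw w0 _ (F := fun i x => c i * e i x))//; last first.
  by move=> j; exact: (L2Z mw w0).
under eq_bigr => j _ do rewrite (ipZr mw w0)//.
case: ifPn => iB; last first.
  rewrite big_seq big1// => j jB; rewrite orthp ?mulr0//.
  by apply: contraNneq iB => ->.
rewrite (bigD1_seq i)//= big1 ?addr0// => j ji.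
by rewrite orthp ?mulr0// eq_sym.
Qed.

Lemma ip_psumr c N i : i \in B N -> ip (e i) (psum c N) = (c i)^* * (sqnorm (e i))%:C.
Proof.
move=> iB; have E : (fun x => 1 * e i x) = e i by apply/funext => x; rewrite mul1r.
have := @ip_psumr_scaled (fun=> 1) c N i; rewrite E iB => -> //.
  by rewrite ip_diag.
by move=> j; exact: orth.
Qed.

Lemma realCM (a b : R) : (a * b)%:C = a%:C * b%:C.
Proof. exact: (rmorphM (real_complex R)). Qed.

Lemma realCB (a b : R) : (a - b)%:C = a%:C - b%:C.
Proof. exact: (rmorphB (real_complex R)). Qed.

Lemma sqnorm_psum c N : sqnorm (psum c N) = \sum_(i <- B N) cmod (c i) ^+ 2 * sqnorm (e i).
Proof.
apply: (@complexI R); rewrite -ip_diag ip_psuml; last exact: L2_psum.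
rewrite (rmorph_sum (real_complex R)) /= big_seq [RHS]big_seq; apply: eq_bigr => i iB.
by rewrite ip_psumr// mulrA mul_conj -realCM.
Qed.

Section expansion.
Variables (c : I -> R[i]) (f : X -> R[i]).
Hypotheses (Lf : L2 f) (fe : forall i, ip (e i) f = (c i)^* * (sqnorm (e i))%:C)
  (fS : forall x, ccvg (fun N => psum c N x) (f x)).

Lemma sqnorm_remainder N : sqnorm (fun x => f x - psum c N x) = sqnorm f - sqnorm (psum c N).
Proof.
have LS := L2_psum c N.
have Sf : ip (psum c N) f = (sqnorm (psum c N))%:C.
  rewrite ip_psuml// sqnorm_psum (rmorph_sum (real_complex R)) /=; apply: eq_bigr => i _.
  by rewrite fe mulrA mul_conj -realCM.
have fS' : ip f (psum c N) = (sqnorm (psum c N))%:C.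
  by rewrite (ip_conj mw w0 LS Lf) Sf; apply/eqP; rewrite eq_complex /= oppr0 !eqxx.
apply: (@complexI R); rewrite -ip_diag (ipBr mw w0)//; last exact: (L2B mw w0).
by rewrite !(ipBl mw w0)// Sf fS' !ip_diag subrr subr0 realCB.
Qed.

Lemma bessel N : sqnorm (psum c N) <= sqnorm f.
Proof. by rewrite -subr_ge0 -sqnorm_remainder sqnorm_ge0. Qed.

(** If every remainder exceeded [eps], Pythagoras would bound the partial sums by [sqnorm f - eps],
    and Fatou's lemma would give the same bound for their limit [f]. Pointwise convergence is
    thereby upgraded to approximation in norm. *)
Lemma sqnorm_remainder_le (eps : R) : 0 < eps ->
  exists N, sqnorm (fun x => f x - psum c N x) <= eps.
Proof.
move=> e0; apply: contrapT => /forallNP H.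
have SN N : sqnorm (psum c N) <= sqnorm f - eps.
  by have /negP := H N; rewrite -ltNge sqnorm_remainder ltrBrDl -ltrBrDr => /ltW.
have [_] := fatou_L2 mw w0 (L2_psum c) Lf.1 fS SN.
by rewrite lerBrDl gerDr leNgt e0.
Qed.

Lemma orth_expansion F : L2 F -> (forall i, ip F (e i) = 0) -> ip F f = 0.
Proof.
move=> LF Fe; apply/eqP; rewrite -cmod_eq0 eq_le cmod_ge0 andbT.
apply/ler_addgt0Pr => eps e0; rewrite add0r.
have s0 : 0 < sqnorm F + 1 by rewrite ltr_wpDl ?sqnorm_ge0.
(* With a remainder of at most [t * (eps / 2)], both terms of [ip_le] at parameter [t] are at most
   [eps / 2]. *)
pose t := eps / 2 / (sqnorm F + 1).
have t0 : 0 < t by rewrite !divr_gt0.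
have [N NP] := sqnorm_remainder_le (mulr_gt0 t0 (divr_gt0 e0 (ltr0n R 2))).
have FS : ip F (psum c N) = 0.
  rewrite (ip_conj mw w0 (L2_psum c N) LF) ip_psuml// big1 ?rmorph0// => i _.
  by rewrite (ip_conj mw w0 LF (Le i)) Fe rmorph0 mulr0.
have -> : ip F f = ip F (fun x => f x - psum c N x).
  by rewrite (ipBr mw w0)// ?FS ?subr0//; exact: L2_psum.
apply: le_trans (ip_le mw w0 LF (L2B mw w0 Lf (L2_psum c N)) t0) _.
rewrite [leRHS]splitr; apply: lerD.
  rewrite /t mulrAC ler_pdivrMr// ler_wpM2l ?divr_ge0// ?ltW//.
  by rewrite ltrDl.
by rewrite ler_pdivrMl.
Qed.

(** Orthogonality bounds each new partial sum by [C ^ 2] times the old one, Bessel's inequality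
    bounds the latter by [f], and Fatou's lemma passes to the limit. *)
Lemma multiplier_expansion (lam : I -> R[i]) (C : R) g : (forall i, cmod (lam i) <= C) ->
  (forall x, ccvg (fun N => psum (fun i => lam i * c i) N x) (g x)) ->
  L2 g /\ sqnorm g <= C ^+ 2 * sqnorm f.
Proof.
move=> lamC gS.
have mg : Cmeas g by apply: Cmeas_cvg gS => N; exact: (L2_psum _ N).1.
apply: (fatou_L2 mw w0 (L2_psum (fun i => lam i * c i)) mg gS) => N.
apply: (@le_trans _ _ (C ^+ 2 * sqnorm (psum c N))).
  rewrite !sqnorm_psum mulr_sumr; apply: ler_sum => i _.
  rewrite cmodM exprMn -mulrA; apply: ler_wpM2r.
    by rewrite mulr_ge0 ?sqr_ge0 ?sqnorm_ge0.
  by rewrite lerXn2r ?nnegrE ?cmod_ge0// (le_trans _ (lamC i))// cmod_ge0.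
apply: ler_wpM2l; [exact: sqr_ge0|exact: bessel].
Qed.

End expansion.

End orthogonal_expansion.

(** * Toeplitz operators on the Fock space *)

Section weighted_fock.
Variables (R : realType) (n : nat) (h : R -> R).
Hypothesis n_gt0 : (0 < n)%N.
Hypothesis h_cont : {within `[0, +oo[, continuous h}.
Hypothesis h_moments : forall m : nat,
  (\int[@lebesgue_measure R]_(r in `[0%R, +oo[)
     (r ^+ (2 * m + 2 * n - 1)%N * expR (- 2 * h r))%:E < +oo)%E.

Local Notation X := (Cn R n).
Local Notation mu := (@lebesgue_Cn R n).
Local Notation w := (@weight R n h).
Local Notation idx := {ffun 'I_n -> nat}.
Local Notation L2 := (wL2 mu w).
Local Notation ip := (wip mu w).
Local Notation sqnorm := (wsqnorm mu w).
Local Notation mon := (@mon R n).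
Implicit Types (x y : idx) (c : idx -> R[i]) (f g phi : X -> R[i]) (z : X) (j : 'I_n).

Let mw : measurable_fun setT w.
Proof. exact: measurable_weight. Qed.

Let w_gt0 z : 0 < w z.
Proof. exact: expR_gt0. Qed.

Let w0 z : 0 <= w z.
Proof. exact: expR_ge0. Qed.
Local Hint Resolve mw w0 : core.

Lemma tnorm_uncvec z : tnorm (uncvec z) = cnorm z.
Proof. by rewrite /tnorm uncvecK. Qed.

Lemma measurable_cnorm : measurable_fun setT (fun z : X => cnorm z).
Proof.
rewrite (_ : (fun z => _) = @tnorm R n \o (@uncvec R n : X -> _)).
  exact: (measurableT_comp (@measurable_tnorm R n) (@measurable_uncvec R n)).
by apply/funext => z; rewrite /= tnorm_uncvec.
Qed.

Lemma Cmeas_coord j : Cmeas (fun z : X => z j 0).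
Proof.
have mt : measurable_fun setT (fun z : X => tnth (uncvec z) j).
  exact: (measurableT_comp (@measurable_tnth _ _ n j) (@measurable_uncvec R n)).
split.
- rewrite (_ : (fun z => _) = fun z : X => (tnth (uncvec z) j).1).
    exact: (measurableT_comp measurable_fst mt).
  by apply/funext => z; rewrite tnth_mktuple.
- rewrite (_ : (fun z => _) = fun z : X => (tnth (uncvec z) j).2).
    exact: (measurableT_comp measurable_snd mt).
  by apply/funext => z; rewrite tnth_mktuple.
Qed.

Lemma Cmeas_mon x : Cmeas (mon x : X -> R[i]).
Proof. by apply: Cmeas_prod => j; apply: CmeasX; exact: Cmeas_coord. Qed.

Lemma polydisc_cnorm z : polydisc z (cnorm z).
Proof.
move=> j; rewrite -[leLHS](ger0_norm (cmod_ge0 _)) -sqrtr_sqr ler_wsqrtr//.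
rewrite (bigD1 j)//= lerDl; apply: sumr_ge0 => i _; exact: sqr_ge0.
Qed.

(** The squared modulus of the monomial is at most the [2 * deg x]-th power of the norm, so the
    radial criterion and the moment [m = deg x] apply. *)
Lemma L2_mon x : L2 (mon x).
Proof.
split; first exact: Cmeas_mon.
(* [h] is continuous only on the half-line, while [Q] must be measurable and nonnegative on all of
   R; arguments are clamped to the half-line. *)
pose m0 (r : R) := Num.max r 0.
pose Q r := m0 r ^+ (2 * deg x) * expR (- 2 * h (m0 r)).
have m00 r : 0 <= m0 r by rewrite /m0 le_max lexx orbT.
have Q0 r : 0 <= Q r by rewrite mulr_ge0 ?exprn_ge0// expR_ge0.
have mm0 : measurable_fun setT m0 by apply: measurable_maxr => //; exact: measurable_cst.
have mh : measurable_fun (`[0, +oo[ : set R) h by exact: subspace_continuous_measurable_fun.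
have mhm : measurable_fun setT (h \o m0).
  refine (measurable_comp _ _ mh mm0); first exact: measurable_itv.
  by move=> _ [t _ <-] /=; rewrite in_itv /= andbT.
have mQ : measurable_fun setT Q.
  apply: measurable_funM; first exact: measurable_funX.
  apply: (measurableT_comp (@measurable_expR R)).
  by apply: measurable_funM => //; exact: measurable_cst.
have Qoo : (\int[@lebesgue_measure R]_(r in `[0%R, +oo[)
    (r ^+ (2 * n - 1) * Q r)%:E < +oo)%E.
  move: (h_moments (deg x)); congr (_ < _)%E; apply: eq_integral => r.
  rewrite inE /= in_itv /= andbT => r0; rewrite /Q /m0 (max_idPl r0) mulrA -exprD.
  by do 3 congr (_ _); rewrite addnBAC ?muln_gt0// addnC.
have H := radial_finite n_gt0 mQ Q0 Qoo.
apply: le_lt_trans H.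
have mQt : measurable_fun setT (fun p => Q (@tnorm R n p)).
  by apply: (measurableT_comp mQ); exact: measurable_tnorm.
rewrite -(lebesgue_Cn_integral (G := fun p => (Q (@tnorm R n p))%:E)); last 2 first.
- exact/measurable_EFinP.
- by move=> p; rewrite lee_fin.
apply: ge0_le_integral_EFin.
- by apply: measurable_funM; [exact/Cmeas_cmod2/Cmeas_mon|exact: mw].
- exact: (measurableT_comp mQt (@measurable_uncvec R n)).
- by move=> z; rewrite mulr_ge0 ?sqr_ge0.
move=> z; rewrite tnorm_uncvec /Q /m0 (max_idPl (sqrtr_ge0 _)).
apply: ler_wpM2r; first exact: expR_ge0.
rewrite mulnC exprM lerXn2r ?nnegrE ?cmod_ge0 ?exprn_ge0 ?sqrtr_ge0//.
exact/cmod_mon_le/polydisc_cnorm.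
Qed.

(** A vanishing norm would make the monomial zero almost everywhere, but it has no zero on the cube
    where all real and imaginary parts lie in [[1, 2]], a set of measure 1. *)
Lemma sqnorm_mon_gt0 x : 0 < sqnorm (mon x).
Proof.
rewrite lt_neqAle sqnorm_ge0// andbT; apply/negP => /eqP/esym e0.
have ix := L2_integrable mw w0 (L2_mon x).
have : (\int[mu]_z `|(cmod (mon x z) ^+ 2 * w z)%:E| = 0)%E.
  rewrite (eq_integral (fun z => (cmod (mon x z) ^+ 2 * w z)%:E)); last first.
    by move=> z _; rewrite gee0_abs// lee_fin; apply: mulr_ge0; [exact: sqr_ge0|exact: w0].
  by rewrite -(rintegralE ix); exact: (congr1 EFin e0).
move/(ae_eq_integral_abs mu measurableT (measurable_int _ ix)) => [N [mN N0 NP]].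
pose J : set (measurableTypeR R) := `[1, 2]%classic.
have mI : measurable (J `*` J) by apply: measurableX; exact: measurable_itv.
have le12 : 1 <= 2 :> R by rewrite ler1n.
have B1 := tuple_measure_tbox n mI (lebesgue_R2_square le12).
pose B : set X := @uncvec R n @^-1` (@tbox R n (J `*` J)).
have BE : @cvec R n @^-1` B = tbox (J `*` J).
  apply/seteqP; split=> p; rewrite /B /= cvecK; exact.
have mB : measurable (@cvec R n @^-1` B) by rewrite BE; exact: measurable_tbox.
have muB : mu B = 1%E.
  have one : 2 - 1 = 1 :> R by lra.
  by rewrite lebesgue_Cn_Borel// BE B1 one !expr1n.
have BN : B `<=` N.
  move=> z Bz; apply: NP => /= /(_ I) /eqP; apply/negP.
  have nz j : z j 0 != 0.
    have := Bz j; rewrite /J /= tnth_mktuple /= in_itv /= => -[/andP[re1 _] _].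
    by rewrite -cmod_gt0 (lt_le_trans _ (Re_le_cmod _))// normr_gt0 gt_eqF// (lt_le_trans _ re1).
  rewrite eqe mulf_neq0 ?(gt_eqF (w_gt0 z))// expf_neq0// cmod_eq0.
  by apply/prodf_neq0 => j _; rewrite expf_neq0.
have : (mu B <= mu N)%E by apply: le_measure; rewrite ?inE//; exact: lebesgue_measurable_Borel.
by rewrite N0 muB lee_fin ler10.
Qed.

Let Lmon x : L2 (mon x).
Proof. exact: L2_mon. Qed.

Let mon_gt0 x : 0 < sqnorm (mon x).
Proof. exact: sqnorm_mon_gt0. Qed.

(** * Invariant symbols and orthogonality of monomials *)

Definition torus_invariant phi :=
  forall j (t : R[i]), cmod t = 1 -> {ae mu, forall z, phi (rot j t z) = phi z}.

(* Essentially bounded symbols are replaced by bounded ones when it comes to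
   integrals. *)
Definition bounded_symbol phi (M : R) :=
  [/\ Cmeas phi, forall z, cmod (phi z) <= M & torus_invariant phi].

Lemma cnorm_rot j (t : R[i]) z : cmod t = 1 -> cnorm (rot j t z) = cnorm z.
Proof.
move=> t1; rewrite /cnorm; congr Num.sqrt; apply: eq_bigr => i _; rewrite mxE.
case: eqP => // ->; congr (_ ^+ 2); rewrite -[LHS]/(cmod _) cmodM t1 mul1r //.
Qed.

Lemma weight_rot j (t : R[i]) z : cmod t = 1 -> w (rot j t z) = w z.
Proof. by move=> t1; rewrite /weight cnorm_rot. Qed.

Lemma mon_rot x j (t : R[i]) z : mon x (rot j t z) = t ^+ x j * mon x z.
Proof.
rewrite /mon (bigD1 j)//= [in RHS](bigD1 j)//= mulrA !mxE eqxx exprMn; congr (_ * _).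
by apply: eq_bigr => i ij; rewrite mxE (negbTE ij).
Qed.

(** Take [t] of angle [pi / (2 d)] with [d] the distance of [a] and [b], so that [t ^ d = 'i]. The
    angle is at most a quarter-turn, which keeps the real part above -1 as [scales_rot] requires. *)
Lemma rotation_neq1 (a b : nat) : a != b ->
  exists2 t : R[i], cmod t = 1 /\ -1 < complex.Re t & t ^+ a * (t ^+ b)^* != 1.
Proof.
have H (d : nat) : (0 < d)%N -> exists2 t : R[i], cmod t = 1 /\ -1 < complex.Re t & t ^+ d = 'i.
  move=> d0; have dR : 0 < d%:R :> R by rewrite ltr0n.
  have d1 : 1 <= d%:R :> R by rewrite ler1n.
  exists (cis (pi / 2 / d%:R)).
    split; first exact: cmod_cis.
    apply: (@lt_le_trans _ _ 0); first by rewrite ltrN10.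
    apply: cos_ge0_pihalf; have p0 := @pi_gt0 R.
    have p2 : 0 < pi / 2 :> R by rewrite divr_gt0.
    apply/andP; split; last by rewrite ler_pdivrMr// ler_peMr// ltW.
    by apply: (@le_trans _ _ 0); rewrite ?oppr_le0 ?divr_ge0// ltW.
  rewrite cisX mulrC divfK ?gt_eqF// /cis cos_pihalf sin_pihalf.
  by [].
move=> ab; wlog : a b ab / (a < b)%N.
  move=> W; case: (ltngtP a b) => [/W h1|/W h1|E]; first exact: h1.
    have [|t tP te] := h1; first by rewrite eq_sym.
    exists t => //; apply: contra te => /eqP te.
    have := congr1 Num.conj te; rewrite rmorphM /= conjCK rmorph1 mulrC => E.
    by apply/eqP; exact: E.
  by rewrite E eqxx in ab.
move=> ltab; have [|t [t1 tr] td] := H (b - a)%N; first by rewrite subn_gt0.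
exists t => //; rewrite -(subnKC (ltnW ltab)) exprD td rmorphM mulrA.
rewrite conj_cmod1 ?cmodX ?t1 ?expr1n// mul1r; apply/negP => /eqP/(congr1 (@complex.Re R)) /=.
by move/eqP; rewrite eq_sym oner_eq0.
Qed.

Lemma ip_mon_orth phi M x y : bounded_symbol phi M -> x != y ->
  ip (fun z => phi z * mon x z) (mon y) = 0.
Proof.
move=> [mphi phiM phi_rot] xy.
have [j xyj] : exists j, x j != y j.
  apply/existsP; rewrite -negb_forall; apply: contra xy => /forallP E.
  by apply/eqP/ffunP => j; exact/eqP/E.
have [t [t1 tr] te] := rotation_neq1 xyj.
have Lx := (L2_bounded_mul mw w0 mphi phiM (Lmon x)).1.
have mF := Cmeas_ip mw Lx.1 (Lmon y).1.
have jF := ip_Cintegrable mw w0 Lx (Lmon y).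
apply: (Cint_scaled_eq0 (scales_rot j t1 tr) mF jF _ te).
apply: filterS (phi_rot j t t1) => z Ez.
by rewrite Ez weight_rot// !mon_rot rmorphM; ring.
Qed.

Let ball_ind (k : nat) z : R[i] := ((cnorm z < k%:R)%R%:R)%:C.

Let mon_sum c := @psum _ X R idx mon (@box n) c.

Lemma mon_zero z : mon [ffun=> 0%N] z = 1.
Proof. by rewrite /mon big1// => j _; rewrite ffunE expr0. Qed.

Lemma bounded_symbol1 : bounded_symbol (fun=> 1) 1.
Proof.
split; [exact: Cmeas_cst|by move=> z; rewrite cmod1|by move=> j t _; exact: aeW].
Qed.

Lemma bounded_symbol_conj phi (M : R) : bounded_symbol phi M ->
  bounded_symbol (fun z => (phi z)^*) M.
Proof.
move=> [mphi phiM phi_rot]; split; first exact: Cmeas_conj.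
- by move=> z; rewrite cmod_conj.
- by move=> j t t1; apply: filterS (phi_rot j t t1) => z ->.
Qed.

Lemma cmod_ball_ind k z : cmod (ball_ind k z) = (cnorm z < k%:R)%R%:R.
Proof. by rewrite /ball_ind cmod_real ger0_norm. Qed.

Lemma bounded_symbol_ball phi (M : R) k : bounded_symbol phi M ->
  bounded_symbol (fun z => ball_ind k z * phi z) M.
Proof.
move=> [mphi phiM phi_rot]; split.
- apply: CmeasM mphi; apply: Cmeas_real; apply: measurable_bool.
  by apply: measurable_lt_set; [exact: measurable_cnorm|exact: measurable_cst].
- move=> z; rewrite cmodM cmod_ball_ind; have := phiM z; have := cmod_ge0 (phi z).
  by case: (_ < _) => /= h1 h2; rewrite ?mul1r// mul0r (le_trans h1).
- move=> j t t1; apply: filterS (phi_rot j t t1) => z ->.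
  by rewrite /ball_ind cnorm_rot.
Qed.

Lemma mon_orth x y : x != y -> ip (mon x) (mon y) = 0.
Proof.
move=> xy; have <- : (fun z => 1 * mon x z) = mon x by apply/funext => z; rewrite mul1r.
exact: ip_mon_orth bounded_symbol1 xy.
Qed.

Lemma L2_symbol_mul phi (M : R) f : bounded_symbol phi M -> L2 f -> L2 (fun z => phi z * f z).
Proof. by move=> [mphi phiM _] Lf; exact: (L2_bounded_mul mw w0 mphi phiM Lf).1. Qed.

(** On a ball the partial sums of the series are bounded uniformly in [N], so the inner product may
    be taken term by term; orthogonality leaves only the term of index [x]. *)
Lemma ip_ball_coef phi (M : R) c f x k : bounded_symbol phi M -> bounded_coef c -> expands c f ->
  ip (fun z => ball_ind k z * phi z * mon x z) f =
  (c x)^* * ip (fun z => ball_ind k z * phi z * mon x z) (mon x).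
Proof.
move=> sphi bc cf; set psi := fun z => ball_ind k z * phi z.
have spsi : bounded_symbol psi M by exact: bounded_symbol_ball.
have Lpsi := L2_symbol_mul spsi (Lmon x).
(* The radius is enlarged by 1 to be positive for [k = 0] too. *)
have r0 : 0 < k%:R + 1 :> R by rewrite ltr_wpDl.
have [K KP] := bc _ (mulr_gt0 (ltr0n R 2) r0).
have H : ccvg (fun N => ip (fun z => psi z * mon x z) (mon_sum c N))
    (ip (fun z => psi z * mon x z) f).
  (* The monomial of index 0 is the constant 1, so this is integrability of the modulus of [mon x]
     against the weight, the majorant up to a constant. *)
  have i0 := ip_integrable mw w0 (Lmon x) (Lmon [ffun=> 0%N]).
  apply: (ip_cvg_r mw w0 (q := fun z => (M * (K * 2 ^+ n)) *
    (cmod (mon x z) * cmod (mon [ffun=> 0%N] z) * w z))).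
  - exact: Lpsi.1.
  - by move=> N; exact: (L2_psum mw w0 _ Lmon c N).1.
  - exact: rintegrableZ.
  - move=> N z; rewrite mon_zero cmod1 mulr1 mulrA; apply: ler_wpM2r; first exact: w0.
    rewrite cmodM mulrAC; apply: ler_wpM2r; first exact: cmod_ge0.
    rewrite cmodM cmod_ball_ind; have [phi0 phiM _] := sphi.
    have M0 := le_trans (cmod_ge0 _) (phiM z).
    case: (ltP (cnorm z) k%:R) => zk /=.
      rewrite mul1r; apply: ler_pM; rewrite ?cmod_ge0//.
      apply: box_sum_le KP _; first exact: r0.
      apply: le_polydisc (polydisc_cnorm z).
      by apply: le_trans (ltW zk) _; rewrite lerDl.
    rewrite !mul0r mulr_ge0// mulr_ge0 ?exprn_ge0//.
    by apply: le_trans (KP [ffun=> 0%N]); rewrite mulr_ge0 ?cmod_ge0 ?exprn_ge0// mulr_ge0// ltW.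
  - exact: cf.
have [N0 N0P] := mem_box_ex x.
apply: ccvg_uniq H _ => e e0; exists N0 => m /N0P xm.
rewrite (ip_psumr_scaled mw w0 Lmon (@uniq_box n) c m Lpsi); last first.
  by move=> y xy; exact: ip_mon_orth spsi xy.
by rewrite xm subrr cmod0 ltW.
Qed.

(** The ball grows to the whole space on both sides of [ip_ball_coef]. The majorant is now the
    integrand without cut-off, integrable because [f] and [phi * mon x] are in L^2. *)
Lemma ip_coef phi (M : R) c f x : bounded_symbol phi M -> L2 f -> bounded_coef c -> expands c f ->
  ip (fun z => phi z * mon x z) f = (c x)^* * ip (fun z => phi z * mon x z) (mon x).
Proof.
move=> sphi Lf bc cf; have Lphi := L2_symbol_mul sphi (Lmon x).
have H g : L2 g -> ccvg (fun k => ip (fun z => ball_ind k z * phi z * mon x z) g)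
    (ip (fun z => phi z * mon x z) g).
  move=> Lg; apply: (ip_cvg_l mw w0 (q := fun z => cmod (phi z * mon x z) * cmod (g z) * w z)).
  - exact: Lg.1.
  - by move=> k; exact: (L2_symbol_mul (bounded_symbol_ball k sphi) (Lmon x)).1.
  - exact: (ip_integrable mw w0 Lphi Lg).
  - move=> k z; apply: ler_wpM2r; first exact: w0.
    apply: ler_wpM2r; first exact: cmod_ge0.
    rewrite -mulrA cmodM cmod_ball_ind; case: (_ < _); first by rewrite mul1r.
    by rewrite mul0r cmod_ge0.
  (* At a fixed point the cut-off sequence is eventually constant. *)
  - move=> z e e0; exists (Num.bound (cnorm z)) => k zk.
    rewrite /ball_ind (lt_le_trans (archi_boundP (sqrtr_ge0 _))) ?ler_nat//.
    by rewrite mul1r subrr cmod0 ltW.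
apply: ccvg_uniq (H f Lf) _.
under [u in ccvg u]eq_fun => k do rewrite (ip_ball_coef x k sphi bc cf).
exact/ccvgZ/H.
Qed.

(** * The Fock space and the Toeplitz operators on it *)

Local Notation A_h := (fock_space n h_cont).
Implicit Types (u v : A_h) (F : X -> R[i]).

Lemma L2_fock u : L2 u.
Proof. by have /asboolP[] := fock_valP u. Qed.

Lemma fock_expansion u : exists2 c, bounded_coef c & expands c u.
Proof. by have /asboolP[_ eu] := fock_valP u; exact/ent_expansion/entire_ent. Qed.

Lemma mon_fock x : mon x \in fock h.
Proof. by apply/asboolP; split; [exact: Lmon|exact/ent_entire/ent_mon]. Qed.

Definition emon x : A_h := FockSpace h_cont (mon_fock x).

Let mulmon1 x : (fun z => 1 * mon x z) = mon x.
Proof. by apply/funext => z; rewrite mul1r. Qed.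

Lemma ip_mon_coef c f x : L2 f -> bounded_coef c -> expands c f ->
  ip (mon x) f = (c x)^* * (sqnorm (mon x))%:C.
Proof.
move=> Lf bc cf.
have := ip_coef x bounded_symbol1 Lf bc cf.
by rewrite mulmon1 ip_diag.
Qed.

Lemma ip_coef_mon c f x : L2 f -> bounded_coef c -> expands c f ->
  ip f (mon x) = c x * (sqnorm (mon x))%:C.
Proof.
move=> Lf bc cf; rewrite (ip_conj mw w0 (Lmon x) Lf) (ip_mon_coef x Lf bc cf).
by rewrite rmorphM /= conjCK; congr (_ * _); apply/eqP; rewrite eq_complex /= oppr0 !eqxx.
Qed.

Lemma fock_eq0 u : (forall x, ip u (mon x) = 0) -> u = 0.
Proof.
move=> u0; have [c bc cu] := fock_expansion u; apply: val_inj; apply/funext => z /=.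
apply: ccvg_uniq (cu z) _ => e e0; exists 0%N => m _.
rewrite big1 ?subrr ?cmod0 ?ltW// => x _.
have /eqP := u0 x; rewrite (ip_coef_mon x (L2_fock u) bc cu) mulf_eq0.
have /negbTE-> : (sqnorm (mon x))%:C != 0 :> R[i].
  by rewrite -cmod_gt0 cmod_real normr_gt0 gt_eqF.
by rewrite orbF => /eqP->; rewrite mul0r.
Qed.

Lemma fock_orth F u : L2 F -> (forall x, ip F (mon x) = 0) -> ip F u = 0.
Proof.
move=> LF F0; have [c bc cu] := fock_expansion u.
apply: (orth_expansion mw w0 Lmon (@uniq_box n) _ (L2_fock u) _ cu LF F0).
- by move=> x y; exact: mon_orth.
- by move=> x; exact: ip_mon_coef (L2_fock u) bc cu.
Qed.

Definition symbol_eigenvalue phi x : R[i] :=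
  ip (fun z => phi z * mon x z) (mon x) / (sqnorm (mon x))%:C.

(** [ip_le] at parameter 1 gives [M ^ 2 + 1] after division by the norm of the monomial. *)
Lemma symbol_eigenvalue_le phi (M : R) x : bounded_symbol phi M ->
  cmod (symbol_eigenvalue phi x) <= M ^+ 2 + 1.
Proof.
move=> sphi; have [mphi phiM _] := sphi.
have [Lp sq] := L2_bounded_mul mw w0 mphi phiM (Lmon x).
rewrite /symbol_eigenvalue cmodM cmodV cmod_real gtr0_norm// ler_pdivrMr//.
apply: le_trans (ip_le mw w0 Lp (Lmon x) ltr01) _.
by rewrite invr1 !mul1r mulrDl mul1r lerD2r.
Qed.

(** The symbol moves to the other factor as its conjugate, which is again bounded and invariant, so
    [ip_coef] applies to it and the monomial. *)
Lemma ip_symbol_mul phi (M : R) u x : bounded_symbol phi M ->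
  ip (fun z => phi z * u z) (mon x) = symbol_eigenvalue phi x * ip u (mon x).
Proof.
move=> sphi; have [c bc cu] := fock_expansion u; have Lu := L2_fock u.
have sphi' := bounded_symbol_conj sphi.
have Lpu := L2_symbol_mul sphi Lu.
have E f g : ip (fun z => phi z * f z) g = ip f (fun z => (phi z)^* * g z).
  rewrite /wip; congr (Cint _ _); apply/funext => z; rewrite rmorphM /= conjCK; ring.
rewrite (ip_coef_mon x Lu bc cu) E.
rewrite (ip_conj mw w0 (L2_symbol_mul sphi' (Lmon x)) Lu).
rewrite (ip_coef x sphi' Lu bc cu) rmorphM /= conjCK.
rewrite -(ip_conj mw w0 (L2_symbol_mul sphi' (Lmon x)) (Lmon x)) -E.
rewrite /symbol_eigenvalue mulrCA divfK//.
by rewrite -cmod_gt0 cmod_real normr_gt0 gt_eqF.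
Qed.

(** The Taylor coefficients of [u] times bounded eigenvalues still satisfy the Cauchy estimates, so
    they define an entire [g], square integrable by [multiplier_expansion]. Then [phi u - g] is
    orthogonal to every monomial, hence to the whole space. *)
Lemma toeplitz_exists phi (M : R) u : bounded_symbol phi M -> exists v : A_h,
  [/\ forall g : A_h, ip (fun z => phi z * u z - v z) g = 0,
      forall x, ip v (mon x) = symbol_eigenvalue phi x * ip u (mon x) &
      sqnorm v <= (M ^+ 2 + 1) ^+ 2 * sqnorm u].
Proof.
move=> sphi; have [c bc cu] := fock_expansion u; have Lu := L2_fock u.
pose lam := symbol_eigenvalue phi; have lamM x := symbol_eigenvalue_le x sphi.
pose c' x := lam x * c x.
have M0 : 0 <= M ^+ 2 + 1 by rewrite addr_ge0 ?sqr_ge0.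
have bc' : bounded_coef c'.
  move=> r r0; have [K KP] := bc r r0; exists ((M ^+ 2 + 1) * K) => x.
  rewrite cmodM -mulrA; apply: ler_pM.
  - exact: cmod_ge0.
  - by rewrite mulr_ge0 ?cmod_ge0// exprn_ge0// ltW.
  - exact: lamM.
  - exact: KP.
have [g eg cg] := expansion_ent bc'.
have [Lg gu] := multiplier_expansion mw w0 Lmon (@uniq_box n)
  (fun x y => mon_orth (x := x) (y := y)) Lu
  (fun x => ip_mon_coef x Lu bc cu) lamM cg.
have fg : g \in fock h by apply/asboolP; split; [exact: Lg|exact: ent_entire].
have gx x : ip g (mon x) = lam x * ip u (mon x).
  by rewrite (ip_coef_mon x Lg bc' cg) (ip_coef_mon x Lu bc cu) mulrA.
exists (FockSpace h_cont fg); split => //.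
move=> v; have Lpu := L2_symbol_mul sphi Lu.
apply: fock_orth; first exact: (L2B mw w0 Lpu Lg).
move=> x; rewrite (ipBl mw w0 Lpu Lg (Lmon x)) /=.
by rewrite (ip_symbol_mul u x sphi) gx subrr.
Qed.

(** The difference of two candidates is orthogonal to all monomials, hence zero; [xget] therefore
    has a single value to return. *)
Lemma fock_projE F v : L2 F -> (forall g : A_h, ip (fun z => F z - v z) g = 0) ->
  fock_proj h_cont F = v.
Proof.
move=> LF Fv; apply: xget_subset1; first by move=> g; exact: Fv.
move=> v1 v2 /= F1 F2; apply/eqP; rewrite -subr_eq0; apply/eqP/fock_eq0 => x.
have E1 : ip F (mon x) - ip v1 (mon x) = 0.
  by rewrite -(ipBl mw w0 LF (L2_fock v1) (Lmon x)); exact: (F1 (emon x)).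
have E2 : ip F (mon x) - ip v2 (mon x) = 0.
  by rewrite -(ipBl mw w0 LF (L2_fock v2) (Lmon x)); exact: (F2 (emon x)).
rewrite [LHS](ipBl mw w0 (L2_fock v1) (L2_fock v2) (Lmon x)).
by move/eqP: E1; move/eqP: E2; rewrite !subr_eq0 => /eqP<- /eqP<-; rewrite subrr.
Qed.

Lemma toeplitz_boundedP phi (M : R) u : bounded_symbol phi M ->
  (forall x, ip (toeplitz (h_cont := h_cont) phi u) (mon x) =
             symbol_eigenvalue phi x * ip u (mon x)) /\
  sqnorm (toeplitz (h_cont := h_cont) phi u) <= (M ^+ 2 + 1) ^+ 2 * sqnorm u.
Proof.
move=> sphi; have [v [vP vx vu]] := toeplitz_exists u sphi.
have -> : toeplitz (h_cont := h_cont) phi u = v.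
  exact: (fock_projE (L2_symbol_mul sphi (L2_fock u)) vP).
by split.
Qed.

Definition truncation (M : R) phi z : R[i] := ((cmod (phi z) <= M)%R%:R)%:C * phi z.

(** The symbols agree almost everywhere, so both projections are chosen from the same set of
    candidates. *)
Lemma toeplitz_truncation phi (M : R) : Cmeas phi -> {ae mu, forall z, cmod (phi z) <= M} ->
  toeplitz (h_cont := h_cont) phi = toeplitz (h_cont := h_cont) (truncation M phi).
Proof.
move=> mphi phiM; have mt : Cmeas (truncation M phi).
  apply: (CmeasM _ mphi); apply: Cmeas_real; apply: measurable_bool.
  by apply: measurable_le_set; [exact: Cmeas_cmod|exact: measurable_cst].
apply/funext => u; rewrite /toeplitz /fock_proj; congr (xget _ _).
suff E (v g : A_h) : ip (fun z => phi z * u z - v z) g =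
    ip (fun z => truncation M phi z * u z - v z) g.
  by apply/seteqP; split=> v /= H g; rewrite -(H g); [exact/esym/E|exact: E].
have mpu psi : Cmeas psi -> Cmeas (fun z => psi z * u z - v z).
  by move=> mpsi; apply: CmeasB (L2_fock v).1; apply: (CmeasM mpsi (L2_fock u).1).
apply: (ae_eq_ip mw (mpu _ mphi) (mpu _ mt) (L2_fock g).1).
by apply: filterS phiM => z zM; rewrite /= /truncation zM mul1r.
Qed.

Lemma bounded_symbol_truncation phi (M : R) : 0 <= M -> Cmeas phi -> torus_invariant phi ->
  bounded_symbol (truncation M phi) M.
Proof.
move=> M0 mphi phi_rot; split.
- apply: (CmeasM _ mphi); apply: Cmeas_real; apply: measurable_bool.
  by apply: measurable_le_set; [exact: Cmeas_cmod|exact: measurable_cst].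
- move=> z; rewrite /truncation; case: (leP (cmod (phi z)) M) => zM /=; first by rewrite mul1r.
  by rewrite mul0r cmod0.
- by move=> j t t1; apply: filterS (phi_rot j t t1) => z; rewrite /truncation => ->.
Qed.

Lemma toeplitzP phi : in_Linfty phi -> torus_invariant phi ->
  exists lam : idx -> R[i], exists2 C : R, 0 <= C & forall u,
    (forall x, ip (toeplitz (h_cont := h_cont) phi u) (mon x) = lam x * ip u (mon x)) /\
    sqnorm (toeplitz (h_cont := h_cont) phi u) <= C ^+ 2 * sqnorm u.
Proof.
(* The essential bound comes without a sign, and the truncation lemma asks for a nonnegative one. *)
move=> [mphi [M phiM]] phi_rot; pose M' := Num.max M 0.
have M'0 : 0 <= M' by rewrite le_max lexx orbT.
have phiM' : {ae mu, forall z, cmod (phi z) <= M'}.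
  by apply: filterS phiM => z zM; rewrite le_max [cmod _ <= M]zM.
rewrite (toeplitz_truncation mphi phiM').
have sphi := bounded_symbol_truncation M'0 mphi phi_rot.
exists (symbol_eigenvalue (truncation M' phi)), (M' ^+ 2 + 1).
  by rewrite addr_ge0 ?sqr_ge0.
by move=> u; exact: toeplitz_boundedP.
Qed.

(** * The C*-algebra of operators diagonal in the monomials *)

Local Notation inner := (@fock_inner R n h h_cont).
Local Notation e := emon.
Local Notation norm2 u := (sqnorm (fock_val u)).
Implicit Types (a : R[i]) (p : A_h) (S T : A_h -> A_h) (lam : idx -> R[i]).

Lemma inner_lin a u v p : inner (a *: u + v) p = a * inner u p + inner v p.
Proof.
rewrite -(ipZl mw w0 a (L2_fock u) (L2_fock p)).
exact: (ipDl mw w0 (L2Z mw w0 a (L2_fock u)) (L2_fock v) (L2_fock p)).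
Qed.

Lemma inner_sub u v p : inner (u - v) p = inner u p - inner v p.
Proof. by rewrite -scaleN1r addrC inner_lin mulN1r addrC. Qed.

Lemma inner0 p : inner 0 p = 0.
Proof. by have := inner_sub 0 0 p; rewrite !subrr. Qed.

Lemma inner_conj u v : inner v u = Num.conj (inner u v).
Proof. exact: (ip_conj mw w0 (L2_fock u) (L2_fock v)). Qed.

Lemma inner_emon_diag x : inner (e x) (e x) = (sqnorm (mon x))%:C.
Proof. exact: ip_diag. Qed.

Lemma inner_emon_neq0 x : inner (e x) (e x) != 0.
Proof. by rewrite inner_emon_diag -cmod_gt0 cmod_real normr_gt0 gt_eqF. Qed.

Lemma inner_emon_orth x y : x != y -> inner (e x) (e y) = 0.
Proof. exact: mon_orth. Qed.

Lemma inner_eq u v : (forall x, inner u (e x) = inner v (e x)) -> u = v.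
Proof.
move=> uv; apply/eqP; rewrite -subr_eq0; apply/eqP/(fock_eq0) => x.
by rewrite -[LHS]/(inner (u - v) (e x)) inner_sub uv subrr.
Qed.

Lemma inner_le u v (t : R) : 0 < t -> cmod (inner u v) <= t * norm2 u + t^-1 * norm2 v.
Proof. exact: (ip_le mw w0 (L2_fock u) (L2_fock v)). Qed.

Lemma norm2_ge0 u : 0 <= norm2 u.
Proof. exact: sqnorm_ge0. Qed.

Lemma hnormE u : hnorm inner u = Num.sqrt (norm2 u).
Proof. by congr Num.sqrt; exact: (congr1 (@complex.Re R) (ip_diag mu w u)). Qed.

Lemma hnorm_sqr u : hnorm inner u ^+ 2 = norm2 u.
Proof. by rewrite hnormE sqr_sqrtr// norm2_ge0. Qed.

Lemma norm2_le u v (M : R) : hnorm inner u <= M * hnorm inner v ->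
  norm2 u <= M ^+ 2 * norm2 v.
Proof.
move=> uv; have h0 : 0 <= hnorm inner u by rewrite hnormE sqrtr_ge0.
rewrite -!hnorm_sqr -exprMn lerXn2r ?nnegrE//; exact: le_trans h0 uv.
Qed.

Lemma bounded_norm2 T (K : R) : 0 <= K -> (forall u, norm2 (T u) <= K * norm2 u) ->
  exists M : R, forall u, hnorm inner (T u) <= M * hnorm inner u.
Proof.
move=> K0 TK; exists (Num.sqrt K) => u; rewrite !hnormE -sqrtrM// ler_wsqrtr//.
Qed.

Lemma norm2_lin a u v : norm2 (a *: u + v) <= 2 * cmod a ^+ 2 * norm2 u + 2 * norm2 v.
Proof.
have Lu := L2_fock u; have Lv := L2_fock v.
have ju := L2_integrable mw w0 Lu; have jv := L2_integrable mw w0 Lv.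
have jl : rintegrable mu (fun z => cmod (a * u z + v z) ^+ 2 * w z).
  exact: (L2_integrable mw w0 (L2D mw w0 (L2Z mw w0 a Lu) Lv)).
apply: (@le_trans _ _ (\int[mu]_z (2 * cmod a ^+ 2 * (cmod (u z) ^+ 2 * w z) +
    2 * (cmod (v z) ^+ 2 * w z)))).
  apply: le_Rintegral => //.
    by apply: rintegrableD; exact: rintegrableZ.
  move=> z _; rewrite [2 * cmod a ^+ 2 * _]mulrA [2 * (_ * _)]mulrA -mulrDl.
  by apply: ler_wpM2r; [exact: w0|exact: normc_lin_le].
rewrite RintegralD//; [|exact: rintegrableZ|exact: rintegrableZ].
by rewrite !RintegralZl.
Qed.

(** Stated through inner products with the monomials: by [inner_eq] these determine [T u] for every
    [u], so linearity and commutation are checked coefficient by coefficient. *)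
Definition diagonal_operator : set (A_h -> A_h) := [set T |
  bounded_operator inner T /\ exists lam, forall u x, inner (T u) (e x) = lam x * inner u (e x)].

Lemma diagonal_linear T lam : (forall u x, inner (T u) (e x) = lam x * inner u (e x)) -> linear T.
Proof.
move=> Tl a u v; apply: inner_eq => x.
by rewrite Tl !inner_lin !Tl; ring.
Qed.

Lemma diagonal_emon T lam x : (forall u x, inner (T u) (e x) = lam x * inner u (e x)) ->
  T (e x) = lam x *: e x.
Proof.
move=> Tl; apply: inner_eq => y; rewrite Tl -[lam x *: e x]addr0 inner_lin inner0 addr0.
by have [->//|xy] := eqVneq x y; rewrite inner_emon_orth// !mulr0.
Qed.

Lemma toeplitz_diagonal phi : in_Linfty phi -> torus_invariant phi ->
  diagonal_operator (toeplitz (h_cont := h_cont) phi).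
Proof.
move=> phioo phi_rot; have [lam [C C0 H]] := toeplitzP phioo phi_rot.
have Tl u x := (H u).1 x.
split; last by exists lam => u x; exact: Tl.
split; first exact: (diagonal_linear Tl).
by apply: (bounded_norm2 (sqr_ge0 C)) => u; exact: (H u).2.
Qed.

Lemma diagonal_operator_cstar : cstar_subalgebra inner diagonal_operator.
Proof.
split.
- by move=> T [].
- have Tl u x : inner (@cst A_h A_h 0 u) (e x) = 0 * inner u (e x) by rewrite inner0 mul0r.
  split; last by exists (fun=> 0).
  split; first exact: (diagonal_linear (lam := fun=> 0) Tl).
  by exists 0 => u; rewrite mul0r hnormE -hnorm_sqr /hnorm inner0 /= sqrtr0 expr0n sqrtr0.
- move=> a S T [[linS [M SM]] [lam Sl]] [[linT [N TN]] [lam' Tl]].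
  have Dl u x : inner ((a *: S + T) u) (e x) = (a * lam x + lam' x) * inner u (e x).
    by rewrite -[(a *: S + T) u]/(a *: S u + T u) inner_lin Sl Tl mulrDl mulrA.
  split; last by exists (fun x => a * lam x + lam' x).
  split; first exact: (diagonal_linear Dl).
  apply: (@bounded_norm2 _ (2 * cmod a ^+ 2 * M ^+ 2 + 2 * N ^+ 2)).
    apply: addr_ge0; apply: mulr_ge0 (sqr_ge0 _) => //.
    by apply: mulr_ge0 (sqr_ge0 _).
  move=> u; apply: le_trans (norm2_lin a (S u) (T u)) _.
  have -> : (2 * cmod a ^+ 2 * M ^+ 2 + 2 * N ^+ 2) * norm2 u =
      2 * cmod a ^+ 2 * (M ^+ 2 * norm2 u) + 2 * (N ^+ 2 * norm2 u) by ring.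
  apply: lerD.
    by apply: ler_wpM2l; [apply: mulr_ge0 (sqr_ge0 _)|exact: norm2_le].
  by apply: ler_wpM2l => //; exact: norm2_le.
- move=> S T [[linS [M SM]] [lam Sl]] [[linT [N TN]] [lam' Tl]].
  have Dl u x : inner ((S \o T) u) (e x) = lam x * lam' x * inner u (e x).
    by rewrite /= Sl Tl mulrA.
  split; last by exists (fun x => lam x * lam' x).
  split; first exact: (diagonal_linear Dl).
  apply: (@bounded_norm2 _ (M ^+ 2 * N ^+ 2)); first by apply: mulr_ge0; exact: sqr_ge0.
  move=> u; apply: le_trans (norm2_le (SM (T u))) _; rewrite -mulrA.
  by apply: ler_wpM2l; [exact: sqr_ge0|exact: norm2_le].
(* The adjoint is tested on a monomial, which [T] multiplies by [lam x]; conjugation gives the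
   eigenvalue of [S]. *)
- move=> T S [_ [lam Tl]] Sb TS; split => //; exists (fun x => (lam x)^*) => v x.
  rewrite inner_conj -TS (diagonal_emon x Tl) -[_ *: _]addr0 inner_lin inner0 addr0.
  by rewrite rmorphM /= -inner_conj.
- move=> T Tb H; split => //.
  (* The only possible eigenvalue, read off at [u = e x]. *)
  exists (fun x => inner (T (e x)) (e x) / inner (e x) (e x)) => u x.
  set D := inner (e x) (e x); have D0 : D != 0 := inner_emon_neq0 x.
  apply/eqP; rewrite -subr_eq0 -cmod_eq0 eq_le cmod_ge0 andbT.
  (* Collects the bounds of [ub] at [u] and at [e x], the latter weighted by the modulus of
     [inner u (e x) / D]; the 1 makes [K] positive. *)
  pose K := norm2 u + norm2 (e x) + (norm2 (e x) + norm2 (e x)) * cmod (inner u (e x) / D) + 1.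
  have K0 : 0 < K.
    by rewrite ltr_wpDl// !addr_ge0 ?norm2_ge0// mulr_ge0 ?cmod_ge0// addr_ge0 ?norm2_ge0.
  apply/ler_addgt0Pr => eps e0; rewrite add0r.
  have t0 : 0 < eps / K by rewrite divr_gt0.
  have [S [_ [lam Sl]] ST] := H _ t0; move: t0 ST; set t := eps / K => t0 ST.
  (* [inner_le] at parameter [t^-1]: the norm of [S v - T v] carries [t ^ 2], so both terms end up
     with a factor [t]. *)
  have ub v : cmod (inner (S v - T v) (e x)) <= t * (norm2 v + norm2 (e x)).
    have ti : 0 < t^-1 by rewrite invr_gt0.
    apply: le_trans (inner_le (S v - T v) (e x) ti) _; rewrite invrK mulrDr lerD2r.
    rewrite ler_pdivrMl// mulrA -expr2; exact: norm2_le.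
  (* The contributions of [S] cancel because [S] is diagonal; the defect of [T] is expressed by
     [S - T] alone. *)
  have -> : inner (T u) (e x) - inner (T (e x)) (e x) / D * inner u (e x) =
      inner (S (e x) - T (e x)) (e x) * (inner u (e x) / D) - inner (S u - T u) (e x).
    by rewrite !inner_sub !Sl -/D; field.
  apply: le_trans (cmodB_le _ _) _; rewrite cmodM.
  apply: (@le_trans _ _ (t * K)); last by rewrite /t divfK// gt_eqF.
  have h1 := ub u; have h2 := ub (e x).
  apply: (@le_trans _ _ (t * (norm2 (e x) + norm2 (e x)) * cmod (inner u (e x) / D) +
      t * (norm2 u + norm2 (e x)))).
    by apply: lerD => //; apply: ler_wpM2r => //; exact: cmod_ge0.
  rewrite -mulrA -mulrDr; apply: ler_wpM2l; first exact: ltW.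
  by rewrite /K [leLHS]addrC lerDl.
Qed.

Lemma diagonal_operator_comm S T : diagonal_operator S -> diagonal_operator T ->
  S \o T = T \o S.
Proof.
move=> [_ [lam Sl]] [_ [lam' Tl]]; apply/funext => u; apply: inner_eq => x /=.
by rewrite Sl Tl Tl Sl mulrCA.
Qed.

End weighted_fock.

(** * Diagonal unitary matrices inside the block group *)

Section diagonal_unitary.
Variable R : realType.

Lemma diag_mx_unitary n (d : 'rV[R[i]]_n) : (forall j, cmod (d 0 j) = 1) ->
  diag_mx d \is unitarymx.
Proof.
move=> d1; apply/unitarymxP; rewrite tr_diag_mx map_diag_mx mulmx_diag -diag_const_mx.
by congr diag_mx; apply/rowP => j; rewrite !mxE conj_cmod1.
Qed.

(** A diagonal matrix is block diagonal for every partition, its blocks being the diagonal matrices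
    of the pieces of [d]. Eliminating [b_sum] first makes the cast trivial. *)
Lemma diag_block_unitary n k (b : 'I_k -> nat) (b_sum : (\sum_(i < k) b i)%N = n)
    (d : 'rV[R[i]]_n) : (forall j, cmod (d 0 j) = 1) -> block_unitary b_sum (diag_mx d).
Proof.
case: n / b_sum d => d d1; exists (fun i => diag_mx (submxrow d i)).
  by move=> i; apply: diag_mx_unitary => j; rewrite !mxE.
by rewrite castmx_id -diag_mxrow submxrowK.
Qed.

Lemma invariant_symbol_torus n k (b : 'I_k -> nat) (b_sum : (\sum_(i < k) b i)%N = n)
    (phi : 'cV[R[i]]_n -> R[i]) :
  invariant_symbol (block_unitary b_sum) phi -> torus_invariant phi.
Proof.
move=> inv j t t1; have t0 : t != 0 by rewrite -cmod_gt0 t1.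
(* Invariance is stated with the inverse matrix, so the inverse of [t] is put on the diagonal to
   obtain the rotation by [t]. *)
pose d : 'rV[R[i]]_n := \row_i (if i == j then t^-1 else 1).
have d1 i : cmod (d 0 i) = 1.
  by rewrite mxE; case: eqP => _; rewrite ?cmod1// cmodV t1 invr1.
have U : diag_mx d \in unitmx by exact: unitarymx_unit (diag_mx_unitary d1).
have -> : rot j t = mulmx (invmx (diag_mx d)).
  apply/funext => z; rewrite -[LHS](mulKmx U); congr (_ *m _).
  apply/colP => i; rewrite mul_diag_mx !mxE; case: eqP => [->|_]; last by rewrite mul1r.
  by rewrite mulKf.
exact: inv (diag_block_unitary b_sum d1).
Qed.

End diagonal_unitary.

Theorem proposition5p3 (R : realType) (n : nat) (n_gt0 : (0 < n)%N)
  (h : R -> R)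
  (h_cont : {within `[0, +oo[, continuous h})
  (h_ge0 : forall r, 0 <= r -> 0 <= h r)
  (h_moments : forall m : nat,
    (\int[@lebesgue_measure R]_(r in `[0%R, +oo[)
       (r ^+ (2 * m + 2 * n - 1)%N * expR (- 2 * h r))%:E < +oo)%E)
  (k : nat) (b : 'I_k -> nat) (b_gt0 : forall i, (0 < b i)%N)
  (b_sum : (\sum_(i < k) b i)%N = n)
  (S T : fock_space n h_cont -> fock_space n h_cont) :
  toeplitz_algebra h_cont (block_unitary b_sum) S ->
  toeplitz_algebra h_cont (block_unitary b_sum) T ->
  S \o T = T \o S.
Proof.
suff diag U : toeplitz_algebra h_cont (block_unitary b_sum) U ->
    diagonal_operator (h_cont := h_cont) n_gt0 h_moments U.
  by move=> /diag Sd /diag Td; exact: diagonal_operator_comm Sd Td.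
(* [U] belongs to every C*-subalgebra containing the generators; the diagonal operators are one of
   them. *)
apply; split; first exact: diagonal_operator_cstar.
move=> _ [phi [phioo inv] <-]; apply: toeplitz_diagonal phioo _.
exact: invariant_symbol_torus inv.
Qed.
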